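(* Let $p\ge 0$ be an integer, let $q\ge1$ be an odd integer, let $\Omega\subseteq\mathbb{R}^{p+q+1}$ be a p-symmetric slice domain and let $f\in\mathcal{GSM}(\Omega)$. Write $f(\boldsymbol{x})=F_1(\boldsymbol{x}')+\underline{\omega}F_2(\boldsymbol{x}')$ with $F_1,F_2$ as given by the representation formula (see context). Then $$\tau_qf(\boldsymbol{x}):=\frac{1}{(q-1)!!}\Delta_{\boldsymbol{x}}^{\frac{q-1}{2}}f(\boldsymbol{x})=A(\boldsymbol{x}')+\underline{\omega}B(\boldsymbol{x}')\in\mathcal{M}(\Omega),$$ where $$A(\boldsymbol{x}')=\Big(\frac1r\partial_r\Big)^{\frac{q-1}{2}}F_1(\boldsymbol{x}'),\qquad B(\boldsymbol{x}')=\Big(\partial_r\frac1r\Big)^{\frac{q-1}{2}}F_2(\boldsymbol{x}').$$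
   Context: $\mathbb{R}_{p+q}$ is the real Clifford algebra generated by $e_1,\dots,e_{p+q}$ with $e_ie_j+e_je_i=-2\delta_{ij}$; $e_0=1$. A point of $\mathbb{R}^{p+q+1}$ is identified with the paravector $\boldsymbol{x}=\boldsymbol{x}_p+\underline{\boldsymbol{x}}_q$, $\boldsymbol{x}_p=\sum_{i=0}^p x_ie_i\in\mathbb{R}^{p+1}$, $\underline{\boldsymbol{x}}_q=\sum_{i=p+1}^{p+q}x_ie_i\in\mathbb{R}^q$. $\mathbb{S}$ is the unit sphere $\{\sum_{i=p+1}^{p+q}x_ie_i:\sum x_i^2=1\}$ of $\mathbb{R}^q$. One writes $\underline{\boldsymbol{x}}_q=r\underline{\omega}$ with $r=|\underline{\boldsymbol{x}}_q|$, $\underline{\omega}\in\mathbb{S}$ ($\underline{\omega}$ arbitrary if $r=0$), and $\boldsymbol{x}'=(\boldsymbol{x}_p,r)$. Operators (acting from the left): $D_{\boldsymbol{x}_p}=\sum_{i=0}^p e_i\partial_{x_i}$, $D_{\boldsymbol{x}}=\sum_{i=0}^{p+q}e_i\partial_{x_i}$; $\Delta_{\boldsymbol{x}}=\sum_{i=0}^{p+q}\partial_{x_i}^2$. $\mathcal{M}(\Omega)$ is the set of monogenic functions on $\Omega$, i.e. $C^1$ functions $f:\Omega\to\mathbb{R}_{p+q}$ with $D_{\boldsymbol{x}}f=0$. For a domain $\Omega\subseteq\mathbb{R}^{p+q+1}$ and $\underline{\omega}\in\mathbb{S}$, $\Omega_{\underline{\omega}}=\Omega\cap(\mathbb{R}^{p+1}\oplus\underline{\omega}\mathbb{R})$,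 viewed in $\mathbb{R}^{p+2}$. $\Omega$ is a slice domain if $\Omega\cap\mathbb{R}^{p+1}\ne\emptyset$ and each $\Omega_{\underline{\omega}}$ is a domain in $\mathbb{R}^{p+2}$; $\Omega$ is p-symmetric if $\boldsymbol{x}_p+r\underline{\omega}\in\Omega$ (with $r>0$, $\underline\omega\in\mathbb{S}$) implies $\boldsymbol{x}_p+r\underline{\eta}\in\Omega$ for all $\underline{\eta}\in\mathbb{S}$. $\mathcal{GSM}(\Omega)$ (generalized partial-slice monogenic functions of type $(p,q)$) is the set of $f:\Omega\to\mathbb{R}_{p+q}$ such that for every $\underline{\omega}\in\mathbb{S}$ the restriction of $f$ to $\Omega_{\underline{\omega}}$ has continuous partial derivatives and satisfies $(D_{\boldsymbol{x}_p}+\underline{\omega}\partial_r)f(\boldsymbol{x}_p+r\underline{\omega})=0$ on $\Omega_{\underline{\omega}}$. Representation formula (known): for $f\in\mathcal{GSM}(\Omega)$ on a p-symmetric slice domain, the functions $F_1(\boldsymbol{x}_p,r)=\frac12\big(f(\boldsymbol{x}_p+r\underline{\eta})+f(\boldsymbol{x}_p-r\underline{\eta})\big)$ and $F_2(\boldsymbol{x}_p,r)=\frac12\underline{\eta}\big(f(\boldsymbol{x}_p-r\underline{\eta})-f(\boldsymbol{x}_p+r\underline{\eta})\big)$ do not depend on $\underline{\eta}\in\mathbb{S}$, and $f(\boldsymbol{x}_p+r\underline{\omega})=F_1(\boldsymbol{x}_p,r)+\underline{\omega}F_2(\boldsymbol{x}_p,r)$ for all $\underline\omega\in\mathbb{S}$.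 $(\frac1r\partial_r)^k$ is the $k$-th iterate of $F\mapsto\frac1r\partial_rF$, and $(\partial_r\frac1r)^k$ the $k$-th iterate of $F\mapsto\partial_r(F/r)$. Convention: the values of $(\frac1r\partial_r)^kF_1$ and $(\partial_r\frac1r)^kF_2$ at points with $r=0$ are understood as the limits as $r\to0$ (which exist). $(2m)!!=2\cdot4\cdots(2m)$, $0!!=1$. *)

(* Defs.v *)
From HB Require Import structures.
From mathcomp Require Import all_boot all_order all_algebra.
From mathcomp Require Import all_classical all_reals all_analysis.

Set Implicit Arguments.
Unset Strict Implicit.
Unset Printing Implicit Defensive.

Import Order.TTheory GRing.Theory Num.Theory.
Import numFieldNormedType.Exports.

Local Open Scope classical_set_scope.
Local Open Scope ring_scope.

(* The coordinate of index [enum_rank A] is that of the blade [e_A], the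
   increasing product of the generators indexed by [A]; [e_i ^+ 2 = -1]. *)
Definition clifford (R : realType) (n : nat) : Type := 'rV[R]_#|{set 'I_n}|.

Section CliffordAlgebra.
Context {R : realType} {n : nat}.

HB.instance Definition _ := NormedModule.copy (clifford R n) 'rV[R]_#|{set 'I_n}|.

Definition ccoef (x : clifford R n) (A : {set 'I_n}) : R :=
  (x : 'rV[R]__) 0 (enum_rank A).

Definition blade (A : {set 'I_n}) : clifford R n :=
  delta_mx 0 (enum_rank A) : 'rV[R]__.

Definition set_symdiff (A B : {set 'I_n}) : {set 'I_n} :=
  ((A :\: B) :|: (B :\: A))%SET.

(* Moving each [e_b] of [e_B] to the left past the [e_a], [b < a], of [e_A]
   changes the sign once per pair, and each common generator contributes
   [e_b * e_b = -1]: one sign for every pair [b <= a]. *)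
Definition blade_sign (A B : {set 'I_n}) : R :=
  (-1) ^+ (\sum_(a in A) \sum_(b in B) (b <= a)%N)%N.

Definition cmul (x y : clifford R n) : clifford R n :=
  \sum_A \sum_B
    (blade_sign A B * ccoef x A * ccoef y B) *: blade (set_symdiff A B).

Lemma odd_sum_symdiff (F : 'I_n -> nat) (A B : {set 'I_n}) :
  odd (\sum_(a in set_symdiff A B) F a) =
  odd (\sum_(a in A) F a) (+) odd (\sum_(a in B) F a).
Proof.
rewrite (big_setID (A := A) B) (big_setID (A := B) A) /= finset.setIC.
rewrite !oddD addbACA addbb /= -oddD; congr odd.
have dAB : fintype.disjoint (mem (A :\: B)%SET) (mem (B :\: A)%SET).
  rewrite -setI_eq0; apply/eqP/setP => i; rewrite !inE.
  by case: (i \in A); case: (i \in B).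
by rewrite -bigU //=; apply: eq_bigl => i; rewrite !inE.
Qed.

Lemma odd_sum_odd (I : finType) (P : pred I) (F G : I -> nat) :
  (forall i, P i -> odd (F i) = odd (G i)) ->
  odd (\sum_(i | P i) F i)%N = odd (\sum_(i | P i) G i)%N.
Proof.
move=> FG; elim/big_ind2: _ => // a b c d.
by rewrite !oddD => -> ->.
Qed.

Lemma blade_sign_symdiffl (A B C : {set 'I_n}) :
  blade_sign (set_symdiff A B) C = blade_sign A C * blade_sign B C.
Proof.
by rewrite /blade_sign -signr_odd odd_sum_symdiff signr_addb !signr_odd.
Qed.

Lemma blade_sign_symdiffr (A B C : {set 'I_n}) :
  blade_sign A (set_symdiff B C) = blade_sign A B * blade_sign A C.
Proof.
rewrite /blade_sign -exprD -big_split -[LHS]signr_odd -[RHS]signr_odd.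
congr (_ ^+ _); congr nat_of_bool; apply: odd_sum_odd => a _ /=.
by rewrite odd_sum_symdiff oddD.
Qed.

Lemma blade_sign0l (A : {set 'I_n}) : blade_sign finset.set0 A = 1.
Proof. by rewrite /blade_sign big_set0 expr0. Qed.

Lemma blade_sign0r (A : {set 'I_n}) : blade_sign A finset.set0 = 1.
Proof.
by rewrite /blade_sign big1 ?expr0// => a _; rewrite big_set0.
Qed.

Lemma set_symdiffA : associative set_symdiff.
Proof.
move=> A B C; apply/setP => i; rewrite !inE.
by case: (i \in A); case: (i \in B); case: (i \in C).
Qed.

Lemma set_symdiff0l : left_id finset.set0 set_symdiff.
Proof. by move=> A; apply/setP => i; rewrite !inE; case: (i \in A). Qed.

Lemma set_symdiff0r : right_id finset.set0 set_symdiff.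
Proof. by move=> A; apply/setP => i; rewrite !inE; case: (i \in A). Qed.

Lemma ccoefD (x y : clifford R n) A : ccoef (x + y) A = ccoef x A + ccoef y A.
Proof. by rewrite /ccoef mxE. Qed.

Lemma ccoefZ a (x : clifford R n) A : ccoef (a *: x) A = a * ccoef x A.
Proof. by rewrite /ccoef mxE. Qed.

Lemma ccoef_blade A B : ccoef (blade A) B = (A == B)%:R.
Proof.
by rewrite /ccoef mxE eqxx /= (inj_eq enum_rank_inj) eq_sym.
Qed.

Lemma cliffordP (x y : clifford R n) : (forall A, ccoef x A = ccoef y A) -> x = y.
Proof.
move=> xy; apply/(@rowP R #|{set 'I_n}|) => k.
by have := xy (enum_val k); rewrite /ccoef enum_valK.
Qed.

Lemma ccoef_sum I (r : seq I) (F : I -> clifford R n) A :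
  ccoef (\sum_(i <- r) F i) A = \sum_(i <- r) ccoef (F i) A.
Proof.
elim: r => [|i r IH]; first by rewrite !big_nil /ccoef mxE.
by rewrite !big_cons ccoefD IH.
Qed.

Lemma clifford_blade (x : clifford R n) : x = \sum_A ccoef x A *: blade A.
Proof.
apply: cliffordP => B; rewrite ccoef_sum (bigD1 B) //= big1.
  by rewrite addr0 ccoefZ ccoef_blade eqxx mulr1.
by move=> A /negbTE neA; rewrite ccoefZ ccoef_blade neA mulr0.
Qed.

Lemma cmulDl : left_distributive cmul +%R.
Proof.
move=> x y z; rewrite /cmul -big_split; apply: eq_bigr => A _ /=.
rewrite -big_split; apply: eq_bigr => B _ /=.
by rewrite ccoefD mulrDr mulrDl scalerDl.
Qed.

Lemma cmulDr : right_distributive cmul +%R.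
Proof.
move=> x y z; rewrite /cmul -big_split; apply: eq_bigr => A _ /=.
rewrite -big_split; apply: eq_bigr => B _ /=.
by rewrite ccoefD mulrDr scalerDl.
Qed.

Lemma cmulZl a (x y : clifford R n) : cmul (a *: x) y = a *: cmul x y.
Proof.
rewrite /cmul scaler_sumr; apply: eq_bigr => A _.
rewrite scaler_sumr; apply: eq_bigr => B _.
by rewrite ccoefZ scalerA mulrCA !mulrA.
Qed.

Lemma cmulZr a (x y : clifford R n) : cmul x (a *: y) = a *: cmul x y.
Proof.
rewrite /cmul scaler_sumr; apply: eq_bigr => A _.
rewrite scaler_sumr; apply: eq_bigr => B _.
by rewrite ccoefZ scalerA mulrCA.
Qed.

Lemma cmul_blade A B :
  cmul (blade A) (blade B) = blade_sign A B *: blade (set_symdiff A B).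
Proof.
rewrite /cmul (bigD1 A) //= (bigD1 B) //= !ccoef_blade !eqxx !mulr1.
rewrite !big1 ?addr0// => [C neC|C neC]; last first.
  by rewrite ccoef_blade [B == C]eq_sym (negbTE neC) mulr0 scale0r.
rewrite big1// => D _.
by rewrite ccoef_blade [A == C]eq_sym (negbTE neC) mulr0 mul0r scale0r.
Qed.

Lemma cmul0l (x : clifford R n) : cmul 0 x = 0.
Proof. by rewrite -[X in cmul X _](scale0r (0 : clifford R n)) cmulZl scale0r. Qed.

Lemma cmul0r (x : clifford R n) : cmul x 0 = 0.
Proof. by rewrite -[X in cmul _ X](scale0r (0 : clifford R n)) cmulZr scale0r. Qed.

Lemma cmul_suml I (r : seq I) (F : I -> clifford R n) y :
  cmul (\sum_(i <- r) F i) y = \sum_(i <- r) cmul (F i) y.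
Proof.
by elim: r => [|i r IH]; rewrite ?(big_nil, cmul0l)// !big_cons cmulDl IH.
Qed.

Lemma cmul_sumr I (r : seq I) (F : I -> clifford R n) y :
  cmul y (\sum_(i <- r) F i) = \sum_(i <- r) cmul y (F i).
Proof.
by elim: r => [|i r IH]; rewrite ?(big_nil, cmul0r)// !big_cons cmulDr IH.
Qed.

Lemma cmulA : associative cmul.
Proof.
have bladeA A B C : cmul (blade A) (cmul (blade B) (blade C)) =
    cmul (cmul (blade A) (blade B)) (blade C).
  rewrite [cmul (blade B) _]cmul_blade [cmul (blade A) (blade B)]cmul_blade.
  rewrite cmulZr cmulZl !cmul_blade !scalerA set_symdiffA.
  by rewrite blade_sign_symdiffl blade_sign_symdiffr [in LHS]mulrC mulrA.
move=> x y z.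
rewrite (clifford_blade x); elim: (index_enum _) => [|A xs IH].
  by rewrite big_nil !cmul0l.
rewrite big_cons !cmulDl IH; congr (_ + _); rewrite !cmulZl; congr (_ *: _).
rewrite (clifford_blade y); elim: (index_enum _) => [|B ys IHy].
  by rewrite big_nil cmul0l cmul0r cmul0l.
rewrite big_cons !(cmulDl, cmulDr) IHy; congr (_ + _).
rewrite !(cmulZl, cmulZr); congr (_ *: _).
rewrite (clifford_blade z); elim: (index_enum _) => [|C zs IHz].
  by rewrite big_nil !cmul0r.
by rewrite big_cons !cmulDr IHz !cmulZr bladeA.
Qed.

Lemma cmul1l : left_id (blade finset.set0) cmul.
Proof.
move=> x; rewrite {2}(clifford_blade x) {1}(clifford_blade x) cmul_sumr.
apply: eq_bigr => A _.
by rewrite cmulZr cmul_blade blade_sign0l set_symdiff0l scale1r.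
Qed.

Lemma cmul1r : right_id (blade finset.set0) cmul.
Proof.
move=> x; rewrite {2}(clifford_blade x) {1}(clifford_blade x) cmul_suml.
apply: eq_bigr => A _.
by rewrite cmulZl cmul_blade blade_sign0r set_symdiff0r scale1r.
Qed.

Lemma blade0_neq0 : blade finset.set0 != 0.
Proof.
apply/eqP => /(congr1 (ccoef ^~ finset.set0)).
rewrite ccoef_blade eqxx /ccoef mxE => /eqP; by rewrite oner_eq0.
Qed.

HB.instance Definition _ := GRing.Zmodule_isNzRing.Build (clifford R n)
  cmulA cmul1l cmul1r cmulDl cmulDr blade0_neq0.

Lemma clifford_scalerAl (a : R) (x y : clifford R n) :
  a *: (x * y) = (a *: x) * y.
Proof. by rewrite [RHS]cmulZl. Qed.

HB.instance Definition _ :=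
  GRing.Lmodule_isLalgebra.Build R (clifford R n) clifford_scalerAl.

Lemma clifford_scalerAr (a : R) (x y : clifford R n) :
  a *: (x * y) = x * (a *: y).
Proof. by rewrite [RHS]cmulZr. Qed.

HB.instance Definition _ :=
  GRing.Lalgebra_isAlgebra.Build R (clifford R n) clifford_scalerAr.

Definition gen (i : 'I_n) : clifford R n := blade [set i]%SET.

Lemma gen_anticomm (i j : 'I_n) :
  gen i * gen j + gen j * gen i = ((-2) *+ (i == j))%:A.
Proof.
rewrite [gen i * _]cmul_blade [gen j * _]cmul_blade /blade_sign !big_set1.
have -> : set_symdiff [set j]%SET [set i]%SET = set_symdiff [set i]%SET [set j]%SET.
  by rewrite /set_symdiff finset.setUC.
rewrite -scalerDl; have [->|neij] := eqVneq i j.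
  rewrite leqnn expr1 mulr1n (_ : set_symdiff _ _ = finset.set0).
    by congr (_ *: _); rewrite -opprD.
  by apply/setP => k; rewrite !inE; case: eqP.
rewrite mulr0n !scale0r; have := neij; rewrite -val_eqE /= => neij'.
have -> : (-1) ^+ (j <= i)%N + (-1) ^+ (i <= j)%N = 0 :> R.
  by case: ltngtP neij' => //= _ _; rewrite expr1 expr0 ?addrN ?addNr.
by rewrite scale0r.
Qed.

(* [e_0 = 1], and [e_(i + 1)] is the generator of index [i : 'I_n]. *)
Definition pgen (i : 'I_n.+1) : clifford R n :=
  if unlift ord0 i is Some j then gen j else 1.

End CliffordAlgebra.

Fixpoint double_factorial (n : nat) : nat :=
  if n is n'.+2 then (n * double_factorial n')%N else 1%N.

Section Calculus.
Context {R : realType} {m : nat} {W : normedModType R}.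

Definition partial (i : 'I_m) (F : 'rV[R]_m -> W) : 'rV[R]_m -> W :=
  'D_(delta_mx 0 i) F.

Definition has_partial (i : 'I_m) (F : 'rV[R]_m -> W) (x : 'rV[R]_m) : Prop :=
  derivable F x (delta_mx 0 i).

(* Meant for open [D], where continuity at the points of [D] only depends on
   the values on [D]. *)
Definition C1_on (D : set 'rV[R]_m) (F : 'rV[R]_m -> W) : Prop :=
  forall i x, D x -> has_partial i F x /\ {for x, continuous (partial i F)}.

Definition laplacian (F : 'rV[R]_m -> W) (x : 'rV[R]_m) : W :=
  \sum_i partial i (partial i F) x.

(* ['D_v] is a total operator; this says that every derivative occurring in
   [iter k laplacian F] exists on [D]. *)
Definition laplacian_iterable (D : set 'rV[R]_m) (k : nat) (F : 'rV[R]_m -> W)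
    : Prop :=
  forall j i x, (j < k)%N -> D x ->
    has_partial i (iter j laplacian F) x /\
    has_partial i (partial i (iter j laplacian F)) x.

End Calculus.

Definition domain {T : topologicalType} (D : set T) : Prop :=
  [/\ D !=set0, open D & connected D].

Section PartialSlice.
Context {R : realType} {p q : nat}.

(* [x = x_p + x_q] is [row_mx x_p x_q], [x' = (x_p, r)] is [row_mx x_p r%:M]. *)
Local Notation point := 'rV[R]_(p.+1 + q).
Local Notation spoint := 'rV[R]_(p.+1 + 1).
Local Notation cliff := (clifford R (p + q)).

Definition sphere : set 'rV[R]_q := [set w | \sum_j w 0 j ^+ 2 = 1].

(* Elements of [R^q] are spanned by [e_(p+1), ..., e_(p+q)]. *)
Definition vec (w : 'rV[R]_q) : cliff :=
  \sum_(j < q) w 0 j *: pgen (rshift p.+1 j).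

Definition ridx : 'I_(p.+1 + 1) := rshift p.+1 ord0.

Definition rad (x' : spoint) : R := x' 0 ridx.

Definition slice_point (w : 'rV[R]_q) (x' : spoint) : point :=
  row_mx (lsubmx x') (rad x' *: w).

Definition slice (Omega : set point) (w : 'rV[R]_q) : set spoint :=
  slice_point w @^-1` Omega.

Definition slice_domain (Omega : set point) : Prop :=
  [/\ domain Omega,
      exists xp : 'rV[R]_p.+1, Omega (row_mx xp 0)
    & forall w, sphere w -> domain (slice Omega w)].

Definition p_symmetric (Omega : set point) : Prop :=
  forall (xp : 'rV[R]_p.+1) (r : R) (w : 'rV[R]_q), 0 < r -> sphere w ->
    Omega (row_mx xp (r *: w)) ->
    forall eta, sphere eta -> Omega (row_mx xp (r *: eta)).

Definition dirac (f : point -> cliff) (x : point) : cliff :=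
  \sum_(i < p.+1 + q) pgen i * partial i f x.

Definition monogenic (Omega : set point) (f : point -> cliff) : Prop :=
  C1_on Omega f /\ forall x, Omega x -> dirac f x = 0.

Definition slice_dirac (w : 'rV[R]_q) (g : spoint -> cliff) (x' : spoint)
    : cliff :=
  \sum_(i < p.+1) pgen (lshift q i) * partial (lshift 1 i) g x'
    + vec w * partial ridx g x'.

Definition GSM (Omega : set point) (f : point -> cliff) : Prop :=
  forall w, sphere w ->
    C1_on (slice Omega w) (f \o slice_point w) /\
    forall x', slice Omega w x' -> slice_dirac w (f \o slice_point w) x' = 0.

(* The functions [F_1] and [F_2] of the representation formula, computed with
   the unit vector [eta]. *)
Definition F1 (f : point -> cliff) (eta : 'rV[R]_q) (x' : spoint) : cliff :=
  let xp := lsubmx x' in let r := rad x' in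
  2^-1 *: (f (row_mx xp (r *: eta)) + f (row_mx xp (- (r *: eta)))).

Definition F2 (f : point -> cliff) (eta : 'rV[R]_q) (x' : spoint) : cliff :=
  let xp := lsubmx x' in let r := rad x' in
  2^-1 *: (vec eta * (f (row_mx xp (- (r *: eta))) - f (row_mx xp (r *: eta)))).

Definition div_r (F : spoint -> cliff) (x' : spoint) : cliff :=
  (rad x')^-1 *: F x'.

(* Both are only meaningful where [rad x' != 0]. *)
Definition inv_r_dr (F : spoint -> cliff) : spoint -> cliff :=
  div_r (partial ridx F).

Definition dr_inv_r (F : spoint -> cliff) : spoint -> cliff :=
  partial ridx (div_r F).

Definition cvg_r0 (F : spoint -> cliff) (xp : 'rV[R]_p.+1) : Prop :=
  cvg (F (row_mx xp r%:M) @[r --> 0^']).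

Definition extend_r0 (F : spoint -> cliff) (x' : spoint) : cliff :=
  if rad x' == 0 then lim (F (row_mx (lsubmx x') r%:M) @[r --> 0^']) else F x'.

Definition stemA (k : nat) (F : spoint -> cliff) : spoint -> cliff :=
  extend_r0 (iter k inv_r_dr F).

Definition stemB (k : nat) (F : spoint -> cliff) : spoint -> cliff :=
  extend_r0 (iter k dr_inv_r F).

(* All derivatives and limits involved in [stemA k F] (resp. [stemB k F])
   exist at the points [x'] of [D]. *)
Definition stemA_exists (D : set spoint) (k : nat) (F : spoint -> cliff)
    : Prop :=
  forall x', D x' ->
    (rad x' != 0 -> forall j, (j < k)%N ->
       has_partial ridx (iter j inv_r_dr F) x') /\
    (rad x' = 0 -> cvg_r0 (iter k inv_r_dr F) (lsubmx x')).

Definition stemB_exists (D : set spoint) (k : nat) (F : spoint -> cliff)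
    : Prop :=
  forall x', D x' ->
    (rad x' != 0 -> forall j, (j < k)%N ->
       has_partial ridx (div_r (iter j dr_inv_r F)) x') /\
    (rad x' = 0 -> cvg_r0 (iter k dr_inv_r F) (lsubmx x')).

Definition tau (f : point -> cliff) (x : point) : cliff :=
  (double_factorial q.-1)%:R^-1 *: iter q.-1./2 laplacian f x.

End PartialSlice.

(* Main.v *)
Require Import Defs.
From HB Require Import structures.
From mathcomp Require Import all_boot all_order all_algebra.
From mathcomp Require Import all_classical all_reals all_analysis.
From mathcomp Require Import ring lra.

Set Implicit Arguments.
Unset Strict Implicit.
Unset Printing Implicit Defensive.

Import Order.TTheory GRing.Theory Num.Theory.
Import numFieldNormedType.Exports.

Local Open Scope classical_set_scope.
Local Open Scope ring_scope.

(* On each slice, [f] solves a first-order system with constant Clifford symbol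
   which factors the Laplacian.  The maximum principle with a quadratic barrier
   bounds the gradient of a [C^2] harmonic function by its supremum; averaging
   along the axes carries the bound over to [C^1] solutions of the system, the
   bound applied to difference quotients makes solutions smooth, and iterated in
   Taylor's formula it gives unique continuation.  Unique continuation from
   [r = 0] gives the representation formula, and [F1], [F2] satisfy the Vekua
   system [D F1 = d_r F2], [Dbar F2 = - d_r F1].

   In [r], [F1] is even and [F2 = r H] with [H] smooth and even, so that
   [f = F1 + x_q H] at [(x_p, |x_q|)].  Let [E = (1/r) d_r] and
   [Q_c = Delta_p + c E + r^2 E^2].  For even [G], the Laplacian of
   [G (x_p, |x_q|)] is [Q_q G], that of [x_q G (x_p, |x_q|)] is [x_q Q_(q+2) G],
   and [Q_c G = 0] implies [Q_(c+2) (E G) = 0].  Since [F1], [F2] are harmonic,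
   [Q_1 F1 = 0] and [Q_3 H = 0]; hence the [k+1]-st Laplacian of [f] replaces
   [E^k F1 + x_q E^k H] by [(q-1-2k) (E^(k+1) F1 + x_q E^(k+1) H)].  Applying [E]
   to the Vekua system [k] times gives
   [D E^k F1 = (1+2k) E^k H + r^2 E^(k+1) H] and [Dbar E^k H = - E^(k+1) F1],
   which for [1+2k = q] says that [E^k F1 + x_q E^k H] is monogenic. *)

(** * Directional derivatives *)

(** Membership in [GSM] gives continuous first derivatives only, and only inside each slice, while
    the conclusion differentiates up to [q] times in all variables, with no information on how [f]
    varies from one slice to another. Smoothness must therefore be produced on the slices; and since
    a [C^1] solution has no second derivatives yet, it cannot be called harmonic before it has been
    averaged, which is why the gradient bound has to be carried over.

    The second obstacle is the set [r = 0], where [|x_q|] is not differentiable and the direction is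
    undefined. Parity in [r] removes both defects: an even smooth function of [r] stays smooth after
    substituting [|x_q|], and the direction occurs only in the product [x_q] of direction and [r].

    The constant [(q-1)!!] is the product of the factors [q - c] left by the successive Laplacians,
    where [c] runs through [1, 3, ..., q-2]; since [q] is odd, the next value of [c] is exactly [q],
    and the process stops after [(q-1)/2] steps. *)

Section DirectionalDerivatives.
Context {R : realType} {V W : normedModType R}.
Implicit Types (F G : V -> W) (x v : V).

Lemma is_derive_line F x v t : derivable F (t *: v + x) v ->
  is_derive t 1 (fun s : R => F (s *: v + x)) ('D_v F (t *: v + x)).
Proof.
move=> dF.
have E : (fun h : R => h^-1 *: (F ((h *: 1 + t) *: v + x) - F (t *: v + x))) =
         (fun h : R => h^-1 *: (F (h *: v + (t *: v + x)) - F (t *: v + x))).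
  by apply/funext => h; rewrite [h *: 1]mulr1 scalerDl addrA.
by apply: DeriveDef; [rewrite /derivable E|rewrite /derive E].
Qed.

(** The substitution [h -> c h] carries one difference quotient to the other, so homogeneity in the
    direction follows from the existence of the single derivative along [v]. *)
Lemma is_derive_scalev F x v c : derivable F x v ->
  is_derive x (c *: v) F (c *: 'D_v F x).
Proof.
move=> dF; have [->|c0] := eqVneq c 0; first by rewrite !scale0r; exact: is_derive0.
suff : (fun h : R => h^-1 *: (F (h *: (c *: v) + x) - F x)) @ 0^' --> c *: 'D_v F x.
  by move=> H; apply: DeriveDef; [apply/cvg_ex; eexists; exact: H|exact/cvg_lim].
have -> : (fun h : R => h^-1 *: (F (h *: (c *: v) + x) - F x)) =
   (fun h => c *: (fun k => k^-1 *: (F (k *: v + x) - F x)) (c * h)).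
  apply/funext => h /=; rewrite invfM !scalerA mulrA divff// mul1r.
  by rewrite [h * c]mulrC.
apply: cvgZl_tmp; apply: (@cvg_comp _ _ _ (fun h => c * h) _ _ (0:R)^') dF.
move=> A [e /= e0 eA]; exists (e / `|c|) => /=; first by rewrite divr_gt0// normr_gt0.
move=> h /=; rewrite sub0r normrN => he h0; apply: eA => /=.
  by rewrite sub0r normrN normrM mulrC -ltr_pdivlMr ?normr_gt0.
by rewrite mulf_neq0.
Qed.

Lemma derive_eq_near F G x v (U : set V) : open U -> U x ->
  (forall y, U y -> F y = G y) -> 'D_v F x = 'D_v G x.
Proof.
move=> oU Ux FG; apply: near_eq_derive.
by apply: filterS FG _; exact: open_nbhs_nbhs.
Qed.

Lemma derivable_eq_near F G x v (U : set V) : open U -> U x ->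
  (forall y, U y -> F y = G y) -> derivable F x v -> derivable G x v.
Proof.
move=> oU Ux FG; apply: near_eq_derivable.
by apply: filterS FG _; exact: open_nbhs_nbhs.
Qed.

Lemma continuous_eq_near F G x (U : set V) : open U -> U x ->
  (forall y, U y -> F y = G y) -> {for x, continuous F} -> {for x, continuous G}.
Proof.
move=> oU Ux FG cF; change (G @ x --> G x); rewrite -(FG _ Ux).
apply: cvg_trans cF; apply: near_eq_cvg.
by apply: (filterS (P := U)) => [y /FG//|]; exact: open_nbhs_nbhs.
Qed.

(* [F] need not be continuous at [x], only along the line of direction [v]. *)
Lemma is_derive_scale (a : V -> R) F x v : derivable a x v -> derivable F x v ->
  is_derive x v (fun y => a y *: F y) ('D_v a x *: F x + a x *: 'D_v F x).
Proof.
move=> da dF.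
suff : (fun h : R => h^-1 *: (a (h *: v + x) *: F (h *: v + x) - a x *: F x)) @ 0^'
    --> 'D_v a x *: F x + a x *: 'D_v F x.
  by move=> H; apply: DeriveDef; [apply/cvg_ex; eexists; exact: H|exact/cvg_lim].
have cF : F (h *: v + x) @[h --> (0:R)^'] --> F x.
  apply: cvg_within_filter.
  have /derivable1P/derivable1_diffP/differentiable_continuous H := dF.
  have : F (h *: v + x) @[h --> (0:R)] --> F (0 *: v + x) by exact: H.
  by rewrite scale0r add0r.
have -> : (fun h : R => h^-1 *: (a (h *: v + x) *: F (h *: v + x) - a x *: F x)) =
  (fun h => (h^-1 *: (a (h *: v + x) - a x)) *: F (h *: v + x) +
            a x *: (h^-1 *: (F (h *: v + x) - F x))).
  apply/funext => h; rewrite scalerA [a x * _]mulrC -!scalerA -scalerDr; congr (_ *: _).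
  by rewrite scalerBl scalerBr addrA subrK.
apply: cvgD; last exact: cvgZl_tmp.
exact: cvgZ.
Qed.

End DirectionalDerivatives.

Section LineCalculus.
Context {R : realType} {V : normedModType R}.

Lemma mvt_line (g : V -> R) (x w : V) :
  (forall t : R, 0 <= t <= 1 -> derivable g (t *: w + x) w) ->
  exists2 t : R, 0 <= t <= 1 & g (w + x) - g x = 'D_w g (t *: w + x).
Proof.
move=> dg.
have D (t : R) : 0 <= t <= 1 -> is_derive t 1 (fun s : R => g (s *: w + x)) ('D_w g (t *: w + x)).
  by move=> t01; apply: is_derive_line; exact: dg.
have [||t t01] := @MVT_segment R (fun s => g (s *: w + x)) (fun t => 'D_w g (t *: w + x)) 0 1 ler01.
- by move=> t; rewrite in_itv/= => /andP[t0 t1]; apply: D; rewrite !ltW.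
- apply: derivable_within_continuous => t; rewrite in_itv/= => t01.
  by have [] := D t t01.
- rewrite scale1r scale0r add0r subr0 mulr1 => E; exists t.
    by move: t01; rewrite in_itv.
  exact: E.
Qed.

(** A mean value inequality in which the bound on the speed is itself a derivative: [g - f] and
    [g + f] have nonnegative derivative. The bound may then grow along the path, as Taylor estimates
    require. *)
Lemma derive_le_comparison (f g f' g' : R -> R) (T : R) : 0 <= T ->
  (forall t : R, 0 <= t <= T -> is_derive t 1 f (f' t)) ->
  (forall t : R, 0 <= t <= T -> is_derive t 1 g (g' t)) ->
  (forall t : R, 0 <= t <= T -> `|f' t| <= g' t) ->
  `|f T - f 0| <= g T - g 0.
Proof.
move=> T0 df dg fg.
have key (s : R) : `|s| = 1 -> s * (f T - f 0) <= g T - g 0.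
  move=> s1.
  have dh (t : R) : 0 <= t <= T -> is_derive t 1 (fun t => g t - s * f t) (g' t - s * f' t).
    move=> tT; have := dg t tT; have := df t tT => ? ?.
    exact: is_deriveB.
  have [||t tT] := @MVT_segment R (fun t => g t - s * f t) (fun t => g' t - s * f' t) 0 T T0.
  - by move=> t; rewrite in_itv/= => /andP[t0 t1]; apply: dh; rewrite !ltW.
  - apply: derivable_within_continuous => t; rewrite in_itv/= => t01.
    by have [] := dh t t01.
  rewrite subr0 => E; rewrite -subr_ge0.
  have -> : g T - g 0 - s * (f T - f 0) = (g' t - s * f' t) * T by rewrite -E; ring.
  apply: mulr_ge0 => //; rewrite subr_ge0; apply: le_trans (fg t _); last by move: tT; rewrite in_itv.
  by apply: le_trans (ler_norm _) _; rewrite normrM s1 mul1r.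
rewrite ler_norml; apply/andP; split.
  by have := key (-1); rewrite normrN normr1 => /(_ erefl); lra.
by have := key 1; rewrite normr1 => /(_ erefl); lra.
Qed.

End LineCalculus.

(** The inner map sends the line of direction [v] to a line of direction [w] at the same speed, so
    the difference quotients coincide; only the derivative of [F] along [w] enters. *)
Lemma is_derive_affine {R : realType} {V V' W : normedModType R} (F : V' -> W)
    (L : V -> V') (x v : V) (w : V') :
  (forall h : R, L (h *: v + x) = h *: w + L x) -> derivable F (L x) w ->
  is_derive x v (F \o L) ('D_w F (L x)).
Proof.
move=> Lvw dF.
have E : (fun h : R => h^-1 *: (F (L (h *: v + x)) - F (L x))) =
         (fun h : R => h^-1 *: (F (h *: w + L x) - F (L x))).
  by apply/funext => h; rewrite Lvw.
by apply: DeriveDef; [rewrite /derivable E|rewrite /derive E].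
Qed.

Lemma partial_val {R : realType} {m : nat} {W : normedModType R} (F : 'rV[R]_m -> W)
  (i : 'I_m) x d : is_derive x (delta_mx 0 i) F d -> partial i F x = d.
Proof. by case. Qed.

Section Translation.
Context {R : realType} {V W : normedModType R}.

Lemma is_derive_translate (F : V -> W) (c x v : V) : derivable F (c + x) v ->
  is_derive x v (fun y => F (c + y)) ('D_v F (c + x)).
Proof.
move=> dF.
have E : (fun h : R => h^-1 *: (F (c + (h *: v + x)) - F (c + x))) =
         (fun h : R => h^-1 *: (F (h *: v + (c + x)) - F (c + x))).
  by apply/funext => h; rewrite addrCA.
by apply: DeriveDef; [rewrite /derivable E|rewrite /derive E].
Qed.

Lemma is_derive_lin {W' : normedModType R} (L : W -> W') (F : V -> W) (x v : V) :
  linear L -> continuous L -> derivable F x v ->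
  is_derive x v (L \o F) (L ('D_v F x)).
Proof.
move=> linL cL dF.
pose L' : {linear W -> W'} := HB.pack L (GRing.isLinear.Build R W W' _ L linL).
have E : (fun h : R => h^-1 *: (L (F (h *: v + x)) - L (F x))) =
     L \o (fun h : R => h^-1 *: (F (h *: v + x) - F x)).
  apply/funext => h /=.
  have LZ c y : L (c *: y) = c *: L y by exact: (linearZZ L').
  have LB y z : L (y - z) = L y - L z by exact: (linearB L').
  by rewrite LZ LB.
suff : (fun h : R => h^-1 *: (L (F (h *: v + x)) - L (F x))) @ 0^' --> L ('D_v F x).
  by move=> H; apply: DeriveDef; [apply/cvg_ex; eexists; exact: H|exact/cvg_lim].
rewrite E; apply: cvg_comp; last exact: cL.
exact: dF.
Qed.

End Translation.

(** * Balls of the sup norm and paths along the coordinate axes *)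

Section Balls.
Context {R : realType} {m : nat}.
Implicit Types (a x y : 'rV[R]_m) (d e : R).

Definition norm1 x : R := \sum_i `|x 0 i|.

Lemma rV_ballP a d x : 0 < d -> ball a d x <-> forall i, `|x 0 i - a 0 i| < d.
Proof.
move=> d0; split=> [[_ H] i|H]; first by have := H 0 i; rewrite /ball/= distrC.
by split=> // i j; rewrite (ord1 i) /ball/= distrC.
Qed.

Lemma norm1_ge0 x : 0 <= norm1 x.
Proof. exact: sumr_ge0. Qed.

Lemma norm1_0 : norm1 (0 : 'rV_m) = 0.
Proof. by rewrite /norm1 big1// => i _; rewrite mxE normr0. Qed.

Lemma norm1_ball a x d : 0 < d -> ball a d x -> norm1 (x - a) <= m%:R * d.
Proof.
move=> d0 /rV_ballP - /(_ d0) H; rewrite /norm1 -[m in m%:R]card_ord -sum1_card.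
rewrite natr_sum mulr_suml; apply: ler_sum => i _; rewrite mul1r !mxE ltW//.
Qed.

Lemma ball_step a d x i c : 0 < d -> ball a d x -> `|c + x 0 i - a 0 i| < d ->
  ball a d (c *: delta_mx 0 i + x).
Proof.
move=> d0 /rV_ballP - /(_ d0) H Hc; apply/rV_ballP => // j; rewrite !mxE eqxx/=.
by have [->|ne] := eqVneq j i; rewrite ?mulr1 ?mulr0 ?add0r.
Qed.

Lemma ball_shift a x d e i c : 0 < d -> 0 <= e -> ball a d x -> `|c| <= e ->
  ball a (d + e) (c *: delta_mx 0 i + x).
Proof.
move=> d0 e0 /rV_ballP - /(_ d0) H Hc; apply/rV_ballP => [|j]; first lra.
rewrite mxE -addrA; apply: le_lt_trans (ler_normD _ _) _; rewrite [d + e]addrC.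
apply: ler_ltD; last exact: H.
rewrite !mxE eqxx/=; have [_|_] := eqVneq j i; first by rewrite mulr1.
by rewrite mulr0 normr0.
Qed.

Lemma norm1_step a x i c : x 0 i = a 0 i ->
  norm1 (c *: delta_mx 0 i + x - a) = `|c| + norm1 (x - a).
Proof.
move=> xi; rewrite /norm1 (bigD1 i)//= [in RHS](bigD1 i)//= !mxE !eqxx/= xi.
rewrite mulr1 addrK subrr normr0 add0r; congr (_ + _); apply: eq_bigr => j ji.
by rewrite !mxE eqxx/= (negbTE ji) mulr0 add0r.
Qed.

(* The path from [a] to [x] follows the coordinate axes, so that only partial
   derivatives enter; [psi] measures the progress in the 1-norm. *)
Lemma axis_path_bound (g : 'rV[R]_m -> R) (psi psi' : R -> R) a d x :
  0 < d ->
  (forall s : R, is_derive s 1 psi (psi' s)) ->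
  (forall y, ball a d y -> forall i, has_partial i g y /\
     `|partial i g y| <= psi' (norm1 (y - a))) ->
  ball a d x -> `|g x - g a| <= psi (norm1 (x - a)) - psi 0.
Proof.
move=> d0 dpsi dg ax.
pose tr k : 'rV[R]_m := \row_i if (i < k)%N then x 0 i else a 0 i.
have trB k : ball a d (tr k).
  apply/rV_ballP => // i; rewrite mxE; case: ifP => _; last by rewrite subrr normr0.
  by move/rV_ballP: ax => /(_ d0 i).
suff key k : (k <= m)%N -> `|g (tr k) - g a| <= psi (norm1 (tr k - a)) - psi 0.
  have -> : x = tr m by apply/rowP => i; rewrite mxE ltn_ord.
  exact: key.
elim: k => [_|k IH km].
  have -> : tr 0 = a by apply/rowP => i; rewrite mxE.
  by rewrite !subrr norm1_0 normr0 subrr.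
pose i := Ordinal km; pose w := x 0 i - a 0 i.
have tri : (tr k) 0 i = a 0 i by rewrite mxE /= ltnn.
have trS : tr k.+1 = w *: delta_mx 0 i + tr k.
  apply/rowP => j; rewrite !mxE eqxx/=.
  have [->|ne] := eqVneq j i; first by rewrite /= ltnSn ltnn mulr1 /w subrK.
  rewrite mulr0 add0r ltnS leq_eqVlt; move: ne; rewrite -val_eqE /= => /negbTE ->.
  by [].
have {IH} IH := IH (ltnW km).
(* The segment from [tr k] to [tr k.+1] is run at unit speed in the direction [u], so that the
   1-norm distance to [a] grows exactly by the time [t]. *)
pose s := Num.sg w; pose u : 'rV[R]_m := s *: delta_mx 0 i.
have wsg : `|w| *: u = w *: delta_mx 0 i by rewrite scalerA mulrC -numEsg.
have P (t : R) : 0 <= t <= `|w| ->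
    ball a d (t *: u + tr k) /\ norm1 (t *: u + tr k - a) = t + norm1 (tr k - a).
  move=> /andP[t0 tw]; rewrite /u scalerA.
  have ts : `|t * s| = t.
    rewrite normrM (ger0_norm t0) normr_sg; have [w0|_] := eqVneq w 0; last by rewrite mulr1.
    by apply/eqP; rewrite mulr0 eq_le t0/=; move: tw; rewrite w0 normr0.
  split; last by rewrite norm1_step// ts.
  apply: ball_step => //; rewrite tri addrK ts (le_lt_trans tw)//.
  by move/rV_ballP: ax => /(_ d0 i).
have df (t : R) : 0 <= t <= `|w| ->
    is_derive t 1 (fun t => g (t *: u + tr k)) (s * partial i g (t *: u + tr k)).
  move=> /P[tB _]; have [dgi _] := dg _ tB i.
  have [du Du] := is_derive_scalev s dgi.
  have -> : s * partial i g (t *: u + tr k) = 'D_u g (t *: u + tr k) by rewrite Du.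
  exact: is_derive_line.
have dpsi' (t : R) : 0 <= t <= `|w| ->
   is_derive t 1 (fun t => psi (t *: 1 + norm1 (tr k - a))) (psi' (t + norm1 (tr k - a))).
  move=> _; have [D1 D2] := dpsi (t *: 1 + norm1 (tr k - a)).
  have := is_derive_line D1; rewrite D2.
  by rewrite [t *: 1]mulr1.
have := derive_le_comparison (normr_ge0 w) df dpsi'.
rewrite scale0r !add0r scale0r add0r [_ *: 1]mulr1 wsg -trS => /(_ _)/= H.
have {H}: `|g (tr k.+1) - g (tr k)| <=
    psi (`|w| + norm1 (tr k - a)) - psi (norm1 (tr k - a)).
  apply: H => t tw; have [tB <-] := P t tw; have [_ ] := dg _ tB i.
  apply: le_trans; rewrite normrM normr_sg ler_piMl//.
  by case: (_ == _).
rewrite [in X in _ -> X]trS norm1_step// => H.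
rewrite -trS -(subrKA (g (tr k))).
apply: le_trans (ler_normD _ _) _; lra.
Qed.

End Balls.

(** * Functions with continuous partial derivatives, and the symmetry of mixed derivatives *)

Section C1Functions.
Context {R : realType} {m : nat}.
Implicit Types (x a : 'rV[R]_m).

Lemma open_ball_sub (U : set 'rV[R]_m) x : open U -> U x ->
  exists2 d : R, 0 < d & ball x d `<=` U.
Proof.
by move=> oU Ux; have /nbhs_ballP[d /= d0 dU] := open_nbhs_nbhs (conj oU Ux); exists d.
Qed.

Lemma continuous_ballP (V : normedModType R) (F : 'rV[R]_m -> V) x :
  {for x, continuous F} -> forall e : R, 0 < e ->
  exists2 d : R, 0 < d & forall y, ball x d y -> `|F x - F y| < e.
Proof.
move=> cF e e0; have H : F y @[y --> x] --> F x by exact: cF.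
have /(_ e e0) := (@cvgrPdist_lt _ _ _ (nbhs x) (nbhs_filter x) F (F x)).1 H.
by move=> /nbhs_ballP[d /= d0 ?]; exists d.
Qed.

Lemma continuous_ball_intro (V : normedModType R) (F : 'rV[R]_m -> V) x :
  (forall e : R, 0 < e -> exists2 d : R, 0 < d & forall y, ball x d y -> `|F x - F y| <= e) ->
  {for x, continuous F}.
Proof.
move=> H; change (F y @[y --> x] --> F x); apply/(@cvgrPdist_le _ _ _ (nbhs x) (nbhs_filter x)) => e e0.
have [d d0 D] := H e e0; apply/nbhs_ballP; exists d => //.
Qed.

Lemma common_radius (P : 'I_m -> R -> Prop) :
  (forall i d e, e <= d -> P i d -> P i e) ->
  (forall i, exists2 d : R, 0 < d & P i d) ->
  exists2 d : R, 0 < d & forall i, P i d.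
Proof.
move=> mono H.
have [r Hr] := choice (fun i => let: ex_intro2 d a b := H i in ex_intro _ d (conj a b)).
exists (\big[Num.min/1]_i r i) => [|i].
  by apply/lt_bigmin => //= i _; have [] := Hr i.
apply: (mono _ (r i)); last by have [] := Hr i.
exact: bigmin_le_cond.
Qed.

Lemma C1_on_ball_bound (U : set 'rV[R]_m) (g : 'rV[R]_m -> R) x e :
  open U -> C1_on U g -> U x -> 0 < e ->
  exists2 d : R, 0 < d & forall y, ball x d y -> U y /\
    forall i, `|partial i g x - partial i g y| < e.
Proof.
move=> oU dg Ux e0; have [d0 d0p dU] := open_ball_sub oU Ux.
have [|i|d dp H] := @common_radius (fun i d => forall y, ball x d y -> `|partial i g x - partial i g y| < e).
- by move=> i d d' dd H y yb; apply: H; apply: le_ball yb.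
- by have [_ c] := dg i x Ux; have [d dp H] := continuous_ballP c e0; exists d.
exists (Num.min d0 d) => [|y yB]; first by rewrite lt_min d0p.
split; first by apply: dU; apply: le_ball yB; rewrite ge_min lexx.
by move=> i; apply: H; apply: le_ball yB; rewrite ge_min lexx orbT.
Qed.

(** Continuous partial derivatives are bounded near [x], and the axis path stays in the ball, which
    is a cube; hence [g] varies at most by a constant times the 1-norm. *)
Lemma C1_on_continuous (U : set 'rV[R]_m) (g : 'rV[R]_m -> R) x :
  open U -> C1_on U g -> U x -> {for x, continuous g}.
Proof.
move=> oU dg Ux.
have [d dp H] := C1_on_ball_bound oU dg Ux ltr01.
pose C := 1 + \sum_i `|partial i g x|.
have C0 : 0 < C by rewrite ltr_pwDl// sumr_ge0.
have bound y i : ball x d y -> `|partial i g y| <= C.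
  move=> /H[_ /(_ i)] h; have hs : `|partial i g x| <= \sum_i `|partial i g x|.
    by rewrite (bigD1 i)//= lerDl sumr_ge0.
  rewrite -(subKr (partial i g x) (partial i g y)).
  apply: le_trans (ler_normB _ _) _; rewrite /C; lra.
apply: continuous_ball_intro => e e0.
(* The 1-norm on the ball of radius [r] is at most [m r]; [m + 1] replaces [m] so as to divide by a
   positive number. *)
pose r := Num.min d (e / (C * (m%:R + 1))).
have m1 : 0 < m%:R + 1 :> R by rewrite ltr_wpDl.
have r0 : 0 < r by rewrite lt_min dp divr_gt0// mulr_gt0.
exists r => // y yB; rewrite distrC.
have yd : ball x d y by apply: le_ball yB; rewrite ge_min lexx.
apply: le_trans (axis_path_bound (psi := fun s => C * s) (psi' := fun=> C) dp _ _ yd) _.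
- by move=> s; apply: is_derive_eq; rewrite [_ *: _]mulr1.
- by move=> z zB i; split; [have [/(dg i)[]] := H _ zB|exact: bound].
rewrite mulr0 subr0; have := norm1_ball r0 yB => h.
have : C * norm1 (y - x) <= C * (m%:R * r) by rewrite ler_pM2l.
move=> /le_trans; apply; have : r <= e / (C * (m%:R + 1)) by rewrite ge_min lexx orbT.
rewrite ler_pdivlMr ?mulr_gt0//; apply: le_trans.
by rewrite [leRHS]mulrC -mulrA ler_pM2l// ler_pM2r// lerDl.
Qed.

(** The mean value theorem is applied to the increment [G] of [g] along [e_j], as a function of the
    step along [e_i], and then to [partial i g] along [e_j]. Balls are open, so the two shifts by
    [h] start from a ball of radius [h]; this gives the radius [3 h]. *)
Lemma second_difference (U : set 'rV[R]_m) (g : 'rV[R]_m -> R) (i j : 'I_m) x h :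
  (forall y, U y -> has_partial i g y /\ has_partial j (partial i g) y) ->
  0 < h -> ball x (h + h + h) `<=` U ->
  exists2 y, ball x (h + h + h) y &
    g (h *: delta_mx 0 j + (h *: delta_mx 0 i + x)) - g (h *: delta_mx 0 i + x)
      - (g (h *: delta_mx 0 j + x) - g x) = h * (h * partial j (partial i g) y).
Proof.
move=> dg h0 hU; have hh : 0 <= h by exact: ltW.
pose ei : 'rV[R]_m := delta_mx 0 i; pose ej : 'rV[R]_m := delta_mx 0 j.
have hn (t : R) : 0 <= t <= 1 -> `|t * h| <= h.
  move=> /andP[t0 t1]; rewrite ger0_norm ?mulr_ge0//.
  by rewrite ler_piMl.
have B2 (t s : R) : 0 <= t <= 1 -> 0 <= s <= 1 ->
    ball x (h + h + h) ((s * h) *: ej + ((t * h) *: ei + x)).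
  move=> t1 s1; apply: ball_shift; rewrite ?hn ?addr_gt0//.
  by apply: ball_shift; rewrite ?hn//; exact: ballxx.
have scl (v : 'rV[R]_m) (t : R) y : t *: (h *: v) + y = (t * h) *: v + y by rewrite scalerA.
pose G y := g (h *: ej + y) - g y.
have dG (t : R) : 0 <= t <= 1 -> is_derive (t *: (h *: ei) + x) (h *: ei) G
    (h * partial i g (h *: ej + (t *: (h *: ei) + x)) - h * partial i g (t *: (h *: ei) + x)).
  move=> t01; rewrite !scl.
  have [d1 _] : has_partial i g (h *: ej + ((t * h) *: ei + x)) /\
      has_partial j (partial i g) (h *: ej + ((t * h) *: ei + x)).
    by apply/dg/hU; have := B2 t 1 t01; rewrite mul1r; apply; rewrite ler01 lexx.
  have [d2 _] : has_partial i g ((t * h) *: ei + x) /\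
      has_partial j (partial i g) ((t * h) *: ei + x).
    by apply/dg/hU; have := B2 t 0 t01; rewrite mul0r scale0r add0r; apply; rewrite ler01 lexx.
  have [D1 E1] := is_derive_scalev h d1; have [D2 E2] := is_derive_scalev h d2.
  have [D3 E3] := is_derive_translate D1; rewrite E1 in E3.
  apply: DeriveDef; first exact: (derivableB D3 D2).
  by rewrite (deriveB D3 D2) E3 E2.
have [|t t01] := @mvt_line R _ G x (h *: ei).
- by move=> t t01; have [] := dG t t01.
have [_ ->] := dG t t01; rewrite scl -mulrBr => GE.
have dH (s : R) : 0 <= s <= 1 -> derivable (partial i g) (s *: (h *: ej) + ((t * h) *: ei + x)) (h *: ej).
  move=> s01; rewrite scl; have [_ d] : has_partial i g ((s * h) *: ej + ((t * h) *: ei + x)) /\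
     has_partial j (partial i g) ((s * h) *: ej + ((t * h) *: ei + x)) by apply/dg/hU/B2.
  by have [] := is_derive_scalev h d.
have [s s01] := mvt_line dH; rewrite scl => HE.
exists ((s * h) *: ej + ((t * h) *: ei + x)); first exact: B2.
move: GE; rewrite HE /G => ->; congr (_ * _).
have [_ d] : has_partial i g ((s * h) *: ej + ((t * h) *: ei + x)) /\
     has_partial j (partial i g) ((s * h) *: ej + ((t * h) *: ei + x)) by apply/dg/hU/B2.
by have [_ ->] := is_derive_scalev h d.
Qed.

Lemma eq_of_common_approx (u v : R) :
  (forall e, 0 < e -> exists z, `|u - z| < e /\ `|v - z| < e) -> u = v.
Proof.
move=> H; apply/eqP; rewrite -subr_eq0 -normr_le0 leNgt; apply/negP => ne.
have [z [h1 h2]] := H (`|u - v| / 2) ltac:(lra).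
have := ler_distD z u v; rewrite (distrC z v); lra.
Qed.

(** The second difference is symmetric in [i] and [j]. Computed in both orders, it shows that the
    two mixed derivatives take a common value at points arbitrarily close to [x], and their
    continuity at [x] concludes. *)
Lemma partialC (U : set 'rV[R]_m) (g : 'rV[R]_m -> R) (i j : 'I_m) x :
  open U -> U x ->
  (forall y, U y -> [/\ has_partial i g y, has_partial j g y,
     has_partial j (partial i g) y & has_partial i (partial j g) y]) ->
  {for x, continuous (partial j (partial i g))} ->
  {for x, continuous (partial i (partial j g))} ->
  partial j (partial i g) x = partial i (partial j g) x.
Proof.
move=> oU Ux dg c1 c2; apply: eq_of_common_approx => e e0.
have [d dp dU] := open_ball_sub oU Ux.
have [d1 d1p H1] := continuous_ballP c1 e0.
have [d2 d2p H2] := continuous_ballP c2 e0.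
pose h := Num.min d (Num.min d1 d2) / 3.
have h0 : 0 < h by rewrite divr_gt0 ?lt_min ?dp ?d1p.
have h3 : h + h + h = Num.min d (Num.min d1 d2) by rewrite /h; field.
have hU : ball x (h + h + h) `<=` U.
  by apply: (subset_trans _ dU); rewrite h3; apply: le_ball; rewrite ge_min lexx.
have [|y1 B1 E1] := @second_difference U g i j x h _ h0 hU; first by move=> y /dg[].
have [|y2 B2 E2] := @second_difference U g j i x h _ h0 hU; first by move=> y /dg[].
have : partial j (partial i g) y1 = partial i (partial j g) y2.
  have hn : h != 0 by rewrite gt_eqF.
  apply: (mulfI hn); apply: (mulfI hn).
  have perm (u v w z : R) : u - v - (w - z) = u - w - (v - z) by ring.
  apply: etrans (esym E1) _; apply: etrans E2; rewrite perm; congr (g _ - _ - _).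
  by rewrite addrCA.
have /H1 h1 : ball x d1 y1 by apply: le_ball B1; rewrite h3 !ge_min lexx orbT.
have /H2 h2 : ball x d2 y2 by apply: le_ball B2; rewrite h3 !ge_min lexx !orbT.
move=> E; exists (partial j (partial i g) y1); split; first exact: h1.
by rewrite E.
Qed.

End C1Functions.

(** * Smooth functions *)

Section SmoothFunctions.
Context {R : realType} {m : nat}.
Implicit Types (W : normedModType R) (U : set 'rV[R]_m).

(** Continuity is that of the total function at the points of [U], not of its restriction, so the
    notion is meant for open [U]. The existence of each derivative is recorded separately because
    [partial] is total. *)
Fixpoint Ck W k U (F : 'rV[R]_m -> W) : Prop :=
  (forall x, U x -> {for x, continuous F}) /\
  (if k is k'.+1 then
     forall i, (forall x, U x -> has_partial i F x) /\ Ck k' U (partial i F)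
   else True).

Definition smooth W U (F : 'rV[R]_m -> W) : Prop := forall k, Ck k U F.

Lemma Ck_cont W k U (F : 'rV[R]_m -> W) x : Ck k U F -> U x -> {for x, continuous F}.
Proof. by case: k => [|k] [+ _]; exact. Qed.

Lemma Ck_subset W k U U' (F : 'rV[R]_m -> W) : U' `<=` U -> Ck k U F -> Ck k U' F.
Proof.
elim: k F => [|k IH] F sU [cF dF]; split=> //; try by move=> x /sU /cF.
move=> i; have [d1 d2] := dF i; split; first by move=> x /sU /d1.
exact: IH.
Qed.

Lemma Ck_local W k U (F : 'rV[R]_m -> W) :
  (forall x, U x -> exists2 U', U' x & Ck k U' F) -> Ck k U F.
Proof.
elim: k F => [|k IH] F H; split=> //; try by move=> x /H[U' U'x /Ck_cont]; exact.
move=> i; split; first by move=> x /H[U' U'x [_ /(_ i)[+ _]]]; exact.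
by apply: IH => x /H[U' U'x [_ /(_ i)[_ ?]]]; exists U'.
Qed.

Lemma Ck_eq W k U (F G : 'rV[R]_m -> W) : open U ->
  (forall x, U x -> F x = G x) -> Ck k U F -> Ck k U G.
Proof.
move=> oU; elim: k F G => [|k IH] F G FG [cF dF]; split=> //;
  try by move=> x Ux; apply: (continuous_eq_near oU Ux FG); exact: cF.
move=> i; have [d1 d2] := dF i; split.
  by move=> x Ux; apply: (derivable_eq_near oU Ux FG); exact: d1.
by apply: IH d2 => x Ux; exact: (derive_eq_near _ oU Ux FG).
Qed.

Lemma CkS W k U (F : 'rV[R]_m -> W) : Ck k.+1 U F -> Ck k U F.
Proof.
elim: k F => [|k IH] F [cF dF]; split=> // i.
by have [d1 d2] := dF i; split=> //; exact: IH.
Qed.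

Lemma CkD W k U (F G : 'rV[R]_m -> W) : open U ->
  Ck k U F -> Ck k U G -> Ck k U (fun x => F x + G x).
Proof.
move=> oU; elim: k F G => [|k IH] F G [cF dF] [cG dG]; split=> //;
  try by move=> x Ux; exact: (cvgD (cF x Ux) (cG x Ux)).
move=> i; have [d1 d2] := dF i; have [e1 e2] := dG i; split.
  by move=> x Ux; exact: (derivableD (d1 x Ux) (e1 x Ux)).
apply: (Ck_eq oU) (IH _ _ d2 e2) => x Ux.
by rewrite -(deriveD (d1 x Ux) (e1 x Ux)).
Qed.

Lemma Ck_lin W W' (L : W -> W') k U (F : 'rV[R]_m -> W) : open U ->
  linear L -> continuous L -> Ck k U F -> Ck k U (L \o F).
Proof.
move=> oU lL cL; elim: k F => [|k IH] F [cF dF]; split=> //;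
  try by move=> x Ux; apply: continuous_comp; [exact: cF|exact: cL].
move=> i; have [d1 d2] := dF i; split.
  by move=> x Ux; have [] := is_derive_lin lL cL (d1 x Ux).
apply: (Ck_eq oU) (IH _ d2) => x Ux.
by have [_ /esym] := is_derive_lin lL cL (d1 x Ux).
Qed.

Lemma CkZ W k U (F : 'rV[R]_m -> W) (c : R) : open U ->
  Ck k U F -> Ck k U (fun x => c *: F x).
Proof.
move=> oU; apply: (Ck_lin (L := fun y => c *: y)) => //.
  by move=> a u v; rewrite scalerDr !scalerA mulrC.
exact: scaler_continuous.
Qed.

Lemma CkN W k U (F : 'rV[R]_m -> W) : open U ->
  Ck k U F -> Ck k U (fun x => - F x).
Proof.
move=> oU; apply: (Ck_lin (L := fun y => - y)) => //.
  by move=> a u v; rewrite opprD scalerN.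
by move=> y; exact: opp_continuous.
Qed.

Lemma CkB W k U (F G : 'rV[R]_m -> W) : open U ->
  Ck k U F -> Ck k U G -> Ck k U (fun x => F x - G x).
Proof. by move=> oU cF cG; apply: CkD => //; exact: CkN. Qed.

Lemma Ck_cst W k U (c : W) : Ck k U (fun=> c).
Proof.
elim: k c => [|k IH] c; split=> //; try by move=> x _; exact: cst_continuous.
move=> i; split; first by move=> x _; exact: derivable_cst.
suff -> : partial i (fun=> c) = fun=> (0 : W) by [].
by apply/funext => x; rewrite /partial derive_cst.
Qed.

Lemma Ck_scale W k U (a : 'rV[R]_m -> R) (F : 'rV[R]_m -> W) : open U ->
  Ck k U a -> Ck k U F -> Ck k U (fun x => a x *: F x).
Proof.
move=> oU; elim: k a F => [|k IH] a F ca cF; have [ca0 da] := ca; have [cF0 dF] := cF;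
  split=> //; try by move=> x Ux; exact: (cvgZ (ca0 x Ux) (cF0 x Ux)).
move=> i; have [d1 d2] := da i; have [e1 e2] := dF i; split.
  by move=> x Ux; have [] := is_derive_scale (d1 x Ux) (e1 x Ux).
apply: (Ck_eq oU) (CkD oU (IH _ _ d2 (CkS cF)) (IH _ _ (CkS ca) e2)) => x Ux.
by have [_ /esym] := is_derive_scale (d1 x Ux) (e1 x Ux).
Qed.

Lemma Ck_sum W k U (I : Type) (r : seq I) (F : I -> 'rV[R]_m -> W) : open U ->
  (forall i, Ck k U (F i)) -> Ck k U (fun x => \sum_(i <- r) F i x).
Proof.
move=> oU cF; elim: r => [|i r IH].
  by under [X in Ck _ _ X]eq_fun do rewrite big_nil; exact: Ck_cst.
under [X in Ck _ _ X]eq_fun do rewrite big_cons; exact: CkD.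
Qed.

Lemma is_derive_coord (x v : 'rV[R]_m) i : is_derive x v (fun y => y 0 i : R) (v 0 i).
Proof.
have [] := @is_derive_lin R 'rV[R]_m 'rV[R]_m R (fun y => y 0 i) id x v.
- by move=> a u w; rewrite !mxE.
- exact: coord_continuous.
- exact: derivable_id.
by move=> d1 d2; apply: DeriveDef => //; rewrite d2 derive_id.
Qed.

Lemma Ck_coord k U i : Ck k U (fun x => x 0 i : R).
Proof.
case: k => [|k]; split=> //; try by move=> x _; exact: coord_continuous.
move=> j; split; first by move=> x _; have [] := is_derive_coord x (delta_mx 0 j) i.
suff -> : partial j (fun x => x 0 i : R) = fun=> ((delta_mx 0 j : 'rV[R]_m) 0 i) by exact: Ck_cst.
by apply/funext => x; have [_] := is_derive_coord x (delta_mx 0 j) i.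
Qed.

Lemma smooth_cont W U (F : 'rV[R]_m -> W) x : smooth U F -> U x -> {for x, continuous F}.
Proof. by move=> /(_ 0) /Ck_cont; exact. Qed.

Lemma smooth_has_partial W U (F : 'rV[R]_m -> W) i x : smooth U F -> U x -> has_partial i F x.
Proof. by move=> /(_ 1)[_ /(_ i)[+ _]]; exact. Qed.

Lemma smooth_partial W U (F : 'rV[R]_m -> W) i : smooth U F -> smooth U (partial i F).
Proof. by move=> sF k; have [_ /(_ i)[_]] := sF k.+1. Qed.

Lemma smooth_C1_on W U (F : 'rV[R]_m -> W) : smooth U F -> C1_on U F.
Proof.
move=> sF i x Ux; split; first exact: smooth_has_partial sF Ux.
exact: smooth_cont (smooth_partial i sF) Ux.
Qed.

Lemma smooth_eq W U (F G : 'rV[R]_m -> W) : open U ->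
  (forall x, U x -> F x = G x) -> smooth U F -> smooth U G.
Proof. by move=> oU FG sF k; exact: Ck_eq FG (sF k). Qed.

Lemma smoothD W U (F G : 'rV[R]_m -> W) : open U ->
  smooth U F -> smooth U G -> smooth U (fun x => F x + G x).
Proof. by move=> oU sF sG k; exact: CkD. Qed.

Lemma smooth_lin W W' (L : W -> W') U (F : 'rV[R]_m -> W) : open U ->
  linear L -> continuous L -> smooth U F -> smooth U (L \o F).
Proof. by move=> oU lL cL sF k; exact: Ck_lin. Qed.

Lemma smoothZ W U (F : 'rV[R]_m -> W) (c : R) : open U ->
  smooth U F -> smooth U (fun x => c *: F x).
Proof. by move=> oU sF k; exact: CkZ. Qed.

Lemma smooth_scale W U (a : 'rV[R]_m -> R) (F : 'rV[R]_m -> W) : open U ->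
  smooth U a -> smooth U F -> smooth U (fun x => a x *: F x).
Proof. by move=> oU sa sF k; exact: Ck_scale. Qed.

Lemma smooth_sum W U (I : Type) (r : seq I) (F : I -> 'rV[R]_m -> W) : open U ->
  (forall i, smooth U (F i)) -> smooth U (fun x => \sum_(i <- r) F i x).
Proof. by move=> oU sF k; apply: Ck_sum => // i; exact: sF. Qed.

Lemma C1_on_Ck1 (U : set 'rV[R]_m) (g : 'rV[R]_m -> R) : open U -> C1_on U g <-> Ck 1 U g.
Proof.
move=> oU; split=> [dg|[_ dg] i x Ux].
  split=> [x|i]; first exact: C1_on_continuous.
  by split=> [x /(dg i)[]|]//; split=> // x /(dg i)[].
by have [d1 [d2 _]] := dg i; split; [exact: d1|exact: d2].
Qed.

Lemma Ck2_partialC (U : set 'rV[R]_m) (g : 'rV[R]_m -> R) i j x :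
  open U -> Ck 2 U g -> U x -> partial j (partial i g) x = partial i (partial j g) x.
Proof.
move=> oU [_ dg] Ux; apply: (partialC oU Ux).
- move=> y Uy; have [di [_ /(_ j)[dij _]]] := dg i; have [dj [_ /(_ i)[dji _]]] := dg j.
  by split; [exact: di|exact: dj|exact: dij|exact: dji].
- by have [_ [_ /(_ j)[_ [c _]]]] := dg i; exact: c.
- by have [_ [_ /(_ i)[_ [c _]]]] := dg j; exact: c.
Qed.

End SmoothFunctions.

(** * Functions with values in the Clifford algebra, handled through their coefficients *)

Section CliffordValued.
Context {R : realType} {n m : nat}.
Local Notation cliff := (clifford R n).
Implicit Types (U : set 'rV[R]_m) (F : 'rV[R]_m -> cliff).

Lemma ccoef_linear A : linear (fun x : cliff => ccoef x A).
Proof. by move=> a u v; rewrite ccoefD ccoefZ. Qed.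

Lemma ccoef_continuous A : continuous (fun x : cliff => ccoef x A).
Proof. exact: coord_continuous. Qed.

(** The norm is that of row vectors, the largest absolute value of a coefficient; it lets bounds
    pass between an element and its coefficients without a constant. *)
Lemma norm_ccoef (x : cliff) (M : R) : 0 <= M ->
  `|x| <= M <-> forall A, `|ccoef x A| <= M.
Proof.
move=> M0; rewrite /Num.Def.normr /= mx_normrE; split=> [/bigmax_leP[_ H] A|H].
  exact: (H (0, enum_rank A)).
apply/bigmax_leP; split=> // -[i j] _ /=; rewrite (ord1 i).
by have := H (enum_val j); rewrite /ccoef enum_valK.
Qed.

Lemma Ck_ccoef k U F : open U -> Ck k U F <-> forall A, Ck k U (fun x => ccoef (F x) A).
Proof.
move=> oU; split=> [cF A|cF].
  by apply: (Ck_lin (L := fun x => ccoef x A)) => //; [exact: ccoef_linear|exact: ccoef_continuous].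
have -> : F = fun x => \sum_A ccoef (F x) A *: blade A.
  by apply/funext => x; exact: clifford_blade.
by apply: Ck_sum => // A; apply: Ck_scale => //; exact: Ck_cst.
Qed.

Lemma cmul_linear (c : cliff) : linear (fun x => c * x).
Proof. by move=> a u v; rewrite mulrDr clifford_scalerAr. Qed.

Lemma cmul_continuous (c : cliff) : continuous (fun x : cliff => c * x).
Proof.
have -> : (fun x : cliff => c * x) = fun x => \sum_A ccoef x A *: (c * blade A).
  apply/funext => x; rewrite {1}(clifford_blade x) mulr_sumr; apply: eq_bigr => A _.
  by rewrite clifford_scalerAr.
apply: continuous_big => [|A _ x]; first exact: add_continuous.
exact: (cvgZr_tmp (@ccoef_continuous A x)).
Qed.

Lemma smooth_cmul U F (c : cliff) : open U -> smooth U F -> smooth U (fun x => c * F x).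
Proof.
move=> oU; apply: smooth_lin => //; [exact: cmul_linear|exact: cmul_continuous].
Qed.

Lemma is_partial_ccoef F i x A : has_partial i F x ->
  is_derive x (delta_mx 0 i) (fun x => ccoef (F x) A) (ccoef (partial i F x) A).
Proof. exact: is_derive_lin (ccoef_linear A) (@ccoef_continuous A). Qed.

Lemma is_partial_cmul F i x (c : cliff) : has_partial i F x ->
  is_derive x (delta_mx 0 i) (fun x => c * F x) (c * partial i F x).
Proof. exact: is_derive_lin (@cmul_linear c) (@cmul_continuous c). Qed.

Lemma C1_on_ccoef U F : open U -> C1_on U F -> Ck 1 U F.
Proof.
move=> oU dF; apply/Ck_ccoef => // A; apply/C1_on_Ck1 => // i x Ux.
have [d1 d2] := dF i x Ux; split; first by have [] := is_partial_ccoef A d1.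
apply: (continuous_eq_near (F := fun x => ccoef (partial i F x) A) oU Ux).
  by move=> y /(dF i)[/(is_partial_ccoef A)[_ <-]].
exact: (@continuous_comp _ _ _ (partial i F) (fun z => ccoef z A) x d2 (@ccoef_continuous A _)).
Qed.

Lemma Ck2_clifford_partialC U F i j x : open U -> Ck 2 U F -> U x ->
  partial j (partial i F) x = partial i (partial j F) x.
Proof.
move=> oU sF Ux; apply: cliffordP => A; have [_ dF] := sF.
have d1 a y : U y -> has_partial a F y by have [+ _] := dF a; exact.
have d2 a b y : U y -> has_partial b (partial a F) y.
  by have [_ [_ /(_ b)[+ _]]] := dF a; exact.
have key a b y : U y -> ccoef (partial b (partial a F) y) A =
    partial b (partial a (fun y => ccoef (F y) A)) y.
  move=> Uy; have [_ <-] := is_partial_ccoef A (d2 a b _ Uy).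
  apply: (derive_eq_near _ oU Uy) => z Uz.
  by have [_ <-] := is_partial_ccoef A (d1 a _ Uz).
have sA : Ck 2 U (fun y => ccoef (F y) A) by apply: (Ck_ccoef _ _ oU).1; exact: sF.
exact: (etrans (key i j x Ux) (etrans (Ck2_partialC i j oU sA Ux) (esym (key j i x Ux)))).
Qed.

Lemma smooth_partialC U F i j x : open U -> smooth U F -> U x ->
  partial j (partial i F) x = partial i (partial j F) x.
Proof. by move=> oU /(_ 2); exact: Ck2_clifford_partialC. Qed.

End CliffordValued.

(** * Gradient bound for harmonic functions *)

Section MaximumPrinciple.
Context {R : realType} {N : nat}.
Implicit Types (x a : 'rV[R]_N) (d M : R).

(** After subtraction of the parabola the function [f] has a maximum at [0], so [f'] vanishes there.
    If the second derivative exceeded [2 c], then [f'] would be positive just to the right of [0],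
    and the mean value theorem would contradict the maximum. *)
Lemma second_partial_touch (g : 'rV[R]_N -> R) x i d (b c : R) :
  0 < d ->
  (forall t : R, `|t| < d -> has_partial i g (t *: delta_mx 0 i + x)) ->
  has_partial i (partial i g) x ->
  (forall t : R, `|t| < d -> g (t *: delta_mx 0 i + x) <= g x + b * t + c * t ^+ 2) ->
  partial i (partial i g) x <= 2 * c.
Proof.
move=> d0 dg ddg gle; set e := delta_mx 0 i in dg gle *.
pose q (t : R) := b * t + c * t ^+ 2.
pose f (t : R) := g (t *: e + x) - q t.
pose f' (t : R) := partial i g (t *: e + x) - (b + 2 * c * t).
have dq (t : R) : is_derive t 1 q (b + 2 * c * t).
  rewrite /q; apply: is_derive_eq; rewrite /GRing.scale/=; ring.
have df (t : R) : `|t| < d -> is_derive t 1 f (f' t).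
  by move=> td; have := is_derive_line (dg t td) => ?; apply: is_deriveB.
have f0 : f 0 = g x by rewrite /f /q scale0r add0r mulr0 expr0n/= mulr0 addr0 subr0.
have fmax (t : R) : `|t| < d -> f t <= f 0.
  by move=> td; rewrite f0 /f /q; have := gle t td; lra.
have itvd (t : R) : t \in `]- d, d[ -> `|t| < d by rewrite in_itv/= ltr_norml.
have f'0 : f' 0 = 0.
  have [||||] := @derive1_at_max R f (- d) d 0.
  - lra.
  - by move=> t /itvd /df[].
  - by rewrite in_itv/= d0 oppr_lt0 d0.
  - by move=> t /itvd; exact: fmax.
  move=> _ E; have [_ E'] := df 0 ltac:(by rewrite normr0).
  by rewrite -E' E.
rewrite leNgt; apply/negP => clt.
pose c' := partial i (partial i g) x - 2 * c.
have c'0 : 0 < c' by rewrite subr_gt0.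
have df' : h^-1 *: (f' h - f' 0) @[h --> (0:R)^'] --> c'.
  have H : h^-1 *: (partial i g (h *: e + x) - partial i g x) - 2 * c @[h --> (0:R)^'] --> c'.
    by apply: cvgB; [exact: ddg|exact: cvg_cst].
  apply: cvg_trans H; apply: near_eq_cvg; near=> h.
  have h0 : h != 0 by near: h; exact: nbhs_dnbhs_neq.
  rewrite /f' scale0r add0r mulr0 addr0 /GRing.scale/=.
  by generalize (partial i g (h *: e + x)), (partial i g x) => u v; field.
have /cvgrPdist_lt/(_ c' c'0)[r /= r0 rH] := df'.
have f'pos (t : R) : 0 < t < r -> 0 < f' t.
  move=> /andP[t0 tr]; have := rH t; rewrite /= sub0r normrN gtr0_norm// => /(_ tr).
  rewrite gt_eqF// => /(_ isT); rewrite f'0 subr0 /GRing.scale/=.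
  rewrite ltr_norml => /andP[_]; rewrite ltrBlDr ltrDl pmulr_rgt0// invr_gt0//.
pose T := Num.min d r / 2.
have m0 : 0 < Num.min d r by rewrite lt_min d0.
have T0 : 0 < T by rewrite divr_gt0.
have [Td Tr] : T < d /\ T < r.
  have : T < Num.min d r by rewrite /T; lra.
  by rewrite lt_min => /andP[].
have dfT (t : R) : 0 <= t <= T -> is_derive t 1 f (f' t).
  by move=> /andP[t0 tT]; apply: df; rewrite ger0_norm// (le_lt_trans tT).
have [||t tT] := @MVT R f f' 0 T T0.
- by move=> t; rewrite in_itv/= => /andP[t0 tT]; apply: dfT; rewrite !ltW.
- apply: derivable_within_continuous => t; rewrite in_itv/= => tT.
  by have [] := dfT t tT.
move: tT; rewrite in_itv/= => /andP[t0 tT].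
have := fmax T ltac:(by rewrite gtr0_norm).
have : 0 < f' t by apply: f'pos; rewrite t0 (lt_trans tT).
move=> p le; rewrite subr0 => E.
have : 0 < f' t * T by exact: mulr_gt0.
by rewrite -E; move: le; generalize (f T), (f 0); move=> *; lra.
Unshelve. all: by end_near. Qed.

Lemma closed_box_compact (l u : 'I_N -> R) :
  compact [set x : 'rV[R]_N | forall i, l i <= x 0 i <= u i].
Proof.
have -> : [set x : 'rV[R]_N | forall i, l i <= x 0 i <= u i] =
   [set x : 'rV[R]_N | forall i, (`[l i, u i]%classic : set R) (x ord0 i)].
  by apply/seteqP; split=> x /= H i; have := H i; rewrite in_itv.
by apply: (@rV_compact R N (fun i => `[l i, u i]%classic)) => i; exact: segment_compact.
Qed.

(* Comparison with a quadratic barrier on a half cube, applied to the odd part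
   of [u] in the direction [n]. *)
Lemma harmonic_odd_part_bound (U : set 'rV[R]_N) (u : 'rV[R]_N -> R) a d M (n : 'I_N) :
  Ck 2 U u -> (forall x, U x -> \sum_i partial i (partial i u) x = 0) ->
  0 < d -> 0 < M ->
  (forall x, (forall i, `|x 0 i - a 0 i| <= d) -> U x /\ `|u x| <= M) ->
  forall t, 0 < t <= d ->
  u (t *: delta_mx 0 n + a) - u (- t *: delta_mx 0 n + a)
    <= 2 * t * ((N%:R + 1) * M / d).
Proof.
move=> cu harm d0 M0 HQ.
pose e i : 'rV[R]_N := delta_mx 0 i.
(* [sg] is the reflection in the hyperplane through [a] orthogonal to [e n], and [s i] is its sign
   on the axis [i]. Below, [phi] is twice the odd part of [u] for this reflection: it is harmonic
   and vanishes on the hyperplane. *)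
pose sg x := (2 * (a 0 n - x 0 n)) *: e n + x.
pose s i : R := if i == n then -1 else 1.
have ee i j : (e i) 0 j = (j == i)%:R by rewrite mxE eqxx.
have sgE x i : (sg x) 0 i - a 0 i = s i * (x 0 i - a 0 i).
  rewrite mxE [(_ *: e n) _ _]mxE ee /s; have [->|_] := eqVneq i n.
    by rewrite mulr1; ring.
  by rewrite mulr0 add0r mul1r.
have sn i : `|s i| = 1 by rewrite /s; case: ifP; rewrite ?normrN normr1.
have s2 i : s i * s i = 1 by rewrite /s; case: ifP => _; rewrite ?mulrNN mulr1.
have sgL i x (h : R) : sg (h *: e i + x) = h *: (s i *: e i) + sg x.
  apply/rowP => j; apply: (addIr (- a 0 j)); rewrite sgE.
  rewrite [in RHS]mxE -[in RHS]addrA sgE !mxE eqxx/=.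
  by have [->|ne] := eqVneq j i; rewrite /= ?mulr1 ?mulr0; ring.
pose Q := [set x : 'rV[R]_N | forall i, `|x 0 i - a 0 i| <= d].
have Qsg x : Q x -> Q (sg x) by move=> Qx i; rewrite sgE normrM sn mul1r.
have [cu0 du] := cu.
have d1 i x : U x -> has_partial i u x by have [+ _] := du i; exact.
have d2 i x : U x -> has_partial i (partial i u) x.
  by have [_ [_ /(_ i)[+ _]]] := du i; exact.
pose phi x := u x - u (sg x).
have dsg i x : U (sg x) -> is_derive x (e i) (u \o sg) (s i * partial i u (sg x)).
  move=> Ux; have [D1 D2] := is_derive_scalev (s i) (d1 i _ Ux).
  have := is_derive_affine (sgL i x) D1.
  by rewrite D2.
have dphi i x : U x -> U (sg x) ->
    is_derive x (e i) phi (partial i u x - s i * partial i u (sg x)).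
  move=> Ux Usx; have [D1 D2] := dsg i x Usx.
  apply: DeriveDef; first exact: (derivableB (d1 i x Ux) D1).
  by rewrite (deriveB (d1 i x Ux) D1) D2.
have ballQ x : ball a d x -> Q x by move=> /(rV_ballP _ _ d0) H i; exact/ltW.
have QU x : Q x -> U x by move=> /HQ[].
have ballsg x : ball a d x -> ball a d (sg x).
  by move=> /(rV_ballP _ _ d0) H; apply/rV_ballP => // i; rewrite sgE normrM sn mul1r.
have ddphi i x : ball a d x -> is_derive x (e i) (partial i phi)
    (partial i (partial i u) x - partial i (partial i u) (sg x)).
  move=> xB; have Ux := QU _ (ballQ _ xB); have Usx := QU _ (ballQ _ (ballsg _ xB)).
  have [D1 D2] := is_derive_scalev (s i) (d2 i _ Usx).
  have [D3 D4] := is_derive_affine (sgL i x) D1.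
  pose G x := partial i u x - s i *: (partial i u \o sg) x.
  have DG : is_derive x (e i) G (partial i (partial i u) x - partial i (partial i u) (sg x)).
    have DZ : derivable (s i \*: (partial i u \o sg)) x (e i) by exact: derivableZ.
    apply: DeriveDef; first exact: (derivableB (d2 i x Ux) DZ).
    have DZE : 'D_(e i) (s i \*: (partial i u \o sg)) x = partial i (partial i u) (sg x).
      apply: etrans (deriveZ _ D3) _; rewrite (etrans D4 D2) scalerA s2 scale1r.
      rewrite /partial; exact: erefl.
    by rewrite (deriveB (d2 i x Ux) DZ) DZE.
  have E y : ball a d y -> G y = partial i phi y.
    move=> yB; have [_] := dphi i y (QU _ (ballQ _ yB)) (QU _ (ballQ _ (ballsg _ yB))).
    by move/esym.
  have oB : open (ball a d) by exact: ball_open.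
  have [D5 D6] := DG; apply: DeriveDef; first exact: (derivable_eq_near oB xB E).
  by rewrite -(derive_eq_near _ oB xB E).
(* The barrier [psi] has Laplacian [2 K N - 2 K (N + 1) = - 2 K < 0]. It is nonnegative on the half
   cube [B], and [K d^2 = 2 M] makes it at least [2 M], which bounds [phi], on the faces at distance
   [d]. On the remaining face [phi] is zero. *)
pose K := 2 * M / d ^+ 2.
have K0 : 0 < K by rewrite divr_gt0 ?mulr_gt0// exprn_gt0.
pose psi (x : 'rV[R]_N) := K * (\sum_i (x 0 i - a 0 i) ^+ 2 +
   (N%:R + 1) * ((x 0 n - a 0 n) * (d - (x 0 n - a 0 n)))).
pose lo i := if i == n then a 0 n else a 0 i - d.
pose hi i := a 0 i + d.
pose B := [set x : 'rV[R]_N | forall i, lo i <= x 0 i <= hi i].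
have BQ x : B x -> Q x.
  move=> xB i; have := xB i; rewrite /lo /hi ler_norml.
  by case: eqVneq => [->|_] /andP[h1 h2]; apply/andP; split; lra.
have N1 : 0 < N%:R + 1 :> R by rewrite ltr_wpDl.
have Bn x : B x -> 0 <= x 0 n - a 0 n <= d.
  by move=> /(_ n); rewrite /lo /hi eqxx => /andP[h1 h2]; apply/andP; split; lra.
have psi_ge0 x i : B x -> K * (x 0 i - a 0 i) ^+ 2 <= psi x.
  move=> /Bn /andP[n0 nd]; rewrite ler_pM2l// (bigD1 i)//= -addrA lerDl.
  apply: addr_ge0; first by apply: sumr_ge0 => j _; exact: sqr_ge0.
  by apply: mulr_ge0; [exact: ltW|apply: mulr_ge0 => //; rewrite subr_ge0].
have phi_le x : B x -> phi x <= 2 * M.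
  move=> xB; have [_ h1] := HQ x (BQ _ xB); have [_ h2] := HQ _ (Qsg x (BQ _ xB)).
  apply: le_trans (ler_norm _) _; apply: le_trans (ler_normB _ _) _; lra.
have csg : continuous sg.
  move=> x.
  have c0 : 2 * (a 0 n - (y : 'rV[R]_N) 0 n) @[y --> x] --> 2 * (a 0 n - x 0 n).
    by apply: (cvgM (cvg_cst _) (cvgB (cvg_cst _) (@coord_continuous _ _ _ _ _ x))).
  exact: (cvgD (cvgZr_tmp c0) cvg_id).
have cpsi : continuous psi.
  move=> x.
  have cc i : (y : 'rV[R]_N) 0 i - a 0 i @[y --> x] --> x 0 i - a 0 i.
    exact: (cvgB (@coord_continuous _ _ _ _ _ x) (cvg_cst _)).
  have cs : \sum_i ((y : 'rV[R]_N) 0 i - a 0 i) ^+ 2 @[y --> x] --> \sum_i (x 0 i - a 0 i) ^+ 2.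
    apply: (@cvg_big _ _ _ _ _ (@add_continuous R) _ (nbhs x) _ _ _ (nbhs_filter x)) => i _.
    exact: (cvgM (cc i) (cc i)).
  exact: (cvgM (cvg_cst _) (cvgD cs (cvgM (cvg_cst _) (cvgM (cc n) (cvgB (cvg_cst _) (cc n)))))).
have aB : B a.
  by move=> i; rewrite /lo /hi; case: eqVneq => [->|_]; apply/andP; split; lra.
have [| |x xB xmax] := @EVT_max_rV R N (fun x => phi x - psi x) B _ (@closed_box_compact lo hi).
- by exists a.
- apply: continuous_in_subspaceT => x; rewrite inE => xB.
  have Ux := QU _ (BQ _ xB); have Usx := QU _ (Qsg _ (BQ _ xB)).
  have c1 : u y @[y --> x] --> u x by exact: cu0.
  have c2 : u (sg y) @[y --> x] --> u (sg x).
    exact: (@continuous_comp _ _ _ sg u x (csg x) (cu0 _ Usx)).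
  exact: (cvgB (cvgB c1 c2) (cpsi x)).
rewrite inE in xB.
(* A positive maximum could not lie on the boundary, by the choice of [psi]. At an interior maximum
   each second derivative of [phi] is at most that of [psi], so that the Laplacian of [phi] would be
   at most [- 2 K], whereas it is zero. *)
have w0 : phi x - psi x <= 0.
  rewrite leNgt; apply/negP => wpos.
  have ne0 i : `|x 0 i - a 0 i| < d.
    rewrite lt_neqAle (BQ _ xB i) andbT; apply/eqP => E.
    have := psi_ge0 x i xB; rewrite -real_normK ?num_real// E /K divfK ?sqrf_eq0 ?gt_eqF//.
    by have := phi_le x xB; lra.
  have n0 : 0 < x 0 n - a 0 n.
    rewrite lt_neqAle; have /andP[-> _] := Bn _ xB; rewrite andbT; apply/eqP => E.
    have : sg x = x.
      apply/rowP => j; apply: (addIr (- a 0 j)); rewrite sgE /s.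
      by have [->|_] := eqVneq j n; rewrite ?mul1r// -E mulr0.
    move=> sgx; have := psi_ge0 x n xB; rewrite -E expr0n/= mulr0.
    by move: wpos; rewrite /phi sgx subrr; lra.
  have xball : ball a d x by apply/rV_ballP.
  have oB : open (ball a d) by exact: ball_open.
  have [r r0 rB] : exists2 r : R, 0 < r & forall i (t : R), `|t| < r ->
      ball a d (t *: e i + x) /\ B (t *: e i + x).
    have [r1 r10 r1B] := open_ball_sub oB xball.
    exists (Num.min r1 (x 0 n - a 0 n)) => [|i t]; first by rewrite lt_min r10.
    rewrite lt_min => /andP[t1 tn].
    have tB : ball a d (t *: e i + x).
      apply: r1B; apply: ball_step => //; first exact: ballxx.
      by rewrite addrK.
    split=> // j; move/(rV_ballP _ _ d0): tB => /(_ j).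
    rewrite /lo /hi; have [->|_] := eqVneq j n; last first.
      by rewrite ltr_norml => /andP[h1 h2]; apply/andP; split; lra.
    rewrite [(_ + x) _ _]mxE [(_ *: e i) _ _]mxE ee ltr_norml => /andP[_ h].
    have tb : - `|t| <= t * (n == i)%:R.
      case: (n == i); rewrite ?mulr1 ?mulr0 ?oppr_le0//.
      by have := lerNnormlW (lexx `|t|).
    by apply/andP; split; lra.
  (* Coefficients of the quadratic polynomial which [psi] is, exactly, along the axis [i] through
     [x]. *)
  pose b i := K * (2 * (x 0 i - a 0 i)) + (i == n)%:R * (K * ((N%:R + 1) * (d - 2 * (x 0 n - a 0 n)))).
  pose c i := K - (i == n)%:R * (K * (N%:R + 1)).
  have psiE i (t : R) : psi (t *: e i + x) = psi x + b i * t + c i * t ^+ 2.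
    have sE : \sum_j ((t *: e i + x) 0 j - a 0 j) ^+ 2 =
        \sum_j (x 0 j - a 0 j) ^+ 2 + 2 * (x 0 i - a 0 i) * t + t ^+ 2.
      rewrite (bigD1 i)//= [in RHS](bigD1 i)//= !mxE !eqxx/= mulr1.
      rewrite (eq_bigr (fun j => (x 0 j - a 0 j) ^+ 2)); last first.
        by move=> j ji; rewrite !mxE eqxx (negbTE ji)/= mulr0 add0r.
      by ring.
    rewrite /psi sE [(_ + x) _ _]mxE [(_ *: e i) _ _]mxE ee /b /c [n == i]eq_sym.
    by have [->|_] := eqVneq i n; rewrite ?mulr1 ?mulr0 ?mul1r ?mul0r; ring.
  have le0 i : partial i (partial i phi) x <= 2 * c i.
    apply: (@second_partial_touch phi x i r (b i) (c i) r0).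
    - move=> t tr; have [yB _] := rB i t tr.
      by have [] := dphi i _ (QU _ (ballQ _ yB)) (QU _ (ballQ _ (ballsg _ yB))).
    - by have [] := ddphi i x xball.
    - move=> t tr; have [_ yB] := rB i t tr.
      by have := xmax (t *: e i + x); rewrite inE => /(_ yB); rewrite psiE; lra.
  have : \sum_i partial i (partial i phi) x = 0.
    under eq_bigr => i _ do rewrite (partial_val (ddphi i x xball)).
    apply: etrans (sumrB _ _ _ _) _.
    exact: etrans (congr2 (fun v w : R => v - w) (harm _ (QU _ (BQ _ xB)))
      (harm _ (QU _ (Qsg _ (BQ _ xB))))) (subrr 0).
  have : \sum_i partial i (partial i phi) x <= \sum_i 2 * c i by exact: ler_sum.
  have -> : \sum_i 2 * c i = - (2 * K).
    rewrite -mulr_sumr /c sumrB sumr_const card_ord (bigD1 n)//= eqxx mul1r big1 => [|j /negbTE ->].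
      by rewrite addr0 -mulr_natr; ring.
    by rewrite mul0r.
  by lra.
move=> t /andP[t0 td].
have yB : B (t *: e n + a).
  move=> j; rewrite [(_ + a) _ _]mxE [(_ *: e n) _ _]mxE ee /lo /hi.
  by have [->|_] := eqVneq j n; rewrite ?mulr1 ?mulr0; apply/andP; split; lra.
have := xmax (t *: e n + a); rewrite inE => /(_ yB) le1.
have le2 : phi (t *: e n + a) <= psi (t *: e n + a) by lra.
have sgy : sg (t *: e n + a) = - t *: e n + a.
  apply/rowP => j; apply: (addIr (- a 0 j)); rewrite sgE !mxE eqxx/= /s.
  by have [->|_] := eqVneq j n; rewrite /= ?mulr1 ?mulr0; ring.
move: le2; rewrite /phi sgy => /le_trans; apply.
have -> : psi (t *: e n + a) = K * (t ^+ 2 + (N%:R + 1) * (t * (d - t))).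
  rewrite /psi; congr (K * (_ + _)); last by rewrite !mxE !eqxx/= mulr1 addrK.
  rewrite (bigD1 n)//= big1 => [|j jn]; first by rewrite !mxE !eqxx/= mulr1 addrK addr0.
  by rewrite !mxE eqxx (negbTE jn)/= mulr0 add0r subrr expr0n.
have -> : 2 * t * ((N%:R + 1) * M / d) = K * ((N%:R + 1) * (t * d)).
  by rewrite /K; field; rewrite gt_eqF.
(* After division by [K] there remains [t^2 <= (N + 1) t^2]. *)
rewrite ler_pM2l// mulrBr mulrBr addrCA gerDl subr_le0 -expr2.
by rewrite mulrDl mul1r lerDr mulr_ge0// sqr_ge0.
Qed.

(** [harmonic_odd_part_bound], for [u] and for [- u], bounds the symmetric difference quotient at
    [a]. By the mean value theorem this quotient is a value of [partial n u] arbitrarily close to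
    [a], and continuity of [partial n u] excludes a larger value at [a]. *)
Lemma harmonic_gradient_bound (U : set 'rV[R]_N) (u : 'rV[R]_N -> R) a d M (n : 'I_N) :
  open U -> Ck 2 U u -> (forall x, U x -> \sum_i partial i (partial i u) x = 0) ->
  0 < d -> 0 < M ->
  (forall x, (forall i, `|x 0 i - a 0 i| <= d) -> U x /\ `|u x| <= M) ->
  `|partial n u a| <= (N%:R + 1) * M / d.
Proof.
move=> oU cu harm d0 M0 HQ; set C := _ / d.
have [cu0 du] := cu.
have [d1 [cdu _]] := du n.
have Ua : U a by have [] := HQ a ltac:(by move=> i; rewrite subrr normr0 ltW).
pose e : 'rV[R]_N := delta_mx 0 n.
have H2 (t : R) : 0 < t <= d -> `|u (t *: e + a) - u (- t *: e + a)| <= 2 * t * C.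
  move=> td; rewrite ler_norml; apply/andP; split; last exact: harmonic_odd_part_bound HQ _ td.
  pose u' x := -1 *: u x.
  have pu' i y : U y -> partial i u' y = -1 *: partial i u y.
    by move=> Uy; apply: deriveZ; have [+ _] := du i; exact.
  have ppu' i y : U y -> partial i (partial i u') y = -1 *: partial i (partial i u) y.
    move=> Uy; apply: etrans (derive_eq_near _ oU Uy (pu' i)) _.
    by apply: deriveZ; have [_ [_ /(_ i)[+ _]]] := du i; exact.
  have := @harmonic_odd_part_bound U u' a d M n (CkZ _ oU cu) _ d0 M0 _ t td.
  rewrite /u' -/C !scaleN1r => H; rewrite lerNl opprB; move: H; rewrite opprK addrC; apply.
    move=> x Ux; rewrite (eq_bigr _ (fun i _ => ppu' i x Ux)) -scaler_sumr.
    by rewrite (harm _ Ux) scaler0.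
  by move=> x /HQ[Ux xM]; split=> //; rewrite /u' scaleN1r normrN.
rewrite leNgt; apply/negP => Cn.
have eta0 : 0 < `|partial n u a| - C by rewrite subr_gt0.
have [r r0 rB] := continuous_ballP (cdu _ Ua) eta0.
pose m := Num.min r d.
have m0 : 0 < m by rewrite lt_min r0.
pose t := m / 2.
have t0 : 0 < t by rewrite divr_gt0.
have tm : t < m by rewrite /t; lra.
have [tr td] : t < r /\ t < d by move: tm; rewrite /m lt_min => /andP[].
have E (th : R) : th *: ((2 * t) *: e) + (- t *: e + a) = (th * (2 * t) - t) *: e + a.
  by rewrite scalerA addrA -scalerDl.
have small (th : R) : 0 <= th <= 1 -> `|th * (2 * t) - t| <= t.
  move=> /andP[th0 th1]; rewrite ler_norml.
  have p1 : 0 <= th * (2 * t) by rewrite !mulr_ge0// ltW.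
  have p2 : th * (2 * t) <= 2 * t by rewrite ler_piMl// mulr_ge0// ltW.
  by apply/andP; split; lra.
have inB (th b : R) : 0 <= th <= 1 -> t < b -> ball a b ((th * (2 * t) - t) *: e + a).
  move=> th1 tb; apply: ball_step; rewrite ?addrK; first by apply: lt_trans tb.
    by apply: ballxx; apply: lt_trans tb.
  by apply: le_lt_trans (small _ th1) tb.
have dU (th : R) : 0 <= th <= 1 -> has_partial n u ((th * (2 * t) - t) *: e + a).
  move=> th1; apply: d1; have [] // := HQ ((th * (2 * t) - t) *: e + a).
  by have /(rV_ballP _ _ d0) H := inB th d th1 td => i; apply/ltW.
have [|th th1] := @mvt_line R _ u (- t *: e + a) ((2 * t) *: e).
  by move=> th th1; rewrite E; have [] := is_derive_scalev (2 * t) (dU th th1).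
rewrite E; have [_ ->] := is_derive_scalev (2 * t) (dU th th1).
have -> : (2 * t) *: e + (- t *: e + a) = t *: e + a.
  by rewrite addrA -scalerDl; congr (_ *: _ + _); ring.
move=> E2; have := H2 t; rewrite t0 (ltW td) => /(_ isT).
have t2 : 0 < 2 * t by exact: mulr_gt0.
have -> : u (t *: e + a) - u (- t *: e + a) = (2 * t) * partial n u ((th * (2 * t) - t) *: e + a).
  exact: E2.
rewrite normrM (gtr0_norm t2) (ler_pM2l t2).
have := rB _ (inB th r th1 tr).
have := ler_distD (partial n u ((th * (2 * t) - t) *: e + a)) (partial n u a) 0; rewrite !subr0.
by move: Cn; clear; move: (partial n u a) (partial n u _) => A B; lra.
Qed.

End MaximumPrinciple.

(** * Integrals over the unit interval depending on parameters *)

Section ParametricIntegral.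
Context {R : realType} {m : nat}.
Notation mu := (@lebesgue_measure R).
Implicit Types (h g : R -> R) (t e : R) (U : set 'rV[R]_m) (G : R -> 'rV[R]_m -> R).

Definition int01 (h : R -> R) : R := (\int[mu]_(t in `[0%R, 1%R]) h t)%R.

Definition continuous01 (h : R -> R) := {within `[0, 1], continuous h}.

Lemma integrable01 h : continuous01 h -> mu.-integrable `[0%R, 1%R] (EFin \o h).
Proof. by apply: continuous_compact_integrable; exact: segment_compact. Qed.

Lemma int01_cst (c : R) : int01 (fun=> c) = c.
Proof.
rewrite /int01 Rintegral_cst//= lebesgue_measure_itv/= lte_fin ltr01.
by rewrite oppr0 adde0 mulr1.
Qed.

Lemma int01Z (c : R) h : continuous01 h -> int01 (fun t => c * h t) = c * int01 h.
Proof. by move=> ch; rewrite /int01 RintegralZl//; exact: integrable01. Qed.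

Lemma int01B h g : continuous01 h -> continuous01 g ->
  int01 (fun t => h t - g t) = int01 h - int01 g.
Proof. by move=> ch cg; rewrite /int01 RintegralB//; exact: integrable01. Qed.

Lemma int01D h g : continuous01 h -> continuous01 g ->
  int01 (fun t => h t + g t) = int01 h + int01 g.
Proof. by move=> ch cg; rewrite /int01 RintegralD//; exact: integrable01. Qed.

Lemma continuous01_cst (c : R) : continuous01 (fun=> c).
Proof. by apply: continuous_subspaceT => x; exact: cvg_cst. Qed.

Lemma continuous01B h g : continuous01 h -> continuous01 g ->
  continuous01 (fun t => h t - g t).
Proof. by move=> ch cg x; apply: cvgB; [exact: ch|exact: cg]. Qed.

Lemma continuous01Z (c : R) h : continuous01 h -> continuous01 (fun t => c * h t).
Proof. by move=> ch x; apply: cvgM; [exact: cvg_cst|exact: ch]. Qed.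

Lemma continuous01D h g : continuous01 h -> continuous01 g ->
  continuous01 (fun t => h t + g t).
Proof. by move=> ch cg x; apply: cvgD; [exact: ch|exact: cg]. Qed.

Lemma continuous01_in h : (forall t, 0 <= t <= 1 -> {for t, continuous h}) -> continuous01 h.
Proof.
by move=> ch; apply: continuous_in_subspaceT => t; rewrite inE/= in_itv/=; exact: ch.
Qed.

Lemma eq_int01 h g : (forall t, 0 <= t <= 1 -> h t = g t) -> int01 h = int01 g.
Proof. by move=> hg; apply: eq_Rintegral => t; rewrite inE/= in_itv/=; exact: hg. Qed.

Lemma int01_near_cst h (c e : R) : continuous01 h ->
  (forall t, 0 <= t <= 1 -> `|h t - c| <= e) -> `|int01 h - c| <= e.
Proof.
move=> ch hc; rewrite -{1}(int01_cst c) -int01B//; last exact: continuous01_cst.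
have ch' : continuous01 (fun t => h t - c) by apply: continuous01B => //; exact: continuous01_cst.
apply: le_trans (le_normr_Rintegral _ (integrable01 ch')) _ => //.
rewrite -[leRHS]int01_cst; apply: le_Rintegral => //.
- by apply: integrable01 => x; apply: cvg_norm; exact: ch'.
- exact: (integrable01 (@continuous01_cst e)).
Qed.

Lemma int01_derive (H h : R -> R) : continuous01 h ->
  (forall t, 0 <= t <= 1 -> is_derive t 1 H (h t)) -> int01 h = H 1 - H 0.
Proof.
move=> ch dH; rewrite /int01 /Rintegral.
have cH (t : R) : 0 <= t <= 1 -> {for t, continuous H}.
  by move=> /dH[/derivable1_diffP/differentiable_continuous].
have := @continuous_FTC2 R h H 0 1 ltr01 ch; rewrite -EFinB => -> //.
- split.
  + by move=> t; rewrite in_itv/= => /andP[t0 t1]; have [] := dH t ltac:(by rewrite !ltW).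
  + by apply: cvg_at_right_filter; apply: cH; rewrite lexx ler01.
  + by apply: cvg_at_left_filter; apply: cH; rewrite lexx ler01.
- move=> t; rewrite in_itv/= => /andP[t0 t1].
  by rewrite derive1E; have [] := dH t ltac:(by rewrite !ltW).
Qed.

(** Continuity in [t] is two-sided also at the end points [0] and [1], since the integrand is a
    total function of [t]. *)
Definition jcont (U : set 'rV[R]_m) (G : R -> 'rV[R]_m -> R) :=
  forall t x, 0 <= t <= 1 -> U x -> {for (t, x), continuous (fun z : R * 'rV[R]_m => G z.1 z.2)}.

Lemma jcont_continuous01 U G x : jcont U G -> U x -> continuous01 (fun t => G t x).
Proof.
move=> cG Ux; apply: continuous01_in => t t01.
have := cG t x t01 Ux => c.
have cp : (s, x) @[s --> t] --> (t, x) by exact: (cvg_pair (f := id) (g := fun=> x) cvg_id (cvg_cst x)).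
exact: (@continuous_comp _ _ _ (fun s => (s, x)) (fun z : R * 'rV[R]_m => G z.1 z.2) t cp c).
Qed.

(** Tube lemma: compactness of the unit interval, in its near-covering form, makes continuity in [x]
    uniform in [t]. *)
Lemma jcont_tube U G x e : jcont U G -> U x -> 0 < e ->
  exists2 d : R, 0 < d & forall t y, 0 <= t <= 1 -> ball x d y -> `|G t x - G t y| < e.
Proof.
move=> cG Ux e0.
have cpt : compact (`[0%R, 1%R]%classic : set R) by exact: segment_compact.
have /compact_near_coveringP nc := cpt.
pose P (y : 'rV[R]_m) (t : R) := `|G t x - G t y| < e.
suff prem (t : R) : (`[0%R, 1%R]%classic : set R) t -> \forall t' \near t & y \near nbhs x, P y t'.
  have HP := nc _ (nbhs x) P (nbhs_filter x) prem.
  have [d /= d0 dP] := (nbhs_ballP x _).1 HP.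
  by exists d => // t y t01 /dP; apply; rewrite /= in_itv.
rewrite /= in_itv/= => t01.
have e2 : 0 < e / 2 by rewrite divr_gt0.
have c : (fun z : R * 'rV[R]_m => G z.1 z.2) z @[z --> (t, x)] --> G t x by exact: cG.
have /(_ _ e2) := (@cvgrPdist_lt _ _ _ (nbhs (t, x)) (nbhs_filter (t, x)) _ _).1 c.
move=> [[A B] /= [tA xB] AB]; exists (A, B) => // -[t' y] /= [At' By].
have Bx : B x by exact: nbhs_singleton.
have h1 := AB (t', y) (conj At' By); have h2 := AB (t', x) (conj At' Bx).
change (`|G t' x - G t' y| < e); move: h1 h2 => /=; move: (G t x) (G t' y) (G t' x) => u v w h1 h2.
have := ler_distD u w v; rewrite (distrC w u); lra.
Qed.

Lemma int01_continuous U G x : open U -> jcont U G -> U x ->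
  {for x, continuous (fun y => int01 (fun t => G t y))}.
Proof.
move=> oU cG Ux; apply: continuous_ball_intro => e e0.
have [d0 d0p dU] := open_ball_sub oU Ux.
have [d dp H] := jcont_tube cG Ux e0.
exists (Num.min d0 d) => [|y yB]; first by rewrite lt_min d0p.
have Uy : U y by apply: dU; apply: le_ball yB; rewrite ge_min lexx.
have yd : ball x d y by apply: le_ball yB; rewrite ge_min lexx orbT.
have cx := jcont_continuous01 cG Ux; have cy := jcont_continuous01 cG Uy.
rewrite -int01B// -[X in `|X|]subr0; apply: int01_near_cst => [|t t01].
  exact: continuous01B.
by rewrite subr0; apply/ltW/H.
Qed.

(** For each [t] the difference quotient of the integrand is a value of the derivative [G'] on the
    segment from [x], by the mean value theorem, and [jcont_tube] makes it uniformly close to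
    [G' t x]. *)
Lemma int01_is_derive U G (G' : R -> 'rV[R]_m -> R) x i : open U -> U x -> jcont U G ->
  (forall t y, 0 <= t <= 1 -> U y -> is_derive y (delta_mx 0 i) (G t) (G' t y)) ->
  jcont U G' ->
  is_derive x (delta_mx 0 i) (fun y => int01 (fun t => G t y)) (int01 (fun t => G' t x)).
Proof.
move=> oU Ux cG dG cdG.
suff H : (fun h : R => h^-1 *: (int01 (fun t => G t (h *: delta_mx 0 i + x)) - int01 (fun t => G t x)))
    @ (0:R)^' --> int01 (fun t => G' t x).
  by apply: DeriveDef; [apply/cvg_ex; eexists; exact: H|exact/cvg_lim].
apply/cvgrPdist_le => e e0.
have [d0 d0p dU] := open_ball_sub oU Ux.
have [d dp H] := jcont_tube cdG Ux e0.
pose r := Num.min d0 d.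
have r0 : 0 < r by rewrite lt_min d0p.
have inB (h s : R) : `|h| < r -> 0 <= s <= 1 -> ball x r (s *: (h *: delta_mx 0 i) + x).
  move=> hr /andP[s0 s1]; rewrite scalerA; apply: ball_step; rewrite ?addrK//; first exact: ballxx.
  by rewrite normrM (le_lt_trans _ hr)// ler_piMl// ger0_norm.
have BU y : ball x r y -> U y by move=> yB; apply: dU; apply: le_ball yB; rewrite ge_min lexx.
exists r => // h /=; rewrite sub0r normrN => hr h0.
have Uh : U (h *: delta_mx 0 i + x).
  by apply: BU; have := inB h 1 hr; rewrite scale1r; apply; rewrite ler01 lexx.
have c1 := jcont_continuous01 cG Uh; have c2 := jcont_continuous01 cG Ux.
have c3 := jcont_continuous01 cdG Ux.
have E : h^-1 *: (int01 (fun t => G t (h *: delta_mx 0 i + x)) - int01 (fun t => G t x)) =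
    int01 (fun t => h^-1 * (G t (h *: delta_mx 0 i + x) - G t x)).
  by rewrite int01Z ?int01B//; exact: continuous01B.
have c4 : continuous01 (fun t => h^-1 * (G t (h *: delta_mx 0 i + x) - G t x)).
  by apply: continuous01Z; exact: continuous01B.
rewrite E -(int01B c3 c4) -[X in `|X|]subr0; apply: int01_near_cst => [|t t01].
  exact: continuous01B.
rewrite subr0.
have [|s s01] := @mvt_line R _ (G t) x (h *: delta_mx 0 i).
  move=> s s01; have [d1 _] := dG t _ t01 (BU _ (inB h s hr s01)).
  by have [] := is_derive_scalev h d1.
have [d1 d2] := dG t _ t01 (BU _ (inB h s hr s01)).
have [_ ->] := is_derive_scalev h d1; rewrite d2.
move=> ->; rewrite [h *: _]/(_ * _) mulrA mulVf// mul1r.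
apply/ltW; apply: H => //; apply: le_ball (inB h s hr s01).
by rewrite ge_min lexx orbT.
Qed.

End ParametricIntegral.

(** * Averages over segments parallel to a coordinate axis *)

Section SteklovAverage.
Context {R : realType} {N : nat}.
Implicit Types (e d t : R) (a x y : 'rV[R]_N) (u : 'rV[R]_N -> R).

Definition steklov1 e (i : 'I_N) u y : R :=
  int01 (fun t => u ((t * e) *: delta_mx 0 i + y)).

Lemma steklov_ball a d e i x t : 0 < d -> 0 < e -> 0 <= t <= 1 -> ball a d x ->
  ball a (d + e) ((t * e) *: delta_mx 0 i + x).
Proof.
move=> d0 e0 /andP[t0 t1] xB; apply: ball_shift => //; first exact: ltW.
by rewrite normrM !ger0_norm// ?(ltW e0)// ler_piMl// ltW.
Qed.

Lemma steklov_jcont a d e i u : 0 < d -> 0 < e ->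
  (forall x, ball a (d + e) x -> {for x, continuous u}) ->
  jcont (ball a d) (fun t y => u ((t * e) *: delta_mx 0 i + y)).
Proof.
move=> d0 e0 cu t x t01 xB.
pose L (z : R * 'rV[R]_N) : 'rV[R]_N := (z.1 * e) *: delta_mx 0 i + z.2.
have cL : {for (t, x), continuous L}.
  have c1 : (z : R * 'rV[R]_N).1 * e @[z --> (t, x)] --> t * e.
    exact: (cvgM cvg_fst (cvg_cst _)).
  exact: (cvgD (cvgZr_tmp c1) cvg_snd).
exact: (@continuous_comp _ _ _ L u (t, x) cL (cu _ (steklov_ball i d0 e0 t01 xB))).
Qed.

Lemma steklov1_near a d e i u c (r : R) x : 0 < d -> 0 < e ->
  (forall x, ball a (d + e) x -> {for x, continuous u}) ->
  (forall x, ball a (d + e) x -> `|u x - c| <= r) ->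
  ball a d x -> `|steklov1 e i u x - c| <= r.
Proof.
move=> d0 e0 cu uc xB; apply: int01_near_cst => [|t t01].
  exact: (jcont_continuous01 (steklov_jcont (i := i) d0 e0 cu) xB).
by apply: uc; exact: steklov_ball.
Qed.

Lemma steklov1_partial a d e i j u x : 0 < d -> 0 < e -> Ck 1 (ball a (d + e)) u ->
  ball a d x -> is_derive x (delta_mx 0 j) (steklov1 e i u) (steklov1 e i (partial j u) x).
Proof.
move=> d0 e0 [cu du] xB; have [d1 [cdu _]] := du j.
have oB : open (ball a d) by exact: ball_open.
apply: (@int01_is_derive R N (ball a d) (fun t y => u ((t * e) *: delta_mx 0 i + y))
  (fun t y => partial j u ((t * e) *: delta_mx 0 i + y)) x j oB xB) => [|t y t01 yB|].
- exact: steklov_jcont.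
- exact: (is_derive_translate (d1 _ (steklov_ball i d0 e0 t01 yB))).
- exact: steklov_jcont.
Qed.

Lemma steklov1_Ck0 a d e i u : 0 < d -> 0 < e -> Ck 0 (ball a (d + e)) u ->
  Ck 0 (ball a d) (steklov1 e i u).
Proof.
move=> d0 e0 [cu _]; split=> // x xB.
by apply: (int01_continuous (U := ball a d)) => //; [exact: ball_open|exact: steklov_jcont].
Qed.

Lemma steklov1_Ck1 a d e i u : 0 < d -> 0 < e -> Ck 1 (ball a (d + e)) u ->
  Ck 1 (ball a d) (steklov1 e i u).
Proof.
move=> d0 e0 cu; have oB : open (ball a d) by exact: ball_open.
have [c0 _] := steklov1_Ck0 i d0 e0 (CkS cu).
split=> // j; split=> [x xB|]; first by have [] := steklov1_partial i j d0 e0 cu xB.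
have [_ /(_ j)[_ cdu]] := cu.
apply: (Ck_eq oB) (steklov1_Ck0 i d0 e0 cdu) => x xB.
by rewrite (partial_val (steklov1_partial i j d0 e0 cu xB)).
Qed.

(** The purpose of averaging: by the fundamental theorem of calculus the derivative along the
    averaged axis is a difference quotient of [u], hence as regular as [u] itself. One derivative is
    gained in that direction. *)
Lemma steklov1_partial_self a d e i u x : 0 < d -> 0 < e -> Ck 1 (ball a (d + e)) u ->
  ball a d x ->
  partial i (steklov1 e i u) x = e^-1 * (u (e *: delta_mx 0 i + x) - u x).
Proof.
move=> d0 e0 cu xB; rewrite (partial_val (steklov1_partial i i d0 e0 cu xB)).
have [cu0 /(_ i)[d1 [cdu _]]] := cu.
have c01 := jcont_continuous01 (steklov_jcont (i := i) d0 e0 cdu) xB.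
have eN : e != 0 by rewrite gt_eqF.
apply: (mulfI eN); rewrite mulrA divff// mul1r /steklov1 -int01Z//.
have := @int01_derive R (fun t => u (t *: (e *: delta_mx 0 i) + x))
  (fun t => e * partial i u ((t * e) *: delta_mx 0 i + x)) _ _.
rewrite scale1r scale0r add0r; apply; first exact: continuous01Z.
move=> t t01; have [D1 D2] := is_derive_scalev e (d1 _ (steklov_ball i d0 e0 t01 xB)).
have <- : 'D_(e *: delta_mx 0 i) u (t *: (e *: delta_mx 0 i) + x) =
    e * partial i u ((t * e) *: delta_mx 0 i + x) by rewrite scalerA; exact: D2.
by apply: is_derive_line; rewrite scalerA.
Qed.

End SteklovAverage.

(** * Integrals of Clifford-valued functions *)

Section CliffordIntegral.
Context {R : realType} {n : nat}.
Local Notation cliff := (clifford R n).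

Definition cint (H : R -> cliff) : cliff := \sum_A int01 (fun t => ccoef (H t) A) *: blade A.

Lemma ccoef_cint H A : ccoef (cint H) A = int01 (fun t => ccoef (H t) A).
Proof.
rewrite ccoef_sum (bigD1 A)//= big1 ?addr0 => [|B BA]; rewrite ccoefZ ccoef_blade.
  by rewrite eqxx mulr1.
by rewrite (negbTE BA) mulr0.
Qed.

Lemma int01_sum (I : Type) (r : seq I) (h : I -> R -> R) :
  (forall i, continuous01 (h i)) ->
  continuous01 (fun t => \sum_(i <- r) h i t) /\
  int01 (fun t => \sum_(i <- r) h i t) = \sum_(i <- r) int01 (h i).
Proof.
move=> ch; elim: r => [|i r [IH1 IH2]].
  have -> : (fun t => \sum_(i <- [::]) h i t) = fun=> 0 by apply/funext => t; rewrite big_nil.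
  by split; [exact: continuous01_cst|rewrite int01_cst big_nil].
have -> : (fun t => \sum_(j <- i :: r) h j t) = fun t => h i t + \sum_(j <- r) h j t.
  by apply/funext => t; rewrite big_cons.
by split; [exact: continuous01D|rewrite int01D// IH2 big_cons].
Qed.

(** Multiplication by [c] acts on the coefficients through a constant matrix. The second conclusion
    is the continuity that [cint_sum] asks for when such terms are added. *)
Lemma cmul_cint (c : cliff) H : (forall A, continuous01 (fun t => ccoef (H t) A)) ->
  c * cint H = cint (fun t => c * H t) /\
  forall A, continuous01 (fun t => ccoef (c * H t) A).
Proof.
move=> cH.
have E B t : ccoef (c * H t) B = \sum_A ccoef (c * blade A) B * ccoef (H t) A.
  rewrite {1}(clifford_blade (H t)) mulr_sumr ccoef_sum; apply: eq_bigr => A _.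
  by rewrite -clifford_scalerAr ccoefZ mulrC.
have cc A B : continuous01 (fun t => ccoef (c * blade A) B * ccoef (H t) A).
  exact: continuous01Z.
split=> [|B]; last first.
  have -> : (fun t => ccoef (c * H t) B) = fun t => \sum_A ccoef (c * blade A) B * ccoef (H t) A.
    by apply/funext => t.
  by have [] := int01_sum (index_enum _) (cc^~ B).
apply: cliffordP => B; rewrite ccoef_cint.
under [in RHS]eq_int01 => t _ do rewrite E.
have [_ ->] := int01_sum (index_enum _) (cc^~ B).
rewrite {1}/cint mulr_sumr ccoef_sum; apply: eq_bigr => A _.
by rewrite -clifford_scalerAr ccoefZ mulrC int01Z.
Qed.

Lemma cint_sum (I : Type) (r : seq I) (H : I -> R -> cliff) :
  (forall i A, continuous01 (fun t => ccoef (H i t) A)) ->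
  \sum_(i <- r) cint (H i) = cint (fun t => \sum_(i <- r) H i t).
Proof.
move=> cH; apply: cliffordP => A; rewrite ccoef_sum ccoef_cint.
have -> : (fun t => ccoef (\sum_(i <- r) H i t) A) = fun t => \sum_(i <- r) ccoef (H i t) A.
  by apply/funext => t; rewrite ccoef_sum.
have [_ ->] := int01_sum r (fun i => cH i A).
by apply: eq_bigr => i _; rewrite ccoef_cint.
Qed.

Lemma cint0 : cint (fun=> 0) = 0.
Proof.
apply: cliffordP => A; rewrite ccoef_cint.
by rewrite int01_cst.
Qed.

End CliffordIntegral.

(** * First-order systems factoring the Laplacian *)

Lemma derive_translate {R : realType} {V W : normedModType R} (F : V -> W) (c x v : V) :
  'D_v (fun y => F (c + y)) x = 'D_v F (c + x).
Proof.
have E : (fun h : R => h^-1 *: (F (c + (h *: v + x)) - F (c + x))) =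
         (fun h : R => h^-1 *: (F (h *: v + (c + x)) - F (c + x))).
  by apply/funext => h; rewrite addrCA.
by rewrite /derive E.
Qed.

Lemma ccoefB {R : realType} {n : nat} (x y : clifford R n) A :
  ccoef (x - y) A = ccoef x A - ccoef y A.
Proof. by rewrite -[- y]scaleN1r ccoefD ccoefZ mulN1r. Qed.

Lemma is_derive_bigsum {R : realType} {V W : normedModType R} (I : Type) (r : seq I)
    (F : I -> V -> W) (x v : V) (dF : I -> W) :
  (forall i, is_derive x v (F i) (dF i)) ->
  is_derive x v (fun y => \sum_(i <- r) F i y) (\sum_(i <- r) dF i).
Proof.
move=> d; elim: r => [|j r IH].
  have -> : (fun y => \sum_(i <- [::]) F i y) = fun=> 0.
    by apply/funext => y; rewrite big_nil.
  by rewrite big_nil; exact: is_derive_cst.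
have -> : (fun y => \sum_(i <- j :: r) F i y) = (fun y => F j y + \sum_(i <- r) F i y).
  by apply/funext => y; rewrite big_cons.
by rewrite big_cons; have := d j => ?; exact: is_deriveD.
Qed.

Lemma Ck_translate {R : realType} {m : nat} {W : normedModType R} k
    (U U' : set 'rV[R]_m) (F : 'rV[R]_m -> W) (c : 'rV[R]_m) :
  (forall x, U' x -> U (c + x)) -> Ck k U F -> Ck k U' (fun x => F (c + x)).
Proof.
move=> U'U.
have cont (G : 'rV[R]_m -> W) : (forall x, U x -> {for x, continuous G}) ->
    forall x, U' x -> {for x, continuous (fun x => G (c + x))}.
  move=> cG x U'x; have cc : {for x, continuous (fun x => c + x)}.
    exact: (cvgD (cvg_cst _) cvg_id).
  exact: (@continuous_comp _ _ _ _ G x cc (cG _ (U'U _ U'x))).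
elim: k F => [|k IH] F [cF dF]; split=> //; try exact: cont.
move=> i; have [d1 d2] := dF i; split.
  by move=> x /U'U /d1 dFx; have [] := is_derive_translate dFx.
have -> : partial i (fun x => F (c + x)) = fun x => partial i F (c + x).
  by apply/funext => x; exact: derive_translate.
exact: IH.
Qed.

Section FirstOrderSystem.
Context {R : realType} {n N : nat}.
Local Notation cliff := (clifford R n).
Implicit Types (g h : 'rV[R]_N -> cliff) (a x y : 'rV[R]_N) (d e M : R).

Definition first_order (c : 'I_N -> cliff) g x : cliff := \sum_i c i * partial i g x.

(* [c'] plays the role of the conjugate symbol: the operator of symbol [c']
   composed with that of symbol [c] is the Laplacian. *)
Definition factors_laplacian (c c' : 'I_N -> cliff) : Prop :=
  forall i j, c' i * c j + c' j * c i = ((2 : R) *+ (i == j))%:A.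

Variables (c c' : 'I_N -> cliff).
Hypothesis cc' : factors_laplacian c c'.

Lemma first_order_partial0 (U : set 'rV[R]_N) g x i : open U -> Ck 2 U g ->
  (forall y, U y -> first_order c g y = 0) -> U x ->
  \sum_j c j * partial i (partial j g) x = 0.
Proof.
move=> oU cg Dg Ux; have [_ dg] := cg.
have D0 : partial i (first_order c g) x = 0.
  apply: etrans (derive_eq_near _ oU Ux Dg) _; exact: derive_cst.
apply: etrans _ D0; apply/esym/partial_val.
have d j : is_derive x (delta_mx 0 i) (fun y => c j * partial j g y)
    (c j * partial i (partial j g) x).
  by apply: is_partial_cmul; have [_ [_ /(_ i)[+ _]]] := dg j; exact.
exact: (is_derive_bigsum (index_enum _) d).
Qed.

(** Applying the symbol [c'] to the differentiated equation gives that the sum of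
    [c'_i c_j d_i d_j g] vanishes. Symmetrising in [i] and [j], which is allowed because second
    derivatives commute, turns the coefficients into [2] on the diagonal and [0] elsewhere. *)
Lemma first_order_harmonic (U : set 'rV[R]_N) g x : open U -> Ck 2 U g ->
  (forall y, U y -> first_order c g y = 0) -> U x ->
  \sum_i partial i (partial i g) x = 0.
Proof.
move=> oU cg Dg Ux.
pose G i j := partial i (partial j g) x.
have GC i j : G i j = G j i by exact: Ck2_clifford_partialC oU cg Ux.
have row0 i : \sum_j c j * G i j = 0 by exact: first_order_partial0 oU cg Dg Ux.
have S0 : \sum_i \sum_j (c' i * c j) * G i j = 0.
  rewrite big1// => i _; apply: etrans _ (etrans (congr1 (fun z => c' i * z) (row0 i)) (mulr0 _)).
  rewrite mulr_sumr;  by apply: eq_bigr => j _; rewrite mulrA.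
have S1 : \sum_i \sum_j (c' j * c i) * G i j = 0.
  rewrite exchange_big; apply: etrans _ S0; apply: eq_bigr => i _; apply: eq_bigr => j _.
  by rewrite GC.
have : (2 : R) *: \sum_i G i i = 0.
  apply: etrans _ (etrans (congr2 +%R S0 S1) (addr0 _)); rewrite -big_split scaler_sumr; apply: eq_bigr => i _ /=.
  rewrite -big_split (bigD1 i)//= big1 ?addr0 => [|j ji]; rewrite -mulrDl cc'.
    by rewrite eqxx mulr1n -scalerAl mul1r.
  by rewrite eq_sym (negbTE ji) mulr0n scale0r mul0r.
by move/eqP; rewrite scaler_eq0 pnatr_eq0/= => /eqP.
Qed.

Definition steklov e i g y : cliff := cint (fun t => g ((t * e) *: delta_mx 0 i + y)).

Lemma ccoef_steklov e i g y A :
  ccoef (steklov e i g y) A = steklov1 e i (fun x => ccoef (g x) A) y.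
Proof. exact: ccoef_cint. Qed.

Lemma steklov_Ck1 a d e i g : 0 < d -> 0 < e -> Ck 1 (ball a (d + e)) g ->
  Ck 1 (ball a d) (steklov e i g).
Proof.
move=> d0 e0 cg; apply/Ck_ccoef => [|A]; first exact: ball_open.
have -> : (fun x => ccoef (steklov e i g x) A) = steklov1 e i (fun x => ccoef (g x) A).
  by apply/funext => x; rewrite ccoef_steklov.
apply: steklov1_Ck1 => //.
by apply: (Ck_ccoef _ _ (ball_open _ _)).1.
Qed.

Lemma steklov_partial a d e i j g x : 0 < d -> 0 < e -> Ck 1 (ball a (d + e)) g ->
  ball a d x -> partial j (steklov e i g) x = steklov e i (partial j g) x.
Proof.
move=> d0 e0 cg xB; apply: cliffordP => A.
have [_ /(_ j)[d1 _]] := steklov_Ck1 i d0 e0 cg.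
have [_ <-] := is_partial_ccoef A (d1 x xB).
have -> : (fun x => ccoef (steklov e i g x) A) = steklov1 e i (fun x => ccoef (g x) A).
  by apply/funext => y; rewrite ccoef_steklov.
have cgA : Ck 1 (ball a (d + e)) (fun x => ccoef (g x) A).
  by apply: (Ck_ccoef _ _ (ball_open _ _)).1.
have [_ ->] := steklov1_partial i j d0 e0 cgA xB.
rewrite ccoef_steklov; apply: eq_int01 => t t01; apply: partial_val.
by apply: is_partial_ccoef; have [_ /(_ j)[+ _]] := cg; apply; exact: steklov_ball.
Qed.

(** The symbol is constant, so the operator passes under the integral, and the integrand vanishes on
    the larger ball. *)
Lemma steklov_first_order a d e i g x : 0 < d -> 0 < e -> Ck 1 (ball a (d + e)) g ->
  (forall y, ball a (d + e) y -> first_order c g y = 0) ->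
  ball a d x -> first_order c (steklov e i g) x = 0.
Proof.
move=> d0 e0 cg Dg xB; rewrite /first_order.
under eq_bigr => j _ do rewrite (steklov_partial _ _ d0 e0 cg xB) /steklov.
have cj j A : continuous01 (fun t => ccoef (partial j g ((t * e) *: delta_mx 0 i + x)) A).
  have [_ /(_ j)[_ cdg]] := cg.
  have [cdgA _] : Ck 0 (ball a (d + e)) (fun x => ccoef (partial j g x) A).
    by apply: (Ck_ccoef _ _ (ball_open _ _)).1.
  exact: (jcont_continuous01 (steklov_jcont (i := i) d0 e0 cdgA) xB).
under eq_bigr => j _ do have [-> _] := cmul_cint (c j) (cj j).
rewrite cint_sum => [|j A]; last by have [_ /(_ A)] := cmul_cint (c j) (cj j).
rewrite -[RHS](@cint0 R n); apply: cliffordP => A; rewrite !ccoef_cint.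
by apply: eq_int01 => t t01; congr ccoef; apply: Dg; exact: steklov_ball.
Qed.

Lemma steklov_partial_Ck1 a d e i j g : 0 < d -> 0 < e -> Ck 1 (ball a (d + e)) g ->
  Ck 1 (ball a (d + e)) (partial j g) -> Ck 1 (ball a d) (partial j (steklov e i g)).
Proof.
move=> d0 e0 cg cdg.
apply: (Ck_eq (ball_open _ _)) (steklov_Ck1 i d0 e0 cdg) => x xB.
by rewrite (steklov_partial i j d0 e0 cg xB).
Qed.

Lemma steklov_partial_self_Ck1 a d e i g : 0 < d -> 0 < e -> Ck 1 (ball a (d + e)) g ->
  Ck 1 (ball a d) (partial i (steklov e i g)).
Proof.
move=> d0 e0 cg; have oB := ball_open a d.
have cgA A : Ck 1 (ball a (d + e)) (fun x => ccoef (g x) A).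
  by apply: (Ck_ccoef _ _ (ball_open _ _)).1.
have sub : ball a d `<=` ball a (d + e) by apply: le_ball; rewrite lerDl ltW.
apply/(Ck_ccoef _ _ oB) => A.
apply: (Ck_eq oB (F := fun x => e^-1 *: (ccoef (g (e *: delta_mx 0 i + x)) A - ccoef (g x) A))).
  move=> x xB; rewrite (steklov_partial i i d0 e0 cg xB) ccoef_steklov.
  apply: etrans (esym (steklov1_partial_self i d0 e0 (cgA A) xB)) _.
  rewrite (partial_val (steklov1_partial i i d0 e0 (cgA A) xB)).
  apply: eq_int01 => t t01; apply: partial_val.
  by apply: is_partial_ccoef; have [_ /(_ i)[+ _]] := cg; apply; exact: steklov_ball.
apply: CkZ => //; apply: CkB => //; last exact: Ck_subset (cgA A).
apply: Ck_translate (cgA A) => x xB.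
by apply: ball_shift => //; [exact: ltW|rewrite gtr0_norm].
Qed.

(* Averaging [g] once along each axis keeps it a solution, with the same bound,
   and makes it [C^2]; [L] stands for the value at [a] of the derivative to be
   estimated. *)
Lemma smoothing a (l : 'I_N) (L : cliff) M (eta e rho sigma rho' sigma' : R)
    (s : seq 'I_N) g :
  0 < e -> 0 < sigma -> sigma <= rho ->
  rho' = rho + (size s)%:R * e -> sigma' = sigma + (size s)%:R * e ->
  Ck 1 (ball a rho') g -> (forall x, ball a rho' x -> first_order c g x = 0) ->
  (forall x A, ball a rho' x -> `|ccoef (g x) A| <= M) ->
  (forall x A, ball a sigma' x -> `|ccoef (partial l g x) A - ccoef L A| <= eta) ->
  exists h, [/\ Ck 1 (ball a rho) h,
     forall x, ball a rho x -> first_order c h x = 0,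
     forall x A, ball a rho x -> `|ccoef (h x) A| <= M,
     forall x A, ball a sigma x -> `|ccoef (partial l h x) A - ccoef L A| <= eta
   & forall i, i \in s -> Ck 1 (ball a rho) (partial i h)].
Proof.
move=> e0 s0; elim: s rho sigma s0 g => [|i s IH] rho sigma s0 g sr.
  rewrite /= mul0r !addr0 => -> -> cg Dg gM gL; exists g.
  split; [exact: cg|exact: Dg|exact: gM|exact: gL|].
  by move=> i ib; exfalso; rewrite in_nil in ib.
have r0 : 0 < rho by apply: lt_le_trans sr.
have E (v : R) : v + (size (i :: s))%:R * e = (v + e) + (size s)%:R * e.
  by rewrite /= -[in LHS]natr1; ring.
rewrite (E rho) (E sigma) => rE sE cg Dg gM gL.
have [||h [ch Dh hM hL hs]] := IH (rho + e) (sigma + e) _ g _ rE sE cg Dg gM gL.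
- exact: addr_gt0.
- by rewrite lerD2r.
have chA A : Ck 1 (ball a (rho + e)) (fun x => ccoef (h x) A).
  by apply: (Ck_ccoef _ _ (ball_open _ _)).1.
have sub : ball a (sigma + e) `<=` ball a (rho + e) by apply: le_ball; rewrite lerD2r.
have sub' : ball a sigma `<=` ball a rho by apply: le_ball.
have [ch0 dh] := ch.
exists (steklov e i h); split.
- exact: steklov_Ck1.
- by move=> x xB; exact: (steklov_first_order i r0 e0 ch Dh xB).
- move=> x A xB; rewrite ccoef_steklov -[X in `|X|]subr0.
  apply: (steklov1_near i r0 e0 _ _ xB) => y yB; first by have [+ _] := chA A; exact.
  by rewrite subr0; exact: hM.
- move=> x A xB; rewrite (steklov_partial i l r0 e0 ch (sub' _ xB)) ccoef_steklov.
  apply: (steklov1_near i s0 e0 _ _ xB) => y yB; last exact: hL.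
  have [_ [cdh _]] := dh l.
  exact: (@continuous_comp _ _ _ (partial l h) (fun z => ccoef z A) y (cdh _ (sub _ yB)) (@ccoef_continuous _ _ A _)).
(* Along the new axis a derivative is gained; along the axes already treated the regularity is
   inherited, because averaging commutes with [partial j]. *)
- move=> j; rewrite inE => /predU1P[->|js]; first exact: steklov_partial_self_Ck1.
  apply: steklov_partial_Ck1; [exact: r0|exact: e0|exact: ch|exact: hs].
Qed.

(** The smoothed solution is [C^2], so its coefficients are harmonic and [harmonic_gradient_bound]
    applies with the same [M]. Its derivative at [a] differs from that of [g] by at most [eta],
    which is arbitrary. *)
Lemma first_order_gradient_bound a d r M g (l : 'I_N) A :
  0 < d -> d < r -> 0 < M -> Ck 1 (ball a r) g ->
  (forall x, ball a r x -> first_order c g x = 0) ->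
  (forall x A, ball a r x -> `|ccoef (g x) A| <= M) ->
  `|ccoef (partial l g a) A| <= (N%:R + 1) * M / d.
Proof.
move=> d0 dr M0 cg Dg gM; apply/ler_addgt0Pr => eta eta0.
have [_ /(_ l)[d1 [cdg _]]] := cg.
have r0 : 0 < r by exact: lt_trans dr.
have [del del0 delB] := continuous_ballP (cdg a (ballxx _ r0)) eta0.
pose k : R := N%:R + 1.
have k0 : 0 < k by rewrite ltr_wpDl.
(* The harmonic bound uses the closed cube of radius [d], which fits in the open ball of radius
   [rho]; the gap between [rho] and [r] is spent on averaging. *)
pose rho := (d + r) / 2.
(* With this step the [N] averages together move points by less than half of the minimum. They stay
   inside radius [r] when started in radius [rho], and inside [del], where the derivative is within
   [eta] of its value at [a], when started in radius [sigma]. *)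
pose e := Num.min (r - rho) (Num.min del rho) / (2 * k).
have rr : rho < r by rewrite /rho; lra.
have dr' : d < rho by rewrite /rho; lra.
have rho0 : 0 < rho by lra.
have m0 : 0 < Num.min (r - rho) (Num.min del rho) by rewrite !lt_min subr_gt0 rr del0.
have e0 : 0 < e by rewrite divr_gt0// mulr_gt0.
have sz : (size (enum 'I_N))%:R = N%:R :> R by rewrite size_enum_ord.
have Ne : N%:R * e < Num.min (r - rho) (Num.min del rho) / 2.
  have -> : Num.min (r - rho) (Num.min del rho) / 2 = k * e by rewrite /e; field; rewrite gt_eqF.
  by rewrite ltr_pM2r// /k ltrDl.
have [mr md mrho] : [/\ Num.min (r - rho) (Num.min del rho) <= r - rho,
    Num.min (r - rho) (Num.min del rho) <= del & Num.min (r - rho) (Num.min del rho) <= rho].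
  by rewrite !ge_min !lexx !orbT.
pose sigma := Num.min (r - rho) (Num.min del rho) / 2.
have sigma0 : 0 < sigma by rewrite divr_gt0.
have sub1 : ball a (rho + (size (enum 'I_N))%:R * e) `<=` ball a r.
  by apply: le_ball; rewrite sz; lra.
have sub2 : ball a (sigma + (size (enum 'I_N))%:R * e) `<=` ball a del.
  by apply: le_ball; rewrite sz /sigma; lra.
have sr : sigma <= rho by rewrite /sigma; lra.
have [||||h [ch Dh hM hL hs]] := @smoothing a l (partial l g a) M eta e rho sigma _ _
  (enum 'I_N) g e0 sigma0 sr erefl erefl.
- exact: Ck_subset cg.
- by move=> x /sub1; exact: Dg.
- by move=> x B /sub1; exact: gM.
- move=> x B /sub2 /delB/ltW; rewrite distrC => /(norm_ccoef _ (ltW eta0))/(_ B).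
  by rewrite ccoefB.
have oB := ball_open a rho.
have c2 : Ck 2 (ball a rho) h.
  have [c0 dh] := ch; split; first exact: c0.
  move=> i; have [dd _] := dh i; split; first exact: dd.
  by apply: hs; rewrite mem_enum.
have cA : Ck 2 (ball a rho) (fun x => ccoef (h x) A) by apply: (Ck_ccoef _ _ oB).1.
have P1 i y : ball a rho y -> partial i (fun x => ccoef (h x) A) y = ccoef (partial i h y) A.
  by move=> yB; apply/partial_val/is_partial_ccoef; have [_ /(_ i)[+ _]] := ch; exact.
have harm y : ball a rho y -> \sum_i partial i (partial i (fun x => ccoef (h x) A)) y = 0.
  move=> yB; have H := first_order_harmonic oB c2 Dh yB.
  apply: etrans _ (etrans (congr1 (ccoef ^~ A) H) _); last by rewrite /ccoef mxE.
  rewrite ccoef_sum; apply: eq_bigr => i _.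
  apply: etrans (derive_eq_near _ oB yB (P1 i)) _.
  apply/partial_val/is_partial_ccoef; have [_ /(_ i)[_ [_ /(_ i)[+ _]]]] := c2.
  exact.
have aB : ball a rho a by apply: ballxx.
have B1 := harmonic_gradient_bound l oB cA harm d0 M0.
have {B1} B1 : `|ccoef (partial l h a) A| <= (N%:R + 1) * M / d.
  rewrite -(P1 l a aB); apply: B1 => x xd.
  have xB : ball a rho x by apply/rV_ballP => // i; exact: le_lt_trans (xd i) dr'.
  by split=> //; exact: hM.
have := hL a A (ballxx _ sigma0).
move: B1; move: (ccoef _ _) (ccoef _ _) (_ / d) => u v w h1.
have := ler_distD v u 0; rewrite !subr0 (distrC u v) => h2 h3; lra.
Qed.

End FirstOrderSystem.

(** * Difference quotients with a uniform Cauchy rate *)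

Section UniformQuotients.
Context {R : realType} {N : nat}.
Implicit Types (x y a : 'rV[R]_N) (v : 'rV[R]_N -> R).

Definition quotient1 (i : 'I_N) (h : R) v x : R :=
  h^-1 * (v (h *: delta_mx 0 i + x) - v x).

Lemma small_step (C e : R) (rho : R) : 0 <= C -> 0 < e -> 0 < rho ->
  exists2 k, 0 < k < rho & C * k <= e.
Proof.
move=> C0 e0 rho0; have C1 : 0 < C + 1 by rewrite ltr_wpDl.
pose k := Num.min (rho / 2) (e / (C + 1)).
have k0 : 0 < k by rewrite lt_min !divr_gt0.
exists k; first by rewrite k0 gt_min; apply/orP; left; lra.
have : k <= e / (C + 1) by rewrite ge_min lexx orbT.
by rewrite ler_pdivlMr// => /(le_trans _); apply; rewrite mulrC ler_pM2l// lerDl.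
Qed.

(** Completeness gives the limit of the quotients, and letting one of the two steps tend to [0] in
    the hypothesis gives the rate. The rate is what makes the convergence uniform in the point later
    on. *)
Lemma has_partial_cauchy v x (i : 'I_N) (rho C : R) : 0 < rho -> 0 <= C ->
  (forall h k : R, 0 < `|h| < rho -> 0 < `|k| < rho ->
     `|quotient1 i h v x - quotient1 i k v x| <= C * (`|h| + `|k|)) ->
  has_partial i v x /\
  forall h : R, 0 < `|h| < rho -> `|partial i v x - quotient1 i h v x| <= C * `|h|.
Proof.
move=> rho0 C0 H.
pose f (h : R) := h^-1 *: (v (h *: delta_mx 0 i + x) - v x).
have cf : cvg (f @ (0:R)^').
  apply/cauchy_cvgP/cauchyP => e e0.
  have [k /andP[k0 kr] ke] := small_step C0 (divr_gt0 e0 (ltr0n _ 4)) rho0.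
  exists (f k); exists k => // h /=; rewrite sub0r normrN => hk h0.
  have nh : 0 < `|h| < rho by rewrite normr_gt0 h0 (lt_trans hk).
  have nk : 0 < `|k| < rho by rewrite gtr0_norm// k0.
  have := H k h nk nh; rewrite -[quotient1 i k v x]/(f k) -[quotient1 i h v x]/(f h).
  rewrite (gtr0_norm k0); have : C * `|h| <= C * k by apply: ler_wpM2l => //; exact: ltW.
  rewrite mulrDr /ball/=; lra.
split=> // h nh; apply/ler_addgt0Pr => e e0.
have lim : f k @[k --> (0:R)^'] --> partial i v x by exact: cf.
have /cvgrPdist_lt/(_ (e / 2))[|d /= d0 dH] := lim; first by rewrite divr_gt0.
have rd0 : 0 < Num.min rho d by rewrite lt_min rho0.
have [k /andP[k0]] := small_step C0 (divr_gt0 e0 (ltr0n _ 2)) rd0.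
rewrite lt_min => /andP[kr kd] ke.
have nk : 0 < `|k| < rho by rewrite gtr0_norm// k0.
have h1 := H k h nk nh; have := dH k; rewrite /= sub0r normrN gtr0_norm// => /(_ kd).
rewrite gt_eqF// => /(_ isT) h2.
have := ler_distD (f k) (partial i v x) (quotient1 i h v x).
move: h1; rewrite -[quotient1 i k v x]/(f k) mulrDr (gtr0_norm k0).
by move: h2; move: (partial i v x) (f k) (quotient1 i h v x) => P Q S; lra.
Qed.

(** Near [x] the derivative is a uniform limit of difference quotients, which are continuous because
    [v] is. *)
Lemma partial_continuous_quotients v x (i : 'I_N) (rho C : R) : 0 < rho -> 0 <= C ->
  (forall y, ball x (rho + rho) y -> {for y, continuous v}) ->
  (forall y, ball x rho y -> forall h : R, 0 < `|h| < rho ->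
     `|partial i v y - quotient1 i h v y| <= C * `|h|) ->
  {for x, continuous (partial i v)}.
Proof.
move=> rho0 C0 cv H; apply: continuous_ball_intro => e e0.
have [h /andP[h0 hr] he] := small_step C0 (divr_gt0 e0 (ltr0n _ 4)) rho0.
have nh : 0 < `|h| < rho by rewrite gtr0_norm// h0.
have cq : {for x, continuous (quotient1 i h v)}.
  have c1 : v y @[y --> x] --> v x by apply: cv; apply: ballxx; exact: addr_gt0.
  have ct : {for x, continuous (fun y => h *: delta_mx 0 i + y)}.
    exact: (cvgD (cvg_cst _) cvg_id).
  have c2 : v (h *: delta_mx 0 i + y) @[y --> x] --> v (h *: delta_mx 0 i + x).
    apply: (@continuous_comp _ _ _ _ v x ct); apply: cv.
    apply: ball_shift; [exact: rho0|exact: ltW|exact: ballxx|].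
    by rewrite gtr0_norm// ltW.
  exact: (cvgM (cvg_cst _) (cvgB c2 c1)).
have [d d0 dH] := continuous_ballP cq (divr_gt0 e0 (ltr0n _ 2)).
exists (Num.min rho d) => [|y yB]; first by rewrite lt_min rho0.
have yr : ball x rho y by apply: le_ball yB; rewrite ge_min lexx.
have yd : ball x d y by apply: le_ball yB; rewrite ge_min lexx orbT.
have h1 := H x (ballxx _ rho0) h nh; have h2 := H y yr h nh; have h3 := dH y yd.
move: h1 h2 h3; rewrite (gtr0_norm h0).
move: (partial i v x) (partial i v y) (quotient1 i h v x) (quotient1 i h v y) => P Q S T.
move=> h1 h2 h3.
have h4 := ler_distD S P Q; have h5 := ler_distD T S Q; rewrite (distrC T Q) in h5; lra.
Qed.

End UniformQuotients.

(** * Smoothness of solutions of first-order systems *)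

Section Regularity.
Context {R : realType} {n N : nat}.
Local Notation cliff := (clifford R n).
Implicit Types (g : 'rV[R]_N -> cliff) (a x y : 'rV[R]_N) (d e M h : R) (i j : 'I_N).

Variables (c c' : 'I_N -> cliff).
Hypothesis cc' : factors_laplacian c c'.

Definition first_order_sol (U : set 'rV[R]_N) g : Prop :=
  Ck 1 U g /\ forall x, U x -> first_order c g x = 0.

Lemma first_order_solZB (U : set 'rV[R]_N) g (h : 'rV[R]_N -> cliff) (k : R) : open U ->
  first_order_sol U g -> first_order_sol U h ->
  first_order_sol U (fun x => k *: (g x - h x)) /\
  forall i x, U x -> partial i (fun x => k *: (g x - h x)) x =
     k *: (partial i g x - partial i h x).
Proof.
move=> oU [cg Dg] [ch Dh].
have P i x : U x -> partial i (fun x => k *: (g x - h x)) x =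
     k *: (partial i g x - partial i h x).
  move=> Ux; have [_ /(_ i)[dg _]] := cg; have [_ /(_ i)[dh _]] := ch.
  have d1 := dg x Ux; have d2 := dh x Ux.
  apply: etrans (deriveZ _ (derivableB d1 d2)) _.
  by rewrite (deriveB d1 d2).
split; last exact: P.
split; first by apply: CkZ; [exact: oU|apply: CkB; [exact: oU|exact: cg|exact: ch]].
move=> x Ux; apply: etrans (_ : k *: (first_order c g x - first_order c h x) = 0); last first.
  by rewrite (Dg _ Ux) (Dh _ Ux) subrr scaler0.
rewrite /first_order -sumrB scaler_sumr; apply: eq_bigr => i _.
by rewrite (P i x Ux) -clifford_scalerAr mulrBr.
Qed.

Lemma first_order_sol_sub (U U' : set 'rV[R]_N) g : U' `<=` U ->
  first_order_sol U g -> first_order_sol U' g.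
Proof. by move=> s [cg Dg]; split; [exact: Ck_subset cg|move=> x /s; exact: Dg]. Qed.

Lemma first_order_sol_translate (U U' : set 'rV[R]_N) g z : (forall x, U' x -> U (z + x)) ->
  first_order_sol U g -> first_order_sol U' (fun x => g (z + x)).
Proof.
move=> s [cg Dg]; split; first exact: Ck_translate cg.
move=> x /s Uzx; apply: etrans _ (Dg _ Uzx).
by apply: eq_bigr => i _; exact: (congr1 (fun z => c i * z) (derive_translate _ _ _ _)).
Qed.

Lemma sol_gradient_bound a d M g i A : 0 < d -> 0 < M ->
  first_order_sol (ball a (d + d)) g ->
  (forall x A, ball a (d + d) x -> `|ccoef (g x) A| <= M) ->
  `|ccoef (partial i g a) A| <= (N%:R + 1) * M / d.
Proof.
move=> d0 M0 [cg Dg] gM.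
by apply: (first_order_gradient_bound cc' i A d0 _ M0 cg Dg gM); rewrite ltrDl.
Qed.

Definition quotient i (h : R) g x : cliff := h^-1 *: (g (h *: delta_mx 0 i + x) - g x).

Lemma ccoef_quotient i h g x A :
  ccoef (quotient i h g x) A = quotient1 i h (fun x => ccoef (g x) A) x.
Proof. by rewrite ccoefZ ccoefB. Qed.

Lemma quotient_sol a d i (h rho : R) g : 0 < d -> `|h| < rho ->
  first_order_sol (ball a (d + rho)) g ->
  first_order_sol (ball a d) (quotient i h g) /\
  forall j x, ball a d x -> partial j (quotient i h g) x = quotient i h (partial j g) x.
Proof.
move=> d0 hr sg; have rho0 : 0 <= rho by apply: le_trans (ltW hr).
have s1 : first_order_sol (ball a d) (fun x => g (h *: delta_mx 0 i + x)).
  apply: first_order_sol_translate sg => x xB; apply: ball_shift => //; exact: ltW.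
have s2 : first_order_sol (ball a d) g.
  by apply: first_order_sol_sub sg; apply: le_ball; rewrite lerDl.
have [s3 P] := first_order_solZB h^-1 (ball_open a d) s1 s2.
split; first exact: s3.
move=> j x xB; apply: etrans (P j x xB) _.
exact: (congr1 (fun z => h^-1 *: (z - partial j g x)) (derive_translate _ _ _ _)).
Qed.

(* The difference quotients of [g] and their differences are again solutions, so
   the gradient bound applies to them; it makes the quotients of [partial j g]
   Cauchy as the step tends to [0]. *)
Lemma quotient_estimates x0 (rho M : R) g : 0 < rho -> 0 < M ->
  first_order_sol (ball x0 (8 * rho)) g ->
  (forall i x A, ball x0 (8 * rho) x -> `|ccoef (partial i g x) A| <= M) ->
  let C1 := (N%:R + 1) * M / rho in let C := (N%:R + 1) * C1 / rho in
  forall i j x A (h k : R), ball x0 rho x -> 0 < `|h| < rho -> 0 < `|k| < rho ->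
  `|quotient1 i h (fun x => ccoef (partial j g x) A) x
    - quotient1 i k (fun x => ccoef (partial j g x) A) x| <= C * (`|h| + `|k|).
Proof.
move=> rho0 M0 sg gM C1 C.
have N1 : 0 < N%:R + 1 :> R by rewrite ltr_wpDl.
have C10 : 0 < C1 by rewrite divr_gt0// mulr_gt0.
have [cg Dg] := sg; have [_ dg] := cg.
have dgA i x A : ball x0 (8 * rho) x -> is_derive x (delta_mx 0 i)
    (fun x => ccoef (g x) A) (ccoef (partial i g x) A).
  by move=> xB; apply: is_partial_ccoef; have [+ _] := dg i; exact.
have mvt i x A (h : R) b : 0 < b -> `|h| < rho -> b + rho <= 8 * rho -> ball x0 b x ->
    exists2 t : R, 0 <= t <= 1 & ccoef (g (h *: delta_mx 0 i + x)) A - ccoef (g x) A =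
      h * ccoef (partial i g ((t * h) *: delta_mx 0 i + x)) A.
  move=> b0 hr br xB.
  have B (t : R) : 0 <= t <= 1 -> ball x0 (8 * rho) ((t * h) *: delta_mx 0 i + x).
    move=> /andP[t0 t1]; apply: (le_ball br); apply: ball_shift; [exact: b0|exact: ltW|exact: xB|].
    by rewrite normrM ger0_norm// (le_trans _ (ltW hr))// ler_piMl.
  have [|t t01] := @mvt_line R _ (fun x => ccoef (g x) A) x (h *: delta_mx 0 i).
    move=> t t01; rewrite scalerA; have [d1 _] := dgA i _ A (B t t01).
    by have [] := is_derive_scalev h d1.
  rewrite scalerA => E; exists t => //; apply: etrans E _.
  have [d1 d2] := dgA i _ A (B t t01).
  by have [_ ->] := is_derive_scalev h d1; rewrite d2.
have subq b x d : ball x0 b x -> b + d <= 8 * rho -> 0 < d -> ball x d `<=` ball x0 (8 * rho).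
  move=> xB bd d0 y yB; apply: (le_ball bd); exact: ball_triangle xB yB.
(* The quotient of [g] is a solution bounded by [M], by the mean value theorem. Its gradient bound
   says that [partial j g] is Lipschitz along the axis [i], with constant [C1]. *)
have stepA i j x A (h : R) : ball x0 (4 * rho) x -> 0 < `|h| < rho ->
    `|ccoef (partial j g (h *: delta_mx 0 i + x)) A - ccoef (partial j g x) A| <= C1 * `|h|.
  move=> xB /andP[h0 hr].
  have sx : first_order_sol (ball x (rho + rho + rho)) g.
    apply: first_order_sol_sub sg; apply: (subq _ _ _ xB); first by lra.
    by rewrite !addr_gt0.
  have [sq Pq] := quotient_sol i (addr_gt0 rho0 rho0) hr sx.
  have qM y B : ball x (rho + rho) y -> `|ccoef (quotient i h g y) B| <= M.
    move=> yB; rewrite ccoef_quotient /quotient1.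
    have yB' : ball x0 (6 * rho) y.
      by have := ball_triangle xB yB; apply: le_ball; lra.
    have [||t t01 ->] := mvt i y B h (6 * rho) _ hr _ yB'; [lra|lra|].
    rewrite mulrA mulVf ?mul1r -?normr_gt0//; apply: gM.
    have /andP[t0 t1] := t01.
    have : ball x0 (6 * rho + rho) ((t * h) *: delta_mx 0 i + y).
      apply: ball_shift; [lra|lra|exact: yB'|].
      by rewrite normrM ger0_norm// (le_trans _ (ltW hr))// ler_piMl.
    by apply: le_ball; lra.
  have := sol_gradient_bound j A rho0 M0 sq qM.
  rewrite (Pq j x (ballxx _ (addr_gt0 rho0 rho0))) ccoef_quotient /quotient1.
  by rewrite normrM normfV mulrC ler_pdivrMr.
move=> i j x A h k xB hr kr.
have [/andP[h0 hr'] /andP[k0 kr']] := (hr, kr).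
(* The quotient of step [l] is a value of [partial i g] at distance at most [|l|] along the axis
   [i], so [stepA] compares it with the value at [y]. *)
have near_partial (l : R) y B : 0 < `|l| < rho -> ball x0 (3 * rho) y ->
    `|ccoef (quotient i l g y) B - ccoef (partial i g y) B| <= C1 * `|l|.
  move=> /andP[l0 lr] yB; rewrite ccoef_quotient /quotient1.
  have [||t t01 ->] := mvt i y B l (3 * rho) _ lr _ yB; [lra|lra|].
  rewrite mulrA mulVf ?mul1r -?normr_gt0//.
  have /andP[t0 t1] := t01.
  have [->|tn] := eqVneq t 0.
    by rewrite mul0r scale0r add0r subrr normr0 mulr_ge0// ltW.
  have tl : `|t * l| <= `|l| by rewrite normrM ger0_norm// ler_piMl.
  apply: le_trans (stepA i i y B (t * l) _ _) _.
  - by apply: le_ball yB; lra.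
  - by rewrite (le_lt_trans tl lr) andbT normr_gt0 mulf_neq0// -normr_gt0.
  - by rewrite ler_pM2l.
have sx (l : R) : 0 < `|l| < rho -> first_order_sol (ball x (rho + rho)) (quotient i l g) /\
    forall j y, ball x (rho + rho) y -> partial j (quotient i l g) y = quotient i l (partial j g) y.
  move=> /andP[l0 lr]; apply: (quotient_sol i (addr_gt0 rho0 rho0) lr).
  apply: first_order_sol_sub sg; apply: (subq _ _ _ xB); first lra.
  by rewrite !addr_gt0.
have [sh Ph] := sx h hr; have [sk Pk] := sx k kr.
(* By [near_partial] the difference of two quotients is a solution of size [C1 (|h| + |k|)]. A
   second use of the gradient bound, now to this difference, yields the constant [C]. *)
have [sd Pd] := first_order_solZB 1 (ball_open x (rho + rho)) sh sk.
have M1 : 0 < C1 * (`|h| + `|k|) by rewrite mulr_gt0// addr_gt0.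
have dM y B : ball x (rho + rho) y ->
    `|ccoef (1 *: (quotient i h g y - quotient i k g y)) B| <= C1 * (`|h| + `|k|).
  move=> yB; have yB' : ball x0 (3 * rho) y.
    by have := ball_triangle xB yB; apply: le_ball; lra.
  have := near_partial h y B hr yB'; have := near_partial k y B kr yB'.
  rewrite scale1r ccoefB mulrDr.
  move: (ccoef (quotient i h g y) B) (ccoef (quotient i k g y) B) (ccoef (partial i g y) B).
  by move=> u v w h1 h2; have := ler_distD w u v; rewrite (distrC w v); lra.
have xx := ballxx x (addr_gt0 rho0 rho0).
have := sol_gradient_bound j A rho0 M1 sd dM.
have E : ccoef (partial j (fun y => 1 *: (quotient i h g y - quotient i k g y)) x) A =
    quotient1 i h (fun x => ccoef (partial j g x) A) x
    - quotient1 i k (fun x => ccoef (partial j g x) A) x.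
  apply: etrans (congr1 (ccoef ^~ A) (etrans (Pd j x xx) (scale1r _))) _.
  apply: etrans (ccoefB _ _ _) _; apply: (congr2 (fun u v : R => u - v)).
    exact: etrans (congr1 (ccoef ^~ A) (Ph j x xx)) (ccoef_quotient _ _ _ _ _).
  exact: etrans (congr1 (ccoef ^~ A) (Pk j x xx)) (ccoef_quotient _ _ _ _ _).
rewrite E.
move=> /le_trans; apply; rewrite /C.
by rewrite [leLHS](_ : _ = (N%:R + 1) * C1 / rho * (`|h| + `|k|))//; field; rewrite gt_eqF.
Qed.

Lemma sol_local_bound (U : set 'rV[R]_N) g x : open U -> U x -> Ck 0 U g ->
  exists2 d, 0 < d & ball x d `<=` U /\
    exists2 M, 0 < M & forall y A, ball x d y -> `|ccoef (g y) A| <= M.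
Proof.
move=> oU Ux [cg _]; have [d1 d10 d1U] := open_ball_sub oU Ux.
have [d2 d20 d2g] := continuous_ballP (cg x Ux) ltr01.
exists (Num.min d1 d2); first by rewrite lt_min d10.
split; first by apply: subset_trans d1U; apply: le_ball; rewrite ge_min lexx.
have M0 : 0 < `|g x| + 1 by rewrite ltr_wpDl.
exists (`|g x| + 1) => // y A yB; move: A; apply/(norm_ccoef _ (ltW M0)).
have : ball x d2 y by apply: le_ball yB; rewrite ge_min lexx orbT.
move=> /d2g h; have := ler_distD (g x) (g y) 0; rewrite !subr0 distrC; lra.
Qed.

(** The gain from [C^1] to [C^2]: around each point all first derivatives are bounded, so
    [quotient_estimates] makes the quotients of [partial j g] Cauchy with a uniform rate. Their
    limits are the second derivatives, and they are continuous. *)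
Lemma first_order_sol_partial_Ck1 (U : set 'rV[R]_N) g j : open U ->
  first_order_sol U g -> Ck 1 U (partial j g).
Proof.
move=> oU sg; have [cg Dg] := sg; have [cg0 dg] := cg.
have key x0 A i : U x0 -> has_partial i (fun x => ccoef (partial j g x) A) x0 /\
    {for x0, continuous (partial i (fun x => ccoef (partial j g x) A))}.
  move=> Ux0.
  have H i' := sol_local_bound oU Ux0 (dg i').2.
  have [|i'|d d0 dH] := @common_radius R N (fun i' d => ball x0 d `<=` U /\
      exists2 M, 0 < M & forall y A, ball x0 d y -> `|ccoef (partial i' g y) A| <= M).
  - move=> i' d d' dd [h1 [M M0 h2]]; split; first exact: subset_trans (le_ball dd) h1.
    by exists M => // y B yB; apply: h2; exact: le_ball yB.
  - exact: H i'.
  have [r Hr] := choice (fun i' => let: ex_intro2 M a b := (dH i').2 in ex_intro _ M (conj a b)).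
  pose M := 1 + \sum_i' r i'.
  have M0 : 0 < M by rewrite ltr_pwDl// sumr_ge0// => i' _; have [/ltW] := Hr i'.
  pose rho := d / 8.
  have rho0 : 0 < rho by rewrite divr_gt0.
  have d8 : 8 * rho = d by rewrite /rho; field.
  have dU : ball x0 d `<=` U by have [] := dH i.
  have gM i' x B : ball x0 (8 * rho) x -> `|ccoef (partial i' g x) B| <= M.
    rewrite d8 => xB; have [_ h] := Hr i'; apply: le_trans (h x B xB) _.
    rewrite /M (bigD1 i')//= addrCA lerDl addr_ge0// sumr_ge0// => k _.
    by have [/ltW] := Hr k.
  have sg' : first_order_sol (ball x0 (8 * rho)) g.
    by rewrite d8; exact: first_order_sol_sub sg.
  have E := quotient_estimates rho0 M0 sg' gM.
  set C := (N%:R + 1) * ((N%:R + 1) * M / rho) / rho in E.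
  have C0 : 0 <= C by rewrite /C !(divr_ge0, mulr_ge0)// ltW.
  have Q y : ball x0 rho y -> has_partial i (fun x => ccoef (partial j g x) A) y /\
     forall h : R, 0 < `|h| < rho -> `|partial i (fun x => ccoef (partial j g x) A) y
        - quotient1 i h (fun x => ccoef (partial j g x) A) y| <= C * `|h|.
    move=> yB; apply: (has_partial_cauchy rho0 C0) => h k hr kr.
    exact: E.
  split; first by have [] := Q x0 (ballxx _ rho0).
  apply: (partial_continuous_quotients rho0 C0) => y yB; last by have [] := Q y yB.
  have Uy : U y by apply: dU; apply: le_ball yB; rewrite -d8; lra.
  have [_ [cdg _]] := dg j.
  exact: (@continuous_comp _ _ _ (partial j g) (fun z => ccoef z A) y (cdg _ Uy) (@ccoef_continuous _ _ A _)).
by apply/(Ck_ccoef _ _ oU) => A; apply/(C1_on_Ck1 _ oU) => i x Ux; exact: key.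
Qed.

(** The symbol is constant, so the differentiated equation is the same equation. This closes the
    class of solutions under derivatives and lets the gain of one derivative be repeated. *)
Lemma first_order_sol_partial (U : set 'rV[R]_N) g j : open U ->
  first_order_sol U g -> first_order_sol U (partial j g).
Proof.
move=> oU sg; have [cg Dg] := sg; split; first exact: first_order_sol_partial_Ck1.
have c2 : Ck 2 U g.
  have [cg0 dg] := cg; split; first exact: cg0.
  move=> i; have [di _] := dg i; split; first exact: di.
  exact: first_order_sol_partial_Ck1.
move=> x Ux; apply: etrans _ (first_order_partial0 j oU c2 Dg Ux).
apply: eq_bigr => i _; apply: (congr1 (fun z => c i * z)).
exact: Ck2_clifford_partialC oU c2 Ux.
Qed.

Theorem first_order_sol_smooth (U : set 'rV[R]_N) g : open U ->
  first_order_sol U g -> smooth U g.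
Proof.
move=> oU sg k; elim: k g sg => [|k IH] g sg; have [cg Dg] := sg.
  by split=> // x Ux; exact: Ck_cont cg Ux.
have [cg0 dg] := cg; split; first exact: cg0.
move=> i; have [di _] := dg i; split; first exact: di.
by apply: IH; exact: first_order_sol_partial.
Qed.

Lemma first_order_sol_harmonic (U : set 'rV[R]_N) g x : open U ->
  first_order_sol U g -> U x -> \sum_i partial i (partial i g) x = 0.
Proof.
move=> oU sg; have [_ Dg] := sg.
exact: (first_order_harmonic cc' oU (first_order_sol_smooth oU sg 2) Dg).
Qed.

End Regularity.

Lemma ccoef0 {R : realType} {n : nat} A : ccoef (0 : clifford R n) A = 0.
Proof. by rewrite /ccoef mxE. Qed.

(** * Unique continuation from a point where all derivatives vanish *)

Section UniqueContinuation.
Context {R : realType} {n N : nat}.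
Local Notation cliff := (clifford R n).
Implicit Types (g : 'rV[R]_N -> cliff) (a x y : 'rV[R]_N) (d e M : R) (i : 'I_N).

Variables (c c' : 'I_N -> cliff).
Hypothesis cc' : factors_laplacian c c'.

Definition partials (s : seq 'I_N) g : 'rV[R]_N -> cliff := foldr partial g s.

Lemma partials_sol (U : set 'rV[R]_N) s g : open U ->
  first_order_sol c U g -> first_order_sol c U (partials s g).
Proof.
move=> oU sg; elim: s => [|i s IH]; first exact: sg.
exact: (first_order_sol_partial cc' i oU IH).
Qed.

Lemma sol_has_partial (U : set 'rV[R]_N) g i x : first_order_sol c U g -> U x -> has_partial i g x.
Proof. by move=> [[_ /(_ i)[+ _]] _]; exact. Qed.

(** Each derivative costs a layer of width [e] and a factor [2 (N + 1) / e], from the gradient bound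
    at radius [e / 2]. *)
Lemma partials_bound s a d e M g : 0 < d -> 0 < e -> 0 < M ->
  first_order_sol c (ball a (d + (size s)%:R * e)) g ->
  (forall x A, ball a (d + (size s)%:R * e) x -> `|ccoef (g x) A| <= M) ->
  forall x A, ball a d x ->
    `|ccoef (partials s g x) A| <= (2 * (N%:R + 1) / e) ^+ size s * M.
Proof.
move=> + e0 M0; elim: s d => [|i s IH] d d0.
  by rewrite /= mul0r addr0 expr0 mul1r => _ gM x A; exact: gM.
have E : d + (size (i :: s))%:R * e = (d + e) + (size s)%:R * e.
  by rewrite /= -[in LHS]natr1; ring.
rewrite E => sg gM x A xB.
have k0 : 0 < 2 * (N%:R + 1) / e by rewrite divr_gt0// mulr_gt0// ltr_wpDl.
have bnd := IH _ (addr_gt0 d0 e0) sg gM.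
have e2 : 0 < e / 2 by rewrite divr_gt0.
have ss : first_order_sol c (ball x (e / 2 + e / 2)) (partials s g).
  apply: (@first_order_sol_sub _ _ _ _ (ball a (d + e + (size s)%:R * e))).
    move=> y; rewrite -splitr => yB; have := ball_triangle xB yB.
    by apply: le_ball; rewrite lerDl mulr_ge0// ltW.
  by apply: partials_sol sg; exact: ball_open.
have M' : 0 < (2 * (N%:R + 1) / e) ^+ size s * M by rewrite mulr_gt0// exprn_gt0.
have := sol_gradient_bound cc' i A e2 M' ss _; rewrite -splitr => /(_ _)/le_trans; apply.
  by move=> y B yB; apply: bnd; exact: ball_triangle xB yB.
rewrite /= exprS; move: ((_ / e) ^+ _) => P.
by rewrite [leLHS](_ : _ = 2 * (N%:R + 1) / e * P * M)//; field; rewrite gt_eqF.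
Qed.

(** Taylor's estimate by descending order of derivation: all derivatives vanish at [a], and a bound
    [B t^j / j!] on the next derivatives integrates, along a path parallel to the axes, to
    [B t^(j+1) / (j+1)!], with [t] the 1-norm distance to [a]. *)
Lemma taylor_vanishing_bound a d (B : R) (k : nat) g : 0 < d -> 0 <= B ->
  first_order_sol c (ball a d) g -> (forall s, partials s g a = 0) ->
  (forall s x A, size s = k -> ball a d x -> `|ccoef (partials s g x) A| <= B) ->
  forall j, (j <= k)%N -> forall s x A, size s = (k - j)%N -> ball a d x ->
    `|ccoef (partials s g x) A| <= B / j`!%:R * norm1 (x - a) ^+ j.
Proof.
move=> d0 B0 sg g0 gB; elim=> [_|j IH jk] s x A.
  by rewrite subn0 fact0 divr1 expr0 mulr1; exact: gB.
move=> sE xB; have IH' := IH (ltnW jk).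
have ss := partials_sol s (ball_open a d) sg.
have f0 : (j.+1`!%:R : R) != 0 by rewrite pnatr_eq0 -lt0n fact_gt0.
have f1 : (j`!%:R : R) != 0 by rewrite pnatr_eq0 -lt0n fact_gt0.
have := @axis_path_bound R N (fun x => ccoef (partials s g x) A)
  (fun t => B / j.+1`!%:R * t ^+ j.+1) (fun t => B / j`!%:R * t ^+ j) a d x d0 _ _ xB.
rewrite g0 ccoef0 subr0 expr0n/= mulr0 subr0; apply.
  move=> t; have Dt : is_derive t 1 (fun t : R => t ^+ j.+1) (j.+1%:R * t ^+ j).
    apply: DeriveDef; first exact: exprn_derivable.
    by rewrite exp_derive /GRing.scale/= mulr1.
  have -> : B / j`!%:R * t ^+ j = (B / j.+1`!%:R) *: (j.+1%:R * t ^+ j).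
    have p0 : (j.+1%:R : R) != 0 by rewrite pnatr_eq0.
    rewrite /GRing.scale/= factS natrM; move: (t ^+ j) (j.+1%:R) p0 => T P p0.
    by field; rewrite f1 p0.
  exact: is_deriveZ.
move=> y yB i; have P := is_partial_ccoef A (sol_has_partial (i := i) ss yB).
split; first by have [] := P.
rewrite (partial_val P); apply: (IH' (i :: s)) => //=.
by rewrite sE subnSK.
Qed.

(** Derivatives of order [k] grow at most like [(C k)^k], which the [1/k!] of Taylor's formula
    reduces to a geometric growth. On a small enough ball the resulting bound tends to [0] with [k],
    as for an analytic function. *)
Lemma sol_vanishing_near (U : set 'rV[R]_N) g a : open U -> first_order_sol c U g -> U a ->
  (forall s, partials s g a = 0) ->
  exists2 d, 0 < d & ball a d `<=` U /\ forall x, ball a d x -> g x = 0.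
Proof.
move=> oU sg Ua g0; have [cg Dg] := sg.
have [d d0 [dU [M M0 gM]]] := sol_local_bound oU Ua (CkS cg).
pose K : R := N%:R + 1; have K0 : 0 < K by rewrite ltr_wpDl.
pose E : R := expR 1; have E0 : 0 < E by exact: expR_gt0.
(* Chosen so that [4 K^2 E r / d = 1/2], the ratio of the geometric bound below. *)
pose r := d / (8 * K * K * E).
have r0 : 0 < r by rewrite divr_gt0// !mulr_gt0.
have E1 : 1 < E by rewrite expR_gt1.
have K1 : 1 <= K by rewrite lerDr.
have rd : r < d / 2.
  have KKE : 1 < K * K * E.
    by apply: lt_le_trans E1 _; rewrite ler_peMl ?(ltW E0)// -[1]mulr1 ler_pM.
  rewrite /r ltr_pM2l// ltf_pV2 ?posrE ?mulr_gt0// -!mulrA mulrA.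
  by move: KKE; rewrite mulrA; lra.
exists r => //; split.
  by apply: subset_trans dU; apply: le_ball; lra.
move=> x xB; apply: cliffordP => A; rewrite ccoef0.
apply/eqP; rewrite -normr_le0; apply/ler_addgt0Pr => e e0; rewrite add0r.
have bound (k : nat) : `|ccoef (g x) A| <= M * (2^-1) ^+ k.+1.
  set k' := k.+1.
  have k0 : 0 < k'%:R :> R by rewrite ltr0n.
  (* The [k'] layers of width [tau] exactly use up the outer half of the ball of radius [d]. *)
  pose tau := d / (2 * k'%:R).
  have tau0 : 0 < tau by rewrite divr_gt0// mulr_gt0.
  pose B := (2 * K / tau) ^+ k' * M.
  have B0 : 0 <= B by rewrite mulr_ge0// ?exprn_ge0 ?divr_ge0 ?mulr_ge0// ltW.
  have d2 : 0 < d / 2 by rewrite divr_gt0.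
  have dE : d / 2 + k'%:R * tau = d by rewrite /tau; field; rewrite gt_eqF.
  have sgd : first_order_sol c (ball a d) g by exact: first_order_sol_sub sg.
  have sB s y A' : size s = k' -> ball a (d / 2) y -> `|ccoef (partials s g y) A'| <= B.
    move=> sE yB; have := @partials_bound s a (d / 2) tau M g d2 tau0 M0.
    by rewrite sE dE => /(_ sgd gM y A' yB).
  have sgd2 : first_order_sol c (ball a (d / 2)) g.
    by apply: first_order_sol_sub sgd; apply: le_ball; lra.
  have xd2 : ball a (d / 2) x by apply: le_ball xB; exact: ltW.
  have := taylor_vanishing_bound d2 B0 sgd2 g0 sB (leqnn k') A _ xd2.
  rewrite subnn => /(_ [::] erefl) /= /le_trans; apply.
  have n1 : norm1 (x - a) <= K * r.
    by apply: le_trans (norm1_ball r0 xB) _; rewrite ler_pM2r// lerDl.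
  have fk : 0 < k'`!%:R :> R by rewrite ltr0n fact_gt0.
  have n2 : norm1 (x - a) ^+ k' <= (K * r) ^+ k' by apply: lerXn2r; rewrite ?nnegrE ?norm1_ge0// mulr_ge0// ltW.
  apply: le_trans (ler_wpM2l _ n2) _; first by rewrite divr_ge0// ltW.
  (* The left side is one term of the exponential series at [k'], hence at most the exponential of
     [k']. *)
  have kE : k'%:R ^+ k' / k'`!%:R <= E ^+ k'.
    have := @expR_ge1Dxn R k'%:R k (ler0n _ _); rewrite -/k'.
    by rewrite -[X in expR X]mulr1 expRM_natl -/E; lra.
  have -> : B / k'`!%:R * (K * r) ^+ k' = M * ((4 * K * K * r / d) ^+ k' * (k'%:R ^+ k' / k'`!%:R)).
    rewrite /B (_ : 4 * K * K * r / d = (2 * K / tau) * (K * r) / k'%:R); last first.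
      by rewrite /tau; field; rewrite !gt_eqF.
    have kk : k'%:R ^+ k' != 0 :> R by rewrite gt_eqF// exprn_gt0.
    move: (2 * K / tau) (K * r) => X Y; rewrite !exprMn exprVn.
    have f0 : k'`!%:R != 0 :> R by rewrite gt_eqF.
    move: (X ^+ k') (Y ^+ k') (k'%:R ^+ k') (k'`!%:R) kk f0 => P Q S F S0 F0.
    by field; rewrite S0 F0.
  rewrite ler_pM2l//; apply: le_trans (ler_wpM2l _ kE) _.
    apply: exprn_ge0; apply: ltW; apply: divr_gt0 d0.
    exact: (mulr_gt0 (mulr_gt0 (mulr_gt0 (ltr0n _ 4) K0) K0) r0).
  rewrite -exprMn (_ : 4 * K * K * r / d * E = 2^-1)//.
  by rewrite /r; field; rewrite !gt_eqF.
have : M * (2^-1) ^+ k @[k --> \oo] --> (0 : R).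
  rewrite -[X in _ --> X](mulr0 M); apply: cvgM; first exact: cvg_cst.
  by apply: cvg_expr; rewrite ger0_norm ?invr_ge0// invf_lt1 ?ltr1n.
move=> /cvgrPdist_lt/(_ e e0)[k _ /(_ k.+1 (leqnSn k))] /=; rewrite sub0r normrN => h.
apply: le_trans (bound k) _; apply: le_trans (ler_norm _) (ltW h).
Qed.

(** The set where all derivatives vanish is open by [sol_vanishing_near], and closed in [U] by
    continuity of the derivatives. *)
Theorem first_order_unique_continuation (U : set 'rV[R]_N) g a : open U -> connected U ->
  first_order_sol c U g -> U a -> (forall s, partials s g a = 0) ->
  forall x, U x -> g x = 0.
Proof.
move=> oU cU sg Ua g0.
pose Z := [set x | U x /\ forall s, partials s g x = 0].
suff ZU : Z = U by move=> x; rewrite -ZU => -[_ /(_ [::])].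
apply: cU; first by exists a.
  exists Z; last by apply/seteqP; split=> [x [Ux Zx]|x [_ Zx]].
  rewrite openE => x [Ux Zx]; have [d d0 [dU gd]] := sol_vanishing_near oU sg Ux Zx.
  apply/nbhs_ballP; exists d => // y yB; split; first exact: dU.
  suff H s z : ball x d z -> partials s g z = 0 by move=> s; exact: H.
  elim: s z => [|i s IH] z zB /=; first exact: gd.
  apply: etrans (derive_eq_near _ (ball_open x d) zB IH) _; exact: derive_cst.
exists (closure Z); first exact: closed_closure.
apply/seteqP; split=> [x [Ux Zx]|x [Ux Zx]]; first by split=> //; apply: subset_closure.
split=> // s; apply/eqP; rewrite -normr_eq0; apply/negPn/negP => ne.
have np : 0 < `|partials s g x| by rewrite lt_neqAle eq_sym ne normr_ge0.
have [cs _] := partials_sol s oU sg.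
have [d d0 dH] := continuous_ballP (Ck_cont cs Ux) np.
have [y [[_ Zy] yB]] := Zx _ (nbhsx_ballx x d d0).
by have := dH y yB; rewrite Zy subr0 ltxx.
Qed.

End UniqueContinuation.

(** * The Vekua system and the representation formula *)

Section SmoothPartials.
Context {R : realType} {m : nat} {W : normedModType R}.
Variables (U : set 'rV[R]_m).
Implicit Types (F G : 'rV[R]_m -> W).

Lemma smooth_partialD F G i x : smooth U F -> smooth U G -> U x ->
  partial i (fun x => F x + G x) x = partial i F x + partial i G x.
Proof.
by move=> sF sG Ux; exact: (deriveD (smooth_has_partial sF Ux) (smooth_has_partial sG Ux)).
Qed.

Lemma smooth_partialZ F (k : R) i x : smooth U F -> U x ->
  partial i (fun x => k *: F x) x = k *: partial i F x.
Proof. by move=> sF Ux; exact: (deriveZ k (smooth_has_partial sF Ux)). Qed.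

Lemma derive_zero_line F x v : (exists2 d : R, 0 < d &
  forall t : R, `|t| < d -> F (t *: v + x) = 0) -> 'D_v F x = 0.
Proof.
move=> [d d0 H].
have H0 : F x = 0 by have := H 0; rewrite scale0r add0r normr0; exact.
have L : h^-1 *: (F (h *: v + x) - F x) @[h --> (0:R)^'] --> (0 : W).
  apply/cvgrPdist_le => e e0; exists d => // h /=; rewrite sub0r normrN => hd h0.
  by rewrite H0 (H h hd) subrr scaler0 subrr normr0 ltW.
exact: (cvg_lim (@norm_hausdorff _ _) L).
Qed.

End SmoothPartials.

Lemma smooth_partial_cmul {R : realType} {m n : nat} (U : set 'rV[R]_m)
    (F : 'rV[R]_m -> clifford R n) (c : clifford R n) i x : smooth U F -> U x ->
  partial i (fun x => c * F x) x = c * partial i F x.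
Proof. by move=> sF Ux; exact/partial_val/is_partial_cmul/(smooth_has_partial sF Ux). Qed.

(** * Conjugation of paravectors and the symbol of the slice operator *)

Section Paravectors.
Context {R : realType} {n : nat}.
Local Notation cliff := (clifford R n).

Definition pconj (i : 'I_n.+1) : cliff := if i == ord0 then 1 else - pgen i.

Lemma pgen0 : pgen ord0 = 1 :> cliff.
Proof. by rewrite /pgen unlift_none. Qed.

(** The polarised form of the identity [conj(x) x = |x|^2] for paravectors. *)
Lemma pconj_pgen (i j : 'I_n.+1) :
  pconj i * pgen j + pconj j * pgen i = ((2 : R) *+ (i == j))%:A :> cliff.
Proof.
rewrite /pconj; case: (unliftP ord0 i) => [i'|] ->; case: (unliftP ord0 j) => [j'|] ->.
- rewrite ![lift _ _ == ord0]eq_sym !(negbTE (neq_lift _ _)) (inj_eq lift_inj).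
  rewrite /pgen !liftK !mulNr -opprD gen_anticomm -scaleNr; congr (_ *: _).
  by case: (i' == j'); rewrite ?mulr1n ?mulr0n ?opprK ?oppr0.
- rewrite eqxx eq_sym !(negbTE (neq_lift _ _)) mulr0n scale0r pgen0 mulr1 mul1r addNr.
  by [].
- rewrite eqxx eq_sym !(negbTE (neq_lift _ _)) mulr0n scale0r pgen0 mulr1 mul1r addrN.
  by [].
- by rewrite !eqxx pgen0 mulr1 mulr1n -mulr2n scaler_nat.
Qed.

End Paravectors.

Section SliceSymbol.
Context {R : realType} {p q : nat}.
Local Notation spoint := 'rV[R]_(p.+1 + 1).
Local Notation cliff := (clifford R (p + q)).
Implicit Types (w : 'rV[R]_q).

Lemma vec_conj w : \sum_(j < q) w 0 j *: pconj (rshift p.+1 j) = - vec w :> cliff.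
Proof.
rewrite /vec -sumrN; apply: eq_bigr => j _.
by rewrite /pconj /= scalerN.
Qed.

(** A vector of the last [q] variables anticommutes with [e_1, ..., e_p] and commutes with
    [e_0 = 1]: moving it past a basis paravector conjugates the latter. *)
Lemma vec_pgenC w (i : 'I_p.+1) :
  vec w * pgen (lshift q i) = pconj (lshift q i) * vec w :> cliff.
Proof.
apply/eqP; rewrite -subr_eq0 -opprB oppr_eq0 addrC -mulNr -vec_conj; apply/eqP.
rewrite mulr_suml mulr_sumr -big_split big1// => j _ /=.
rewrite -scalerAl -clifford_scalerAr -scalerDr pconj_pgen.
have -> : (rshift p.+1 j == lshift q i) = false by rewrite eq_rlshift.
by rewrite mulr0n scale0r scaler0.
Qed.

Lemma vec_sqr w : sphere w -> vec w * vec w = -1 :> cliff.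
Proof.
move=> w1; have two : (2 : R) != 0 by rewrite pnatr_eq0.
have E : (- vec w) * vec w = \sum_(j < q) \sum_(k < q)
    (w 0 j * w 0 k) *: (pconj (rshift p.+1 j) * pgen (rshift p.+1 k)) :> cliff.
  rewrite -vec_conj mulr_suml; apply: eq_bigr => j _; rewrite /vec mulr_sumr.
  by apply: eq_bigr => k _; rewrite -scalerAl -clifford_scalerAr scalerA.
(* Adding the double sum to its transpose brings the terms into the shape of [pconj_pgen], which
   cancels those off the diagonal. *)
have E2 : (- vec w) * vec w + (- vec w) * vec w = (2 : R)%:A :> cliff.
  rewrite {1}E E [X in _ + X]exchange_big -big_split/=.
  apply: etrans (_ : \sum_(j < q) (w 0 j ^+ 2) *: (2 : R)%:A = _); last first.
    by rewrite -scaler_suml w1 scale1r.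
  apply: eq_bigr => j _; rewrite -big_split (bigD1 j)//= big1 ?addr0 => [|k kj].
    by rewrite -scalerDr pconj_pgen eqxx mulr1n.
  rewrite [w 0 k * _]mulrC -scalerDr pconj_pgen.
  have -> : (rshift p.+1 j == rshift p.+1 k) = false.
    by rewrite (inj_eq (@rshift_inj _ _)) eq_sym (negbTE kj).
  by rewrite mulr0n scale0r scaler0.
apply: (scalerI two); apply: oppr_inj.
rewrite scalerN opprK -E2 -scalerN -mulNr.
by rewrite scaler_nat mulr2n.
Qed.

Lemma vec_opp w : vec (- w) = - vec w :> cliff.
Proof. by rewrite /vec -sumrN; apply: eq_bigr => j _; rewrite mxE scaleNr. Qed.

Definition slice_symbol w (k : 'I_(p.+1 + 1)) : cliff :=
  match fintype.split k with inl i => pgen (lshift q i) | inr _ => vec w end.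

Definition slice_symbol_conj w (k : 'I_(p.+1 + 1)) : cliff :=
  match fintype.split k with inl i => pconj (lshift q i) | inr _ => - vec w end.

Lemma slice_symbol_factors w : sphere w ->
  factors_laplacian (slice_symbol w) (slice_symbol_conj w).
Proof.
move=> w1 k l; rewrite /slice_symbol /slice_symbol_conj.
rewrite -(@fintype.splitK _ _ k) -(@fintype.splitK _ _ l) !fintype.unsplitK.
case: (fintype.split k) (fintype.split l) => [i|i] [j|j] /=.
- by rewrite pconj_pgen; congr (_ *+ _ *: _); rewrite !(inj_eq (@lshift_inj _ _)).
- rewrite eq_lrshift mulr0n scale0r mulNr vec_pgenC subrr.
  by [].
- rewrite eq_rlshift mulr0n scale0r mulNr vec_pgenC addNr.
  by [].
- rewrite !ord1 eqxx mulNr vec_sqr// opprK mulr1n -mulr2n scaler_nat.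
  by [].
Qed.

Lemma slice_diracE w (g : spoint -> cliff) x :
  slice_dirac w g x = first_order (slice_symbol w) g x.
Proof.
rewrite /first_order big_split_ord big_ord1; congr (_ + _).
  by apply: eq_bigr => i _; rewrite /slice_symbol (fintype.unsplitK (inl _)).
by rewrite /slice_symbol (fintype.unsplitK (inr _)).
Qed.

End SliceSymbol.

Section RepresentationFormula.
Context {R : realType} {p q : nat}.
Local Notation point := 'rV[R]_(p.+1 + q).
Local Notation spoint := 'rV[R]_(p.+1 + 1).
Local Notation cliff := (clifford R (p + q)).
Local Notation ridx := (@ridx p).
Local Notation rad := (@Defs.rad R p).
Implicit Types (w eta : 'rV[R]_q) (x y : spoint) (g F G : spoint -> cliff) (U : set spoint).

Lemma rad_ridx x (t : R) : rad (t *: delta_mx 0 ridx + x) = t + rad x.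
Proof. by rewrite /Defs.rad !mxE !eqxx mulr1. Qed.

Lemma rad_lshift x (t : R) (i : 'I_p.+1) : rad (t *: delta_mx 0 (lshift 1 i) + x) = rad x.
Proof. by rewrite /Defs.rad /Defs.ridx !mxE eq_rlshift andbF mulr0 add0r. Qed.

(** The hyperplane [r = 0] is noncharacteristic. Tangential derivatives vanish there along with the
    function, and the equation reduces to [w] times the derivative in [r], where [w] is invertible
    because its square is [-1]. *)
Lemma sol_hyperplane_vanishing w U g : sphere w -> open U ->
  first_order_sol (slice_symbol w) U g ->
  (forall x, U x -> rad x = 0 -> g x = 0) ->
  forall s x, U x -> rad x = 0 -> partials s g x = 0.
Proof.
move=> w1 oU sg g0; elim=> [|i s IH] x Ux x0; first exact: g0.
have ss := partials_sol (slice_symbol_factors w1) s oU sg.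
have tang (j : 'I_p.+1) : partial (lshift 1 j) (partials s g) x = 0.
  apply: derive_zero_line; have [d d0 dU] := open_ball_sub oU Ux.
  exists d => // t td; apply: IH; last by rewrite rad_lshift.
  apply: dU; apply: ball_step => //; first exact: ballxx.
  by rewrite addrK.
have [_ /(_ x Ux)] := ss; rewrite -slice_diracE /slice_dirac big1 ?add0r => [E|j _]; last first.
  by rewrite tang mulr0.
have rd : partial ridx (partials s g) x = 0.
  apply: oppr_inj; rewrite oppr0 -mulN1r -(vec_sqr w1) -mulrA E mulr0.
  by [].
rewrite /= -(@fintype.splitK _ _ i); case: (fintype.split i) => k /=; first exact: tang.
by rewrite (ord1 k).
Qed.

Lemma sol_hyperplane_unique w U g : sphere w -> open U -> connected U ->
  first_order_sol (slice_symbol w) U g -> (exists2 x, U x & rad x = 0) ->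
  (forall x, U x -> rad x = 0 -> g x = 0) -> forall x, U x -> g x = 0.
Proof.
move=> w1 oU cU sg [a Ua a0] g0.
apply: (first_order_unique_continuation (slice_symbol_factors w1) oU cU sg Ua) => s.
exact: (sol_hyperplane_vanishing w1 oU sg g0).
Qed.

Definition Dp F x : cliff := \sum_(i < p.+1) pgen (lshift q i) * partial (lshift 1 i) F x.
Definition Dpbar F x : cliff := \sum_(i < p.+1) pconj (lshift q i) * partial (lshift 1 i) F x.

Lemma Dp_linear U F G (k l : R) x : smooth U F -> smooth U G -> open U -> U x ->
  Dp (fun x => k *: F x + l *: G x) x = k *: Dp F x + l *: Dp G x.
Proof.
move=> sF sG oU Ux; rewrite /Dp !scaler_sumr -big_split; apply: eq_bigr => i _ /=.
rewrite (smooth_partialD _ (smoothZ k oU sF) (smoothZ l oU sG) Ux).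
rewrite (smooth_partialZ _ _ sF Ux) (smooth_partialZ _ _ sG Ux).
by rewrite mulrDr !clifford_scalerAr.
Qed.

(** Multiplication by [w] intertwines the operator in [x_p] with its conjugate, which is how the
    conjugate operator enters the Vekua system. *)
Lemma Dpbar_vec w U F x : smooth U F -> U x ->
  Dpbar (fun x => vec w * F x) x = vec w * Dp F x.
Proof.
move=> sF Ux; rewrite /Dpbar /Dp mulr_sumr; apply: eq_bigr => i _.
by rewrite (smooth_partial_cmul _ _ sF Ux) mulrA -vec_pgenC mulrA.
Qed.

Lemma vec_pconjC w (i : 'I_p.+1) :
  vec w * pconj (lshift q i) = pgen (lshift q i) * vec w :> cliff.
Proof.
have := vec_pgenC w i; rewrite /pconj; case: ifP => [/eqP i0 _|_ E].
  by rewrite i0 pgen0 mulr1 mul1r.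
by rewrite mulrN E mulNr opprK.
Qed.

Lemma Dp_vec w U F x : smooth U F -> U x ->
  Dp (fun x => vec w * F x) x = vec w * Dpbar F x.
Proof.
move=> sF Ux; rewrite /Dpbar /Dp mulr_sumr; apply: eq_bigr => i _.
by rewrite (smooth_partial_cmul _ _ sF Ux) mulrA -vec_pconjC mulrA.
Qed.

Lemma sphere_opp w : sphere w -> sphere (- w).
Proof.
move=> w1; apply: etrans w1; apply: eq_bigr => j _.
by rewrite mxE sqrrN.
Qed.

Lemma slice_pointN w x : slice_point (- w) x = row_mx (lsubmx x) (- (rad x *: w)).
Proof. by rewrite /slice_point scalerN. Qed.

Variables (Omega : set point) (f : point -> cliff) (eta : 'rV[R]_q).
Hypotheses (dom : slice_domain Omega) (sym : p_symmetric Omega).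
Hypotheses (fGSM : GSM Omega f) (eta1 : sphere eta).

Local Notation U := (slice Omega eta).

(** For [r > 0] this is p-symmetry; for [r < 0] one replaces [(r, w)] by [(- r, - w)]; for [r = 0]
    the direction disappears. A single set [U] of points [x'] thus serves all directions. *)
Lemma slice_sphere w : sphere w -> slice Omega w = U.
Proof.
suff H v w' : sphere v -> sphere w' -> slice Omega v `<=` slice Omega w'.
  by move=> w1; apply/seteqP; split; apply: H.
move=> v1 w1 x; rewrite /slice /slice_point /=.
have [r0|r0|<-] := ltgtP 0 (rad x); last by rewrite !scale0r.
  by move=> Ox; apply: (sym r0 v1 Ox w1).
have E (u : 'rV[R]_q) : rad x *: u = (- rad x) *: (- u) by rewrite scalerN scaleNr opprK.
rewrite (E v) (E w') => Ox.
by apply: (sym _ (sphere_opp v1) Ox (sphere_opp w1)); rewrite oppr_gt0.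
Qed.

Lemma slice_open : open U.
Proof. by have [_ _ /(_ _ eta1)[]] := dom. Qed.

Lemma slice_connected : connected U.
Proof. by have [_ _ /(_ _ eta1)[]] := dom. Qed.

Lemma slice_meets_real : exists2 x, U x & rad x = 0.
Proof.
have [_ [xp Oxp] _] := dom; exists (row_mx xp 0).
  by rewrite /slice /slice_point /= row_mxKl /Defs.rad row_mxEr mxE scale0r.
by rewrite /Defs.rad row_mxEr mxE.
Qed.

Lemma slice_sol w : sphere w -> first_order_sol (slice_symbol w) U (f \o slice_point w).
Proof.
move=> w1; have [C D] := fGSM w1; rewrite (slice_sphere w1) in C D.
split; first exact: (C1_on_ccoef slice_open).
by move=> x Ux; rewrite -slice_diracE; exact: D.
Qed.

Local Notation GE := (f \o slice_point eta).
Local Notation GM := (f \o slice_point (- eta)).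

Let oU := slice_open.
Let solE := slice_sol eta1.
Let solM := slice_sol (sphere_opp eta1).

Lemma slice_smooth w : sphere w -> smooth U (f \o slice_point w).
Proof.
by move=> w1; exact: (first_order_sol_smooth (slice_symbol_factors w1) oU (slice_sol w1)).
Qed.

Let sE := slice_smooth eta1.
Let sM := slice_smooth (sphere_opp eta1).

Lemma F1E : F1 f eta = fun x => 2^-1 *: GE x + 2^-1 *: GM x.
Proof. by apply/funext => x; rewrite /F1 /= slice_pointN -scalerDr. Qed.

Lemma F2E : F2 f eta = fun x => vec eta * (2^-1 *: GM x + (- 2^-1) *: GE x).
Proof.
apply/funext => x; rewrite /F2 /= slice_pointN clifford_scalerAr scaleNr -scalerBr.
by [].
Qed.

Let sEM : smooth U (fun x => 2^-1 *: GM x + (- 2^-1) *: GE x).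
Proof. by apply: smoothD; [exact: oU|exact: smoothZ|exact: smoothZ]. Qed.

Lemma smooth_F1 : smooth U (F1 f eta).
Proof. by rewrite F1E; apply: smoothD; [exact: oU|exact: smoothZ|exact: smoothZ]. Qed.

Lemma smooth_F2 : smooth U (F2 f eta).
Proof. by rewrite F2E; apply: smooth_cmul; [exact: oU|exact: sEM]. Qed.

Let DpE x : U x -> Dp GE x = - (vec eta * partial ridx GE x).
Proof.
move=> Ux; apply/eqP; rewrite -subr_eq0 opprK; apply/eqP.
by have [_ /(_ x Ux)] := solE; rewrite -slice_diracE.
Qed.

Let DpM x : U x -> Dp GM x = vec eta * partial ridx GM x.
Proof.
move=> Ux; apply/eqP; rewrite -subr_eq0 -mulNr -vec_opp; apply/eqP.
by have [_ /(_ x Ux)] := solM; rewrite -slice_diracE.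
Qed.

(** The equation on the slice of [eta] expresses the operator in [x_p] through [- eta d_r], that on
    the slice of [- eta] through [eta d_r]. The half sum of the two is the derivative in [r] of
    [F2]. *)
Lemma vekua1 x : U x -> Dp (F1 f eta) x = partial ridx (F2 f eta) x.
Proof.
move=> Ux; rewrite F1E F2E (Dp_linear _ _ sE sM oU Ux) (DpE Ux) (DpM Ux).
rewrite (smooth_partial_cmul _ _ sEM Ux).
rewrite (smooth_partialD _ (smoothZ _ oU sM) (smoothZ _ oU sE) Ux).
rewrite (smooth_partialZ _ _ sM Ux) (smooth_partialZ _ _ sE Ux).
generalize (partial ridx GE x), (partial ridx GM x) => P Q.
by rewrite mulrDr scalerN scaleNr mulrN !clifford_scalerAr addrC.
Qed.

(** Here [eta] stands in front of the difference: moving it out conjugates the operator, and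
    [eta^2 = -1] turns the two slice equations into the derivative of the half sum. *)
Lemma vekua2 x : U x -> Dpbar (F2 f eta) x = - partial ridx (F1 f eta) x.
Proof.
move=> Ux; rewrite F1E F2E (Dpbar_vec _ sEM Ux) (Dp_linear _ _ sM sE oU Ux) (DpE Ux) (DpM Ux).
rewrite (smooth_partialD _ (smoothZ _ oU sE) (smoothZ _ oU sM) Ux).
rewrite (smooth_partialZ _ _ sM Ux) (smooth_partialZ _ _ sE Ux).
generalize (partial ridx GE x), (partial ridx GM x) => P Q.
rewrite scalerN scaleNr opprK mulrDr -!clifford_scalerAr !mulrA (vec_sqr eta1) !mulN1r.
by rewrite !scalerN opprD addrC.
Qed.

(** The Vekua system says precisely that [F1 + w F2] solves the equation of the slice of [w]. At
    [r = 0] it agrees with [f], since [F1 = f] and [F2 = 0] there, and solutions are determined by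
    their values on that hyperplane. *)
Lemma representation_formula w x : sphere w -> U x ->
  f (slice_point w x) = F1 f eta x + vec w * F2 f eta x.
Proof.
move=> w1 Ux; apply/eqP; rewrite -subr_eq0; apply/eqP; move: x Ux.
have sw := slice_smooth w1.
have swF2 : smooth U (fun x => vec w * F2 f eta x) by apply: smooth_cmul; [exact: oU|exact: smooth_F2].
(* The coefficients [1] and [-1] only give the sums the shape expected by [Dp_linear]. *)
pose S x := 1 *: F1 f eta x + 1 *: (vec w * F2 f eta x).
have sS : smooth U S.
  by apply: smoothD; [exact: oU|apply: smoothZ; [exact: oU|exact: smooth_F1]|exact: smoothZ].
pose h x := 1 *: (f \o slice_point w) x + (-1) *: S x.
have sh : smooth U h by apply: smoothD; [exact: oU|exact: smoothZ|exact: smoothZ].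
have hE x : f (slice_point w x) - (F1 f eta x + vec w * F2 f eta x) = h x.
  by rewrite /h /S !scale1r scaleN1r.
suff H x : U x -> h x = 0 by move=> x Ux; rewrite hE; exact: H.
apply: (sol_hyperplane_unique w1 oU slice_connected _ slice_meets_real).
  split; first exact: sh 1.
  move=> y Uy; rewrite -slice_diracE /slice_dirac.
  have -> : \sum_(i < p.+1) pgen (lshift q i) * partial (lshift 1 i) h y = Dp h y by [].
  rewrite (Dp_linear _ _ sw sS oU Uy) (Dp_linear _ _ smooth_F1 swF2 oU Uy).
  rewrite (Dp_vec _ smooth_F2 Uy) (vekua1 Uy) (vekua2 Uy).
  have Dw : Dp (f \o slice_point w) y = - (vec w * partial ridx (f \o slice_point w) y).
    apply/eqP; rewrite -subr_eq0 opprK; apply/eqP.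
    by have [_ /(_ y Uy)] := slice_sol w1; rewrite -slice_diracE.
  rewrite Dw (smooth_partialD _ (smoothZ _ oU sw) (smoothZ _ oU sS) Uy).
  rewrite (smooth_partialZ _ _ sw Uy) (smooth_partialZ _ _ sS Uy).
  rewrite (smooth_partialD _ (smoothZ _ oU smooth_F1) (smoothZ _ oU swF2) Uy).
  rewrite (smooth_partialZ _ _ smooth_F1 Uy) (smooth_partialZ _ _ swF2 Uy).
  rewrite (smooth_partial_cmul _ _ smooth_F2 Uy) !scale1r !scaleN1r.
  generalize (partial ridx (f \o slice_point w) y), (partial ridx (F2 f eta) y), (partial ridx (F1 f eta) y) => P Q T.
  rewrite mulrBr mulrDr mulrA (vec_sqr w1) mulN1r mulrN.
  move: (vec w * P) (vec w * T) => P' T'.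
  have Z (a b e : cliff) : - a - (b - e) + (a - (e - b)) = 0.
    by rewrite !opprB addrACA addNr add0r addrA subrK subrr.
  exact: Z.
move=> y Uy y0; rewrite -hE; rewrite F1E F2E /= /slice_point y0 !scale0r.
rewrite scaleNr subrr !mulr0 addr0 -scalerDl -[2^-1]mul1r -splitr scale1r.
exact: subrr.
Qed.

Lemma harmonic_linear F G (k l : R) x : smooth U F -> smooth U G -> U x ->
  \sum_i partial i (partial i F) x = 0 -> \sum_i partial i (partial i G) x = 0 ->
  \sum_i partial i (partial i (fun x => k *: F x + l *: G x)) x = 0.
Proof.
move=> sF sG Ux F0 G0.
have P i y : U y -> partial i (fun x => k *: F x + l *: G x) y =
    k *: partial i F y + l *: partial i G y.
  move=> Uy; apply: etrans (smooth_partialD i (smoothZ k oU sF) (smoothZ l oU sG) Uy) _.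
  exact: (congr2 +%R (smooth_partialZ k i sF Uy) (smooth_partialZ l i sG Uy)).
have PP i : partial i (partial i (fun x => k *: F x + l *: G x)) x =
    k *: partial i (partial i F) x + l *: partial i (partial i G) x.
  apply: etrans (derive_eq_near _ oU Ux (P i)) _.
  have sFi := smooth_partial i sF; have sGi := smooth_partial i sG.
  apply: etrans (smooth_partialD i (smoothZ k oU sFi) (smoothZ l oU sGi) Ux) _.
  exact: (congr2 +%R (smooth_partialZ k i sFi Ux) (smooth_partialZ l i sGi Ux)).
have Z (r : R) (H : spoint -> cliff) : \sum_i partial i (partial i H) x = 0 ->
    \sum_i r *: partial i (partial i H) x = 0.
  move=> H0; rewrite -scaler_sumr.
  by rewrite H0 scaler0.
apply: etrans (eq_bigr _ (fun i _ => PP i)) _; apply: etrans (big_split _ _ _ _ _) _.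
exact: (etrans (congr2 (fun u v : cliff => u + v) (Z k F F0) (Z l G G0)) (addr0 _)).
Qed.

Lemma harmonic_cmul (c : cliff) F x : smooth U F -> U x ->
  \sum_i partial i (partial i F) x = 0 ->
  \sum_i partial i (partial i (fun x => c * F x)) x = 0.
Proof.
move=> sF Ux F0.
have P i y : U y -> partial i (fun x => c * F x) y = c * partial i F y.
  by move=> Uy; exact: smooth_partial_cmul sF Uy.
have PP i : partial i (partial i (fun x => c * F x)) x = c * partial i (partial i F) x.
  apply: etrans (derive_eq_near _ oU Ux (P i)) _.
  exact: (smooth_partial_cmul _ _ (smooth_partial i sF) Ux).
apply: etrans (eq_bigr _ (fun i _ => PP i)) _; rewrite -mulr_sumr.
exact: etrans (congr1 (fun z => c * z) F0) (mulr0 _).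
Qed.

Lemma harmonic_slice w x : sphere w -> U x ->
  \sum_i partial i (partial i (f \o slice_point w)) x = 0.
Proof.
by move=> w1 Ux; exact: (first_order_sol_harmonic (slice_symbol_factors w1) oU (slice_sol w1) Ux).
Qed.

Lemma harmonic_F1 x : U x -> \sum_i partial i (partial i (F1 f eta)) x = 0.
Proof.
move=> Ux; rewrite F1E; apply: harmonic_linear; [exact: sE|exact: sM|exact: Ux| |].
  exact: harmonic_slice eta1 Ux.
exact: harmonic_slice (sphere_opp eta1) Ux.
Qed.

Lemma harmonic_F2 x : U x -> \sum_i partial i (partial i (F2 f eta)) x = 0.
Proof.
move=> Ux; rewrite F2E; apply: harmonic_cmul; [exact: sEM|exact: Ux|].
apply: harmonic_linear; [exact: sM|exact: sE|exact: Ux| |].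
  exact: harmonic_slice (sphere_opp eta1) Ux.
exact: harmonic_slice eta1 Ux.
Qed.

End RepresentationFormula.

(** * Division by a coordinate *)

Section DivisionByCoordinate.
Context {R : realType} {N : nat}.
Implicit Types (x y a : 'rV[R]_N) (h F : 'rV[R]_N -> R) (d t : R) (i k : 'I_N).

(** The homothety of ratio [t] in the single coordinate [k], written as a step along that axis so
    that [ball_step] applies. *)
Definition squeeze k t x : 'rV[R]_N := ((t - 1) * x 0 k) *: delta_mx 0 k + x.

Lemma squeeze_ball a d k t x : 0 < d -> a 0 k = 0 -> 0 <= t <= 1 -> ball a d x ->
  ball a d (squeeze k t x).
Proof.
move=> d0 ak /andP[t0 t1] xB; apply: ball_step => //.
have -> : (t - 1) * x 0 k + x 0 k - a 0 k = t * x 0 k by rewrite ak; ring.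
rewrite normrM ger0_norm//; apply: (@le_lt_trans _ _ `|x 0 k|); first by rewrite ler_piMl.
by move/(rV_ballP _ _ d0): xB => /(_ k); rewrite ak subr0.
Qed.

(* [x_k * radial_mean k 0 (partial k F) x = F x] when [F] vanishes for [x_k = 0];
   the powers of [t] come from differentiating along [x_k]. *)
Definition radial_mean k n h x : R := int01 (fun t => t ^+ n * h (squeeze k t x)).

Lemma radial_mean_jcont a d k n h : 0 < d -> a 0 k = 0 ->
  (forall x, ball a d x -> {for x, continuous h}) ->
  jcont (ball a d) (fun t x => t ^+ n * h (squeeze k t x)).
Proof.
move=> d0 ak ch t x t01 xB.
pose L (z : R * 'rV[R]_N) : 'rV[R]_N := squeeze k z.1 z.2.
have c1 : (z : R * 'rV[R]_N).1 @[z --> (t, x)] --> t by exact: cvg_fst.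
have c2 : (z : R * 'rV[R]_N).2 @[z --> (t, x)] --> x by exact: cvg_snd.
have c3 : (z : R * 'rV[R]_N).2 0 k @[z --> (t, x)] --> x 0 k.
  exact: (@continuous_comp _ _ _ snd (fun y : 'rV[R]_N => y 0 k) (t, x) c2 (@coord_continuous _ _ _ _ _ x)).
have cL : {for (t, x), continuous L}.
  exact: (cvgD (cvgZr_tmp (cvgM (cvgB c1 (cvg_cst _)) c3)) c2).
have c4 : h (L z) @[z --> (t, x)] --> h (L (t, x)).
  exact: (@continuous_comp _ _ _ L h (t, x) cL (ch _ (squeeze_ball d0 ak t01 xB))).
have c5 : (z : R * 'rV[R]_N).1 ^+ n @[z --> (t, x)] --> t ^+ n.
  exact: (@continuous_comp _ _ _ fst (fun s : R => s ^+ n) (t, x) c1 (@exprn_continuous _ _ _)).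
exact: (cvgM c5 c4).
Qed.

Lemma radial_mean_partial a d k n h i x : 0 < d -> a 0 k = 0 -> Ck 1 (ball a d) h ->
  ball a d x ->
  is_derive x (delta_mx 0 i) (radial_mean k n h) (radial_mean k (n + (i == k)) (partial i h) x).
Proof.
move=> d0 ak [ch dh] xB; have [d1 [cdh _]] := dh i.
apply: (@int01_is_derive R N (ball a d) (fun t x => t ^+ n * h (squeeze k t x))
  (fun t x => t ^+ (n + (i == k)) * partial i h (squeeze k t x)) x i (ball_open a d) xB).
- exact: radial_mean_jcont.
- move=> t y t01 yB.
  have aff (s : R) : squeeze k t (s *: delta_mx 0 i + y) =
      s *: (t ^+ (i == k) *: delta_mx 0 i) + squeeze k t y.
    rewrite /squeeze !mxE eqxx/=; have [->|ne] := eqVneq i k.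
      rewrite expr1 mulr1 addrA scalerA; apply/rowP => l; rewrite !mxE.
      by rewrite eqxx/=; ring.
    by rewrite mulr0 add0r expr0 scale1r addrCA.
  have [D1 D2] := is_derive_scalev (t ^+ (i == k)) (d1 _ (squeeze_ball d0 ak t01 yB)).
  have D3 := is_derive_affine aff D1.
  have D4 := is_deriveZ (t ^+ n) D3.
  rewrite exprD -mulrA; move: D4; rewrite D2.
  exact.
- exact: radial_mean_jcont.
Qed.

(** With arbitrary powers of [t] the family of radial means is closed under partial derivatives,
    hence the induction on [j] with [n] general. *)
Lemma radial_mean_Ck a d k n h j : 0 < d -> a 0 k = 0 -> Ck j (ball a d) h ->
  Ck j (ball a d) (radial_mean k n h).
Proof.
move=> d0 ak; elim: j n h => [|j IH] n h ch.
  split; last exact: I.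
  move=> x xB; apply: (int01_continuous (ball_open a d) _ xB).
  by apply: radial_mean_jcont; [exact: d0|exact: ak|have [+ _] := ch; exact].
have c1 : Ck 1 (ball a d) h.
  have [c0 dc] := ch; split; first exact: c0.
  move=> i; have [di ci] := dc i; split; first exact: di.
  split; last exact: I.
  by move=> x; exact: Ck_cont ci.
split.
  move=> x xB; apply: (int01_continuous (ball_open a d) _ xB).
  by apply: radial_mean_jcont; [exact: d0|exact: ak|have [+ _] := ch; exact].
move=> i; split; first by move=> x xB; have [] := radial_mean_partial n i d0 ak c1 xB.
have [_ /(_ i)[_ ci]] := ch.
apply: (Ck_eq (ball_open a d)) (IH (n + (i == k))%N _ ci) => x xB.
by rewrite (partial_val (radial_mean_partial n i d0 ak c1 xB)).
Qed.

(** At [x_k = 0] the derivative is the value that extends the quotient of a function vanishing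
    there. *)
Definition divx k F x : R := if x 0 k == 0 then partial k F x else (x 0 k)^-1 * F x.

(** Hadamard's lemma: by the fundamental theorem of calculus along the axis [k], [F x] is [x_k]
    times the mean of [partial k F] over the segment from the hyperplane to [x]. *)
Lemma divx_radial_mean a d k F x : 0 < d -> a 0 k = 0 -> Ck 1 (ball a d) F ->
  (forall y, ball a d y -> y 0 k = 0 -> F y = 0) -> ball a d x ->
  divx k F x = radial_mean k 0 (partial k F) x.
Proof.
move=> d0 ak cF F0 xB; rewrite /divx /radial_mean.
have [cF0 /(_ k)[dF [cdF _]]] := cF.
have cont := jcont_continuous01 (radial_mean_jcont (n := 0) d0 ak cdF) xB.
case: ifPn => xk.
  rewrite -[LHS]int01_cst; apply: eq_int01 => t t01.
  by rewrite /squeeze (eqP xk) mulr0 scale0r add0r expr0 mul1r.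
apply: (mulfI xk); rewrite mulrA divff// mul1r -int01Z//.
have F0' : F (squeeze k 0 x) = 0.
  apply: F0; first by apply: squeeze_ball; rewrite ?lexx ?ler01.
  by rewrite /squeeze !mxE !eqxx sub0r mulr1; ring.
have F1' : F (squeeze k 1 x) = F x by rewrite /squeeze subrr mul0r scale0r add0r.
have := @int01_derive R (fun t => F (squeeze k t x))
  (fun t => x 0 k * (t ^+ 0 * partial k F (squeeze k t x))) (continuous01Z cont).
rewrite F0' F1' subr0 => /(_ _)/esym; apply => t t01.
have aff (s : R) : squeeze k (s *: 1 + t) x = s *: (x 0 k *: delta_mx 0 k) + squeeze k t x.
  rewrite /squeeze [s *: 1]mulr1 addrA scalerA -scalerDl; congr (_ *: _ + _); ring.
have [D1 D2] := is_derive_scalev (x 0 k) (dF _ (squeeze_ball d0 ak t01 xB)).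
have := @is_derive_affine R R _ _ F (fun t => squeeze k t x) t 1 _ aff D1.
by rewrite D2 expr0 mul1r.
Qed.

Lemma open_coord_neq0 k : open [set x : 'rV[R]_N | x 0 k != 0].
Proof.
have -> : [set x : 'rV[R]_N | x 0 k != 0] = (fun x => x 0 k) @^-1` [set y : R | y != 0] by [].
apply: open_comp => [x _|]; first exact: coord_continuous.
exact: open_neq.
Qed.

Lemma inv_coord_Ck k j : Ck j [set x : 'rV[R]_N | x 0 k != 0] (fun x => (x 0 k)^-1).
Proof.
have oV : open [set x : 'rV[R]_N | x 0 k != 0] by exact: open_coord_neq0.
have D x i : x 0 k != 0 -> is_derive x (delta_mx 0 i) (fun x => (x 0 k)^-1)
    (- ((delta_mx 0 i : 'rV[R]_N) 0 k) *: ((x 0 k)^-1 *: (x 0 k)^-1)).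
  move=> xk; have [D1 D2] := is_derive_coord x (delta_mx 0 i) k.
  apply: DeriveDef; first exact: (derivableV xk D1).
  apply: etrans (deriveV xk D1) _; rewrite D2 /GRing.scale/= expr2 invfM.
  by ring.
have c0 x : x 0 k != 0 -> {for x, continuous (fun x : 'rV[R]_N => (x 0 k)^-1)}.
  by move=> xk; exact: (cvgV xk (@coord_continuous _ _ _ _ _ x)).
elim: j => [|j IH]; first by split; [exact: c0|exact: I].
split; first exact: c0.
move=> i; split; first by move=> x xk; have [] := D x i xk.
apply: (Ck_eq oV) (CkZ (- ((delta_mx 0 i : 'rV[R]_N) 0 k)) oV (Ck_scale oV IH IH)) => x xk.
by rewrite (partial_val (D x i xk)).
Qed.

(** In a ball centred on the hyperplane the quotient is a radial mean; elsewhere it is the product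
    of [F] with the smooth function [1 / x_k]. *)
Theorem divx_smooth (U : set 'rV[R]_N) k F : open U -> smooth U F ->
  (forall x, U x -> x 0 k = 0 -> F x = 0) -> smooth U (divx k F).
Proof.
move=> oU sF F0 j; apply: Ck_local => x Ux.
have [xk|xk] := eqVneq (x 0 k) 0.
  have [d d0 dU] := open_ball_sub oU Ux; exists (ball x d); first exact: ballxx.
  have cF : Ck j.+1 (ball x d) F by apply: Ck_subset dU _; exact: sF.
  have c1 : Ck 1 (ball x d) F by apply: Ck_subset dU _; exact: sF.
  have [_ /(_ k)[_ cdF]] := cF.
  apply: (Ck_eq (ball_open x d)) (radial_mean_Ck 0 d0 xk cdF) => y yB.
  apply/esym/(divx_radial_mean d0 xk c1 _ yB) => z zB zk.
  by apply: F0 => //; exact: dU.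
pose V := [set x : 'rV[R]_N | x 0 k != 0].
have oV : open V by exact: open_coord_neq0.
exists (U `&` V); first by split.
have oUV : open (U `&` V) by exact: openI.
have c1 : Ck j (U `&` V) (fun x => (x 0 k)^-1).
  by apply: (Ck_subset (U := V)) (inv_coord_Ck k j) => y [].
have c2 : Ck j (U `&` V) F by apply: Ck_subset (sF j) => y [].
apply: (Ck_eq oUV) (Ck_scale oUV c1 c2) => y [_ yk].
by rewrite /divx ifN.
Qed.

End DivisionByCoordinate.

Section CliffordDivision.
Context {R : realType} {n N : nat}.
Local Notation cliff := (clifford R n).
Implicit Types (F G : 'rV[R]_N -> cliff) (U : set 'rV[R]_N) (x : 'rV[R]_N) (k : 'I_N).

Definition cdivx k F x : cliff :=
  if x 0 k == 0 then partial k F x else (x 0 k)^-1 *: F x.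

Lemma cdivx_smooth U k F : open U -> smooth U F ->
  (forall x, U x -> x 0 k = 0 -> F x = 0) -> smooth U (cdivx k F).
Proof.
move=> oU sF F0 j; apply/(Ck_ccoef _ _ oU) => A.
have sA : smooth U (fun x => ccoef (F x) A) by move=> l; apply: (Ck_ccoef _ _ oU).1; exact: sF.
have A0 x : U x -> x 0 k = 0 -> ccoef (F x) A = 0.
  by move=> Ux xk; rewrite (F0 x Ux xk); exact: ccoef0.
apply: (Ck_eq oU) (divx_smooth oU sA A0 j) => x Ux.
rewrite /divx /cdivx; case: ifP => _; last by rewrite ccoefZ.
exact/partial_val/is_partial_ccoef/(smooth_has_partial sF Ux).
Qed.

Lemma cdivxK U k F x : (forall x, U x -> x 0 k = 0 -> F x = 0) -> U x ->
  F x = x 0 k *: cdivx k F x.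
Proof.
move=> F0 Ux; rewrite /cdivx; case: ifPn => xk; last by rewrite scalerA divff// scale1r.
by rewrite (eqP xk) scale0r; apply: F0 => //; exact/eqP.
Qed.

(* Near a point of the hyperplane [x_k = 0] the factor [x_k] is nonzero on a
   dense set, so it can be cancelled between continuous functions. *)
Lemma coord_cancel U k F G : open U ->
  (forall x, U x -> {for x, continuous F}) -> (forall x, U x -> {for x, continuous G}) ->
  (forall x, U x -> x 0 k *: F x = x 0 k *: G x) -> forall x, U x -> F x = G x.
Proof.
move=> oU cF cG FG x Ux.
have [xk|xk] := eqVneq (x 0 k) 0; last by apply: (scalerI xk); exact: FG.
apply/eqP; rewrite -subr_eq0 -normr_eq0 -[X in X == _]/(`|F x - G x|).
apply/eqP/le_anti; rewrite normr_ge0 andbT; apply/ler_addgt0Pr => e e0; rewrite add0r.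
have e2 : 0 < e / 2 by rewrite divr_gt0.
have [d d0 dU] := open_ball_sub oU Ux.
have [d1 d10 d1F] := continuous_ballP (cF x Ux) e2.
have [d2 d20 d2G] := continuous_ballP (cG x Ux) e2.
pose t := Num.min d (Num.min d1 d2) / 2.
have m0 : 0 < Num.min d (Num.min d1 d2) by rewrite !lt_min d0 d10.
have t0 : 0 < t by rewrite divr_gt0.
have tm : t < Num.min d (Num.min d1 d2) by rewrite /t; lra.
have [td td1 td2] : [/\ t < d, t < d1 & t < d2].
  by move: tm; rewrite !lt_min => /andP[-> /andP[-> ->]].
have B (r : R) : t < r -> ball x r (t *: delta_mx 0 k + x).
  move=> tr; have r0 : 0 < r by exact: lt_trans tr.
  by apply: ball_step => //; [exact: ballxx|rewrite addrK gtr0_norm].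
have E : F (t *: delta_mx 0 k + x) = G (t *: delta_mx 0 k + x).
  have yk : (t *: delta_mx 0 k + x) 0 k != 0 by rewrite !mxE !eqxx mulr1 xk addr0 gt_eqF.
  by apply: (scalerI yk); apply: FG; exact: dU (B _ td).
have h1 := d1F _ (B _ td1); have h2 := d2G _ (B _ td2).
have := ler_distD (F (t *: delta_mx 0 k + x)) (F x) (G x).
rewrite [in X in _ <= _ + X]E [X in _ <= _ + X]distrC => /le_trans; apply.
by rewrite [leRHS]splitr lerD// ltW.
Qed.

End CliffordDivision.

(** * Even functions of the radial variable *)

Section RadialDerivative.
Context {R : realType} {p n : nat}.
Local Notation spoint := 'rV[R]_(p.+1 + 1).
Local Notation cliff := (clifford R n).
Local Notation ridx := (@ridx p).
Local Notation rad := (@Defs.rad R p).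
Implicit Types (x y : spoint) (F G : spoint -> cliff) (k l : R).

(** The reflection [r -> - r], written as a step along the axis of [r]. *)
Definition refl x : spoint := (- 2 * rad x) *: delta_mx 0 ridx + x.

Definition refl_sign (i : 'I_(p.+1 + 1)) : R := if i == ridx then -1 else 1.

Lemma refl_affine i x (h : R) :
  refl (h *: delta_mx 0 i + x) = h *: (refl_sign i *: delta_mx 0 i) + refl x.
Proof.
rewrite /refl /refl_sign; apply/rowP => j; rewrite /Defs.rad !mxE /=.
have [->|ne] := eqVneq i ridx; first by rewrite ?eqxx /=; ring.
by rewrite mulr0; ring.
Qed.

Lemma refl_fix x : rad x = 0 -> refl x = x.
Proof. by move=> x0; rewrite /refl x0 mulr0 scale0r add0r. Qed.

Lemma rad_refl x : rad (refl x) = - rad x.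
Proof. by rewrite /refl /Defs.rad !mxE !eqxx mulr1; ring. Qed.

Variable U : set spoint.
Hypotheses (oU : open U) (symU : forall x, U x -> U (refl x)).

Definition has_parity (s : R) F := forall x, U x -> F (refl x) = s *: F x.

Lemma parity_partial s F i : smooth U F -> has_parity s F ->
  has_parity (refl_sign i * s) (partial i F).
Proof.
move=> sF pF x Ux.
have [D1 D2] := is_derive_scalev (refl_sign i) (smooth_has_partial (i := i) sF (symU Ux)).
have [D3 D4] := is_derive_affine (refl_affine i x) D1.
have E : refl_sign i *: partial i F (refl x) = s *: partial i F x.
  apply: etrans (etrans (esym D2) (esym D4)) _.
  apply: etrans (derive_eq_near _ oU Ux pF) _.
  exact: (smooth_partialZ s i sF Ux).
have ss : refl_sign i * refl_sign i = 1.
  by rewrite /refl_sign; case: ifP => _; rewrite ?mulrNN mulr1.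
rewrite -scalerA; apply: etrans (congr1 (fun z => refl_sign i *: z) E).
generalize (partial i F (refl x)) => P; by rewrite scalerA ss scale1r.
Qed.

(* [Er F] is the smooth extension of [r^-1 * dF/dr] across [r = 0]. *)
Definition Er F : spoint -> cliff := cdivx ridx (partial ridx F).

Definition even_smooth F := smooth U F /\ has_parity 1 F.

Lemma odd_vanishes F : has_parity (-1) F -> forall x, U x -> x 0 ridx = 0 -> F x = 0.
Proof.
move=> oF x Ux x0; have := oF x Ux; rewrite (refl_fix x0) scaleN1r => /eqP.
rewrite -subr_eq0 opprK -mulr2n -scaler_nat scaler_eq0 pnatr_eq0/=.
by move/eqP.
Qed.

(** An odd function vanishes at [r = 0], so Hadamard's quotient by [r] is smooth, and the two signs
    cancel. *)
Lemma even_cdivx F : smooth U F -> has_parity (-1) F -> even_smooth (cdivx ridx F).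
Proof.
move=> sF oF; split; first exact: (cdivx_smooth oU sF (odd_vanishes oF)).
move=> x Ux; rewrite scale1r.
have [x0|x0] := eqVneq (rad x) 0; first by rewrite (refl_fix x0).
have r1 : (refl x) 0 ridx = - rad x by exact: rad_refl.
rewrite /cdivx r1 -[x 0 ridx]/(rad x) oppr_eq0 (negbTE x0) (oF x Ux).
by rewrite scalerA mulrN1 invrN opprK.
Qed.

Lemma even_dr_odd F : even_smooth F -> smooth U (partial ridx F) /\ has_parity (-1) (partial ridx F).
Proof.
move=> [sF pF]; split; first exact: smooth_partial.
by have := parity_partial ridx sF pF; rewrite /refl_sign eqxx mulr1.
Qed.

Lemma even_Er F : even_smooth F -> even_smooth (Er F).
Proof. by move=> /even_dr_odd[]; exact: even_cdivx. Qed.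

Lemma even_partial F (i : 'I_p.+1) : even_smooth F -> even_smooth (partial (lshift 1 i) F).
Proof.
move=> [sF pF]; split; first exact: smooth_partial.
by have := parity_partial (lshift 1 i) sF pF; rewrite /refl_sign eq_lrshift mulr1.
Qed.

Lemma drE F x : even_smooth F -> U x -> partial ridx F x = rad x *: Er F x.
Proof.
by move=> /even_dr_odd[sF oF] Ux; exact: (cdivxK (odd_vanishes oF) Ux).
Qed.

(** The identities for [Er] below are checked after multiplication by [r], where [Er] becomes the
    derivative in [r]; this lemma then removes the factor, also on [r = 0]. *)
Lemma rad_cancel F G : smooth U F -> smooth U G ->
  (forall x, U x -> rad x *: F x = rad x *: G x) -> forall x, U x -> F x = G x.
Proof.
move=> sF sG; apply: (coord_cancel oU) => x Ux; first exact: smooth_cont sF Ux.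
exact: smooth_cont sG Ux.
Qed.

Lemma Er_eq F G : (forall x, U x -> F x = G x) -> forall x, U x -> Er F x = Er G x.
Proof.
move=> FG x Ux.
have FG' y : U y -> partial ridx F y = partial ridx G y.
  by move=> Uy; exact: (derive_eq_near _ oU Uy FG).
rewrite /Er /cdivx; case: (x 0 ridx == 0); first exact: (derive_eq_near _ oU Ux FG').
exact: (congr1 (fun z : cliff => (x 0 ridx)^-1 *: z) (FG' x Ux)).
Qed.

Lemma smooth_rad : smooth U rad.
Proof. by move=> j; apply: (@Ck_coord R _ j U ridx). Qed.

Lemma even_linear k l F G : even_smooth F -> even_smooth G ->
  even_smooth (fun x => k *: F x + l *: G x).
Proof.
move=> [sF pF] [sG pG]; split.
  by apply: smoothD; [exact: oU|exact: smoothZ|exact: smoothZ].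
by move=> x Ux; rewrite (pF x Ux) (pG x Ux) !scale1r.
Qed.

Lemma even_cmul (c : cliff) F : even_smooth F -> even_smooth (fun x => c * F x).
Proof.
move=> [sF pF]; split; first exact: smooth_cmul.
by move=> x Ux; rewrite (pF x Ux) !scale1r.
Qed.

Lemma even_r2 F : even_smooth F -> even_smooth (fun x => rad x ^+ 2 *: F x).
Proof.
move=> [sF pF]; split.
  apply: smooth_scale; [exact: oU| |exact: sF].
  by apply: (smooth_scale oU smooth_rad smooth_rad).
by move=> x Ux; rewrite rad_refl sqrrN (pF x Ux) !scale1r.
Qed.

Lemma Er_linear k l F G x : even_smooth F -> even_smooth G -> U x ->
  Er (fun x => k *: F x + l *: G x) x = k *: Er F x + l *: Er G x.
Proof.
move=> eF eG; have [sF _] := eF; have [sG _] := eG.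
have [sEF _] := even_Er eF; have [sEG _] := even_Er eG.
have eS := even_linear k l eF eG; have [sES _] := even_Er eS.
move: x; apply: rad_cancel; first exact: sES.
  by apply: smoothD; [exact: oU|exact: smoothZ|exact: smoothZ].
move=> x Ux; rewrite -(drE eS Ux).
apply: etrans (smooth_partialD _ (smoothZ k oU sF) (smoothZ l oU sG) Ux) _.
apply: etrans (congr2 (fun u v : cliff => u + v) (smooth_partialZ k _ sF Ux) (smooth_partialZ l _ sG Ux)) _.
apply: etrans (congr2 (fun u v : cliff => k *: u + l *: v) (drE eF Ux) (drE eG Ux)) _.
generalize (Er F x), (Er G x) => P Q.
by rewrite scalerDr !scalerA [k * _]mulrC [l * _]mulrC.
Qed.

Lemma Er_cmul (c : cliff) F x : even_smooth F -> U x ->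
  Er (fun x => c * F x) x = c * Er F x.
Proof.
move=> eF; have [sF _] := eF; have [sEF _] := even_Er eF.
have eS := even_cmul c eF; have [sES _] := even_Er eS.
move: x; apply: rad_cancel; [exact: sES|exact: smooth_cmul|].
move=> x Ux; rewrite -(drE eS Ux).
apply: etrans (smooth_partial_cmul _ _ sF Ux) _.
by rewrite (drE eF Ux) clifford_scalerAr.
Qed.

Lemma partial_rad_lshift (i : 'I_p.+1) F x : smooth U F -> U x ->
  partial (lshift 1 i) (fun x => rad x *: F x) x = rad x *: partial (lshift 1 i) F x.
Proof.
move=> sF Ux; have [D1 D2] := is_derive_coord x (delta_mx 0 (lshift 1 i)) ridx.
have [_ D3] := is_derive_scale D1 (smooth_has_partial sF Ux).
by apply: etrans D3 _; rewrite D2 mxE eq_rlshift andbF scale0r add0r.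
Qed.

Lemma partial_rad_ridx F x : smooth U F -> U x ->
  partial ridx (fun x => rad x *: F x) x = F x + rad x *: partial ridx F x.
Proof.
move=> sF Ux; have [D1 D2] := is_derive_coord x (delta_mx 0 ridx) ridx.
have [_ D3] := is_derive_scale D1 (smooth_has_partial sF Ux).
by apply: etrans D3 _; rewrite D2 mxE !eqxx scale1r.
Qed.

Lemma Er_partial (i : 'I_p.+1) F x : even_smooth F -> U x ->
  Er (partial (lshift 1 i) F) x = partial (lshift 1 i) (Er F) x.
Proof.
move=> eF; have [sF _] := eF; have [sEF _] := even_Er eF.
have ei := even_partial i eF; have [sEi _] := even_Er ei.
move: x; apply: rad_cancel; [exact: sEi|exact: smooth_partial|].
move=> x Ux; rewrite -(drE ei Ux) -(partial_rad_lshift i sEF Ux).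
apply: etrans (smooth_partialC (lshift 1 i) ridx oU sF Ux) _.
by apply: (derive_eq_near _ oU Ux) => y Uy; exact: drE.
Qed.

Lemma Er_r2 F x : even_smooth F -> U x ->
  Er (fun x => rad x ^+ 2 *: F x) x = 2 *: F x + rad x ^+ 2 *: Er F x.
Proof.
move=> eF; have [sF _] := eF; have eE := even_Er eF; have [sEF _] := eE.
have e2 := even_r2 eF; have [sE2 _] := even_Er e2.
have [sr2 _] := even_r2 eE.
move: x; apply: rad_cancel; [exact: sE2| |].
  by apply: smoothD; [exact: oU|exact: smoothZ|exact: sr2].
move=> x Ux; rewrite -(drE e2 Ux).
have sr : smooth U (fun x => rad x *: F x) by apply: (smooth_scale oU smooth_rad sF).
have E1 y : U y -> rad y ^+ 2 *: F y = rad y *: (rad y *: F y) by rewrite scalerA expr2.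
apply: etrans (derive_eq_near _ oU Ux E1) _.
apply: etrans (partial_rad_ridx sr Ux) _.
rewrite (partial_rad_ridx sF Ux) (drE eF Ux) !scalerDr !scalerA addrA -scalerDl.
by congr (_ *: _ + _ *: _); rewrite ?expr2; ring.
Qed.

Definition LapP F x : cliff := \sum_(i < p.+1) partial (lshift 1 i) (partial (lshift 1 i) F) x.

Lemma even_sum (I : Type) (r : seq I) (F : I -> spoint -> cliff) :
  (forall i, even_smooth (F i)) ->
  even_smooth (fun x => \sum_(i <- r) F i x) /\
  forall x, U x -> Er (fun x => \sum_(i <- r) F i x) x = \sum_(i <- r) Er (F i) x.
Proof.
move=> eF; elim: r => [|i r [IH1 IH2]].
  have -> : (fun x => \sum_(i <- [::]) F i x) = fun=> 0 by apply/funext => x; rewrite big_nil.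
  have e0 : even_smooth (fun=> 0).
    by split=> [j|x _]; [exact: Ck_cst|rewrite /= scaler0].
  split=> // x Ux; rewrite big_nil.
  have E : (fun=> 0) = (fun _ : spoint => (0 : R) *: (0 : cliff) + (0 : R) *: (0 : cliff)).
    by apply/funext => y; rewrite scale0r addr0.
  have := Er_linear 0 0 e0 e0 Ux; rewrite -E => ->.
  by rewrite !scale0r addr0.
have -> : (fun x => \sum_(j <- i :: r) F j x) = fun x => 1 *: F i x + 1 *: \sum_(j <- r) F j x.
  by apply/funext => x; rewrite big_cons !scale1r.
split; first exact: even_linear.
by move=> x Ux; rewrite (Er_linear 1 1 (eF i) IH1 Ux) (IH2 x Ux) big_cons !scale1r.
Qed.

Lemma even_LapP F : even_smooth F -> even_smooth (LapP F) /\
  forall x, U x -> Er (LapP F) x = LapP (Er F) x.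
Proof.
move=> eF.
have [H1 H2] := even_sum (index_enum 'I_p.+1) (fun i => even_partial i (even_partial i eF)).
split; first exact: H1.
move=> x Ux; apply: etrans (H2 x Ux) _; apply: eq_bigr => i _.
apply: etrans (Er_partial i (even_partial i eF) Ux) _.
by apply: (derive_eq_near _ oU Ux) => y Uy; exact: Er_partial.
Qed.

(* The Laplacian in dimension [p + 1 + c] of the function [x' |-> G (x_p, r)]
   with [r] the norm in the last [c] variables. *)
Definition axial_laplacian (c : R) G x : cliff :=
  LapP G x + c *: Er G x + rad x ^+ 2 *: Er (Er G) x.

(** [E] commutes with the Laplacian in [x_p], and [E r^2 = r^2 E + 2]; the extra term raises the
    coefficient of [E] by [2]. *)
Lemma axial_laplacian_Er c G : even_smooth G ->
  (forall x, U x -> axial_laplacian c G x = 0) ->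
  forall x, U x -> axial_laplacian (c + 2) (Er G) x = 0.
Proof.
move=> eG G0 x Ux.
have eE := even_Er eG; have eEE := even_Er eE; have [eL EL] := even_LapP eG.
have e2 := even_r2 eEE.
pose S1 x := 1 *: LapP G x + c *: Er G x.
pose S x := 1 *: S1 x + 1 *: (rad x ^+ 2 *: Er (Er G) x).
have eS1 : even_smooth S1 by exact: even_linear.
have S0 y : U y -> S y = 0.
  by move=> Uy; apply: etrans (G0 y Uy); rewrite /S /S1 !scale1r.
have E0 : Er S x = 0.
  apply: etrans (Er_eq S0 Ux) _.
  (* That [Er] kills the zero function is read off from additivity for the empty sum. *)
  have [_ H] := even_sum (Nil 'I_p.+1) (fun _ => eG); have := H x Ux; rewrite big_nil => H0.
  by apply: etrans H0; congr (Er _ x); apply/funext => y; rewrite big_nil.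
rewrite -[RHS]E0; apply: esym.
apply: etrans (Er_linear 1 1 eS1 e2 Ux) _.
apply: etrans (congr2 (fun u v : cliff => 1 *: u + 1 *: v) (Er_linear 1 c eL eE Ux) (Er_r2 eEE Ux)) _.
apply: etrans (congr1 (fun u : cliff => 1 *: (1 *: u + c *: Er (Er G) x) + 1 *:
  (2 *: Er (Er G) x + rad x ^+ 2 *: Er (Er (Er G)) x)) (EL x Ux)) _.
rewrite /axial_laplacian; generalize (LapP (Er G) x), (Er (Er G) x), (Er (Er (Er G)) x) => P Q T.
by rewrite !scale1r [(c + 2) *: Q]scalerDl !addrA.
Qed.

End RadialDerivative.

(** * Axially symmetric functions *)

Lemma is_derive_comp1 {R : realType} {W : normedModType R} (phi : R -> W) (g : R -> R)
    (t g' : R) (phi' : W) :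
  is_derive t 1 g g' -> is_derive (g t) 1 phi phi' -> is_derive t 1 (phi \o g) (g' *: phi').
Proof.
move=> [/derivable1_diffP dg g'E] [/derivable1_diffP dphi phiE].
have dc : differentiable (phi \o g) t by exact: differentiable_comp.
have E1 : 'd g t 1 = g' by rewrite -deriveE.
have E2 : 'd phi (g t) 1 = phi' by rewrite -deriveE.
apply: DeriveDef; first exact/derivable1_diffP.
rewrite deriveE// diff_comp//= E1 -E2 -linearZ/=.
by congr ('d phi (g t) _); rewrite [RHS]mulr1.
Qed.

Lemma is_derive_along {R : realType} {V W : normedModType R} (F : V -> W) (x v : V) (l : W) :
  is_derive (0 : R) 1 (fun h : R => F (h *: v + x)) l -> is_derive x v F l.
Proof.
have E : (fun h : R => h^-1 *: (F ((h *: (1 : R) + 0 : R) *: v + x) - F ((0 : R) *: v + x))) =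
         (fun h : R => h^-1 *: (F (h *: v + x) - F x)).
  by apply/funext => h; rewrite scale0r add0r addr0 [h *: 1]mulr1.
move=> [+ +]; rewrite /derivable /derive E => H1 H2.
exact: DeriveDef.
Qed.

Section AxialLift.
Context {R : realType} {p q : nat}.
Local Notation point := 'rV[R]_(p.+1 + q).
Local Notation spoint := 'rV[R]_(p.+1 + 1).
Local Notation cliff := (clifford R (p + q)).
Local Notation ridx := (@ridx p).
Local Notation rad := (@Defs.rad R p).
Implicit Types (x y : point) (F G : spoint -> cliff).

Definition qnorm2 x : R := \sum_j x 0 (rshift p.+1 j) ^+ 2.
Definition qnorm x : R := Num.sqrt (qnorm2 x).
(** The point [x'] attached to [x], always with [r >= 0]. The root in [qnorm] is not differentiable
    at [r = 0], so smoothness of a lift has to come from evenness. *)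
Definition meridian x : spoint := row_mx (lsubmx x) (qnorm x)%:M.
Definition lift F x : cliff := F (meridian x).
Definition qvec x : cliff := vec (rsubmx x).

Lemma qnorm2_ge0 x : 0 <= qnorm2 x.
Proof. by apply: sumr_ge0 => j _; exact: sqr_ge0. Qed.

Lemma qnorm_ge0 x : 0 <= qnorm x.
Proof. exact: sqrtr_ge0. Qed.

Lemma qnorm_eq0 x (j : 'I_q) : qnorm x = 0 -> x 0 (rshift p.+1 j) = 0.
Proof.
move=> r0; apply/eqP; rewrite -sqrf_eq0 eq_le sqr_ge0 andbT.
have q0 : qnorm2 x <= 0 by rewrite -sqrtr_eq0 -/(qnorm x) r0.
apply: le_trans q0; rewrite /qnorm2 (bigD1 j)//= lerDl.
by apply: sumr_ge0 => k _; exact: sqr_ge0.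
Qed.

Lemma rad_meridian x : rad (meridian x) = qnorm x.
Proof. by rewrite /Defs.rad row_mxEr mxE mulr1n. Qed.

Lemma meridian_lshift x (i : 'I_p.+1) : meridian x 0 (lshift 1 i) = x 0 (lshift q i).
Proof. by rewrite row_mxEl mxE. Qed.

Lemma spointP (x y : spoint) : (forall i : 'I_p.+1, x 0 (lshift 1 i) = y 0 (lshift 1 i)) ->
  rad x = rad y -> x = y.
Proof.
move=> H1 H2; apply/rowP => i; rewrite -(@fintype.splitK _ _ i).
by case: (fintype.split i) => k /=; [exact: H1|rewrite (ord1 k); exact: H2].
Qed.

Lemma qnorm2_lshift x (i : 'I_p.+1) (h : R) : qnorm2 (h *: delta_mx 0 (lshift q i) + x) = qnorm2 x.
Proof.
by apply: eq_bigr => j _; rewrite !mxE eqxx eq_rlshift mulr0 add0r.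
Qed.

Lemma qnorm2_rshift x (j : 'I_q) (h : R) : qnorm2 (h *: delta_mx 0 (rshift p.+1 j) + x) =
  qnorm2 x + 2 * x 0 (rshift p.+1 j) * h + h ^+ 2.
Proof.
rewrite /qnorm2 (bigD1 j)//= [in RHS](bigD1 j)//= !mxE !eqxx/= mulr1.
rewrite (eq_bigr (fun k => x 0 (rshift p.+1 k) ^+ 2)) => [|k kj]; first by ring.
by rewrite !mxE eqxx (inj_eq (@rshift_inj _ _)) (negbTE kj) mulr0 add0r.
Qed.

Lemma meridian_affine_l x (i : 'I_p.+1) (h : R) :
  meridian (h *: delta_mx 0 (lshift q i) + x) = h *: delta_mx 0 (lshift 1 i) + meridian x.
Proof.
apply: spointP => [k|]; last first.
  by rewrite rad_meridian rad_lshift rad_meridian /qnorm qnorm2_lshift.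
by rewrite meridian_lshift [RHS]mxE meridian_lshift !mxE !(inj_eq (@lshift_inj _ _)).
Qed.

Lemma meridian_r x (j : 'I_q) (h : R) :
  meridian (h *: delta_mx 0 (rshift p.+1 j) + x) =
  (qnorm (h *: delta_mx 0 (rshift p.+1 j) + x) - qnorm x) *: delta_mx 0 ridx + meridian x.
Proof.
apply: spointP => [k|]; last by rewrite rad_ridx !rad_meridian subrK.
rewrite meridian_lshift [RHS]mxE meridian_lshift !mxE !eqxx/=.
by rewrite eq_lrshift /Defs.ridx eq_lrshift !mulr0.
Qed.

Lemma qnorm_continuous x : qnorm y @[y --> x] --> qnorm x.
Proof.
have cc i : (y : point) 0 i @[y --> x] --> x 0 i by exact: (@coord_continuous _ _ _ _ _ x).
have c2 : qnorm2 y @[y --> x] --> qnorm2 x.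
  apply: (@cvg_big _ _ _ _ _ (@add_continuous R) _ (nbhs x) _ _ _ (nbhs_filter x)) => i _.
  exact: (cvgM (cc _) (cc _)).
exact: (@continuous_comp _ _ _ qnorm2 Num.sqrt x c2 (@sqrt_continuous _ _)).
Qed.

Lemma meridian_continuous : continuous meridian.
Proof.
have -> : meridian = fun x => \sum_(i < p.+1) x 0 (lshift q i) *: delta_mx 0 (lshift 1 i)
    + qnorm x *: delta_mx 0 ridx.
  apply/funext => x; apply: spointP => [k|].
    rewrite meridian_lshift [RHS]mxE summxE (bigD1 k)//= big1 ?addr0 => [|i ik].
      by rewrite !mxE !eqxx /Defs.ridx eq_lrshift !mulr1 mulr0 addr0.
    by rewrite !mxE eqxx (inj_eq (@lshift_inj _ _)) eq_sym (negbTE ik) mulr0.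
  rewrite rad_meridian /Defs.rad [RHS]mxE summxE big1 ?add0r => [|i _].
    by rewrite !mxE !eqxx mulr1.
  by rewrite !mxE /Defs.ridx eq_rlshift andbF mulr0.
move=> x.
pose L (y : point) : spoint := \sum_(i < p.+1) y 0 (lshift q i) *: (delta_mx 0 (lshift 1 i) : spoint).
have c1 : Ck 0 setT L.
  apply: Ck_sum; [exact: openT|move=> i].
  by apply: Ck_scale; [exact: openT|exact: Ck_coord|exact: Ck_cst].
have c2 : qnorm y *: (delta_mx 0 ridx : spoint) @[y --> x] --> qnorm x *: (delta_mx 0 ridx : spoint).
  by apply: (@cvgZr_tmp _ _ _ _ (nbhs_filter x)); exact: qnorm_continuous.
have c3 : L y @[y --> x] --> L x by exact: (Ck_cont c1 I).
exact: (@cvgD _ _ _ _ (nbhs_filter x) _ _ _ _ c3 c2).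
Qed.

Variables (U : set spoint) (Omega : set point).
Hypotheses (oU : open U) (symU : forall z : spoint, U z -> U (refl z)).
Hypotheses (oO : open Omega) (OU : forall x, Omega x -> U (meridian x)).

Lemma lift_continuous F x : (forall z, U z -> {for z, continuous F}) -> Omega x ->
  {for x, continuous (lift F)}.
Proof.
move=> cF Ox; apply: (@continuous_comp _ _ _ meridian F x); first exact: meridian_continuous.
exact: cF (OU Ox).
Qed.

Lemma lift_partial_l F x (i : 'I_p.+1) : smooth U F -> Omega x ->
  is_derive x (delta_mx 0 (lshift q i)) (lift F) (lift (partial (lshift 1 i) F) x).
Proof.
move=> sF Ox; apply: (is_derive_affine (meridian_affine_l x i)).
exact: (smooth_has_partial sF (OU Ox)).
Qed.

(** Off the axis the derivative of [|x_q|] along [e_j] is [x_j / |x_q|], and the denominator turns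
    the derivative of [F] in [r] into [Er F]. *)
Lemma lift_partial_r F x (j : 'I_q) : even_smooth U F -> Omega x ->
  is_derive x (delta_mx 0 (rshift p.+1 j)) (lift F) (x 0 (rshift p.+1 j) *: lift (Er F) x).
Proof.
move=> eF Ox; have [sF pF] := eF; have Ux := OU Ox.
pose e : point := delta_mx 0 (rshift p.+1 j); pose xj := x 0 (rshift p.+1 j).
suff H : is_derive (0 : R) 1 (fun h : R => lift F (h *: e + x)) (xj *: lift (Er F) x).
  exact: is_derive_along H.
have dphi (s : R) : U (s *: delta_mx 0 ridx + meridian x) ->
    is_derive s 1 (fun s : R => F (s *: delta_mx 0 ridx + meridian x))
      (partial ridx F (s *: delta_mx 0 ridx + meridian x)).
  by move=> Us; exact: (is_derive_line (smooth_has_partial sF Us)).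
have d0 : is_derive (0:R) 1 (fun s : R => F (s *: delta_mx 0 ridx + meridian x)) (rad (meridian x) *: Er F (meridian x)).
  have := dphi 0; rewrite scale0r add0r => /(_ Ux) D.
  exact: (is_derive_eq D (drE oU symU eF Ux)).
(* On the axis [|x_q|] becomes [|h|] after a step [h]; evenness replaces [|h|] by [h], and the
   derivative of [F] in [r] vanishes there. *)
have [r0|r0] := eqVneq (qnorm x) 0.
  have xj0 : xj = 0 by exact: qnorm_eq0.
  have q0 : qnorm2 x = 0 by rewrite /qnorm2 big1 // => k _; rewrite qnorm_eq0// expr0n.
  rewrite xj0 scale0r; move: d0; rewrite rad_meridian r0 scale0r => d0.
  have [d dp dU] := open_ball_sub oU Ux.
  apply: (near_eq_is_derive _ d0); exists d => // h /=; rewrite sub0r normrN => hd.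
  rewrite /lift meridian_r r0 subr0 /qnorm qnorm2_rshift q0 -/xj xj0 mulr0 mul0r !add0r sqrtr_sqr.
  have [h0|h0] := leP 0 h; first by rewrite ger0_norm.
  have hU : U (h *: delta_mx 0 ridx + meridian x).
    by apply: dU; apply: ball_step => //; [exact: ballxx|rewrite addrK].
  have := pF _ hU; rewrite scale1r => <-; congr F.
  rewrite refl_affine /refl_sign eqxx scaleN1r scalerN -scaleNr ltr0_norm//.
  by rewrite refl_fix// rad_meridian.
pose rho (h : R) := qnorm (h *: e + x) - qnorm x.
have E : (fun h : R => lift F (h *: e + x)) = (fun s : R => F (s *: delta_mx 0 ridx + meridian x)) \o rho.
  by apply/funext => h; rewrite /lift meridian_r.
have rp : 0 < qnorm x by rewrite lt_neqAle eq_sym r0 qnorm_ge0.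
have drho : is_derive (0:R) 1 rho (xj / qnorm x).
  have E2 : rho = (fun h => Num.sqrt (qnorm2 x + 2 * xj * h + h ^+ 2) - qnorm x).
    by apply/funext => h; rewrite /rho /qnorm qnorm2_rshift.
  rewrite E2.
  have q0 : 0 < qnorm2 x by rewrite -sqrtr_gt0.
  pose g (h : R) := qnorm2 x + 2 * xj * h + h ^+ 2.
  have g0 : g 0 = qnorm2 x by rewrite /g mulr0 expr0n/= !addr0.
  have dg : is_derive (0:R) 1 g (2 * xj).
    have i1 : is_derive (0:R) (1:R) (@id R) 1 by exact: is_derive_id.
    have i3 := is_deriveM i1 i1.
    have i2 := is_deriveZ (2 * xj) i1.
    have i0 : is_derive (0:R) (1:R) (cst (qnorm2 x)) (0:R) by exact: is_derive_cst.
    have i4 := is_deriveD (is_deriveD i0 i2) i3.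
    apply: (is_derive_eq i4).
    by rewrite /= add0r scale0r !addr0 /GRing.scale/= mulr1.
  have g00 : 0 < g 0 by rewrite g0.
  have [d1 d2] := is_derive_comp1 dg (is_derive1_sqrt g00).
  have dcst : is_derive (0:R) 1 (cst (- qnorm x)) 0 by exact: is_derive_cst.
  have := is_deriveD (DeriveDef d1 d2) dcst.
  rewrite addr0 g0 -[Num.sqrt (qnorm2 x)]/(qnorm x).
  rewrite (_ : _ *: _ = xj / qnorm x); first exact.
  by rewrite /GRing.scale /= invfM mulrCA mulrA mulKf.
rewrite E.
have rho0 : rho 0 = 0 by rewrite /rho scale0r add0r subrr.
have d1 : is_derive (rho 0) 1 (fun s : R => F (s *: delta_mx 0 ridx + meridian x)) (rad (meridian x) *: Er F (meridian x)).
  by rewrite rho0.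
have := is_derive_comp1 drho d1; by rewrite scalerA rad_meridian divfK.
Qed.

End AxialLift.

(** * The Laplacian of axially symmetric functions *)

Section AxialLaplacian.
Context {R : realType} {p q : nat}.
Local Notation point := 'rV[R]_(p.+1 + q).
Local Notation spoint := 'rV[R]_(p.+1 + 1).
Local Notation cliff := (clifford R (p + q)).
Local Notation ridx := (@ridx p).
Local Notation rad := (@Defs.rad R p).
Implicit Types (x y : point) (F H : spoint -> cliff) (G : point -> cliff).

Variables (U : set spoint) (Omega : set point).
Hypotheses (oU : open U) (symU : forall z : spoint, U z -> U (refl z)).
Hypotheses (oO : open Omega) (OU : forall x, Omega x -> U (meridian x)).

Lemma partial_lift_l F x (i : 'I_p.+1) : smooth U F -> Omega x ->
  partial (lshift q i) (lift F) x = lift (partial (lshift 1 i) F) x.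
Proof. by move=> sF Ox; apply: partial_val; exact: (lift_partial_l OU i sF Ox). Qed.

Lemma partial_lift_r F x (j : 'I_q) : even_smooth U F -> Omega x ->
  partial (rshift p.+1 j) (lift F) x = x 0 (rshift p.+1 j) *: lift (Er F) x.
Proof. by move=> eF Ox; apply: partial_val; exact: (lift_partial_r oU symU OU j eF Ox). Qed.

(** Up to a coordinate factor, every partial derivative of the lift of an even function is again
    such a lift, so the induction on the order closes. *)
Lemma smooth_lift F : even_smooth U F -> smooth Omega (lift F).
Proof.
move=> eF k; elim: k F eF => [|k IH] F eF; have [sF _] := eF.
  split; last exact: I.
  by move=> x Ox; apply: (lift_continuous OU _ Ox) => z; exact: smooth_cont sF.
split; first by move=> x Ox; apply: (lift_continuous OU _ Ox) => z; exact: smooth_cont sF.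
move=> i; rewrite -(@fintype.splitK _ _ i); case: (fintype.split i) => j /=; split.
- by move=> x Ox; have [] := lift_partial_l OU j sF Ox.
- apply: (Ck_eq (F := lift (partial (lshift 1 j) F)) oO).
    by move=> x Ox; apply: esym; exact: partial_lift_l.
  by apply: IH; exact: (even_partial oU symU _ eF).
- by move=> x Ox; have [] := lift_partial_r oU symU OU j eF Ox.
- apply: (Ck_eq (F := fun x => x 0 (rshift p.+1 j) *: lift (Er F) x) oO).
    by move=> x Ox; apply: esym; exact: partial_lift_r.
  apply: Ck_scale; [exact: oO|exact: Ck_coord|].
  by apply: IH; exact: (even_Er oU symU eF).
Qed.

Lemma partial_coord_mul G x (j i : 'I_(p.+1 + q)) : has_partial i G x ->
  partial i (fun y => y 0 j *: G y) x = (i == j)%:R *: G x + x 0 j *: partial i G x.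
Proof.
move=> dG; have [c1 c2] := is_derive_coord x (delta_mx 0 i) j.
apply: partial_val; apply: (is_derive_eq (is_derive_scale c1 dG)).
by rewrite c2 mxE eqxx eq_sym.
Qed.

(** Differentiating [x_j E F] once more along [e_j] gives [E F + x_j^2 E E F]; summed over the [q]
    last coordinates this is [q E F + r^2 E E F]. *)
Lemma laplacian_lift F x : even_smooth U F -> Omega x ->
  laplacian (lift F) x = lift (axial_laplacian q%:R F) x.
Proof.
move=> eF Ox; have [sF _] := eF; have eE := even_Er oU symU eF.
have H1 (i : 'I_p.+1) : partial (lshift q i) (partial (lshift q i) (lift F)) x =
    lift (partial (lshift 1 i) (partial (lshift 1 i) F)) x.
  apply: etrans (partial_lift_l i (smooth_partial _ sF) Ox).
  by apply: (derive_eq_near _ oO Ox) => y Oy; exact: partial_lift_l.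
have H2 (j : 'I_q) : partial (rshift p.+1 j) (partial (rshift p.+1 j) (lift F)) x =
    lift (Er F) x + x 0 (rshift p.+1 j) ^+ 2 *: lift (Er (Er F)) x.
  apply: etrans (derive_eq_near _ oO Ox (fun y Oy => partial_lift_r j eF Oy)) _.
  have dE : has_partial (rshift p.+1 j) (lift (Er F)) x.
    exact: (smooth_has_partial (smooth_lift eE) Ox).
  apply: etrans (partial_coord_mul _ dE) _; rewrite eqxx scale1r expr2 -scalerA.
  apply: (congr1 (fun u : cliff => lift (Er F) x + x 0 (rshift p.+1 j) *: u)).
  exact: partial_lift_r.
rewrite /laplacian big_split_ord /=.
apply: etrans (congr2 (fun u v : cliff => u + v) (eq_bigr _ (fun i _ => H1 i))
  (eq_bigr _ (fun j _ => H2 j))) _.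
rewrite big_split/= -scaler_suml sumr_const card_ord -/(qnorm2 x) addrA.
rewrite [RHS]/lift /axial_laplacian rad_meridian /qnorm sqr_sqrtr ?qnorm2_ge0//.
by rewrite scaler_nat.
Qed.

Lemma qvecE x : qvec x = \sum_(j < q) x 0 (rshift p.+1 j) *: pgen (rshift p.+1 j).
Proof. by apply: eq_bigr => j _; rewrite mxE. Qed.

Lemma sum_pgen_coord x (c : cliff) :
  \sum_(j < q) pgen (rshift p.+1 j) * (x 0 (rshift p.+1 j) *: c) = qvec x * c.
Proof.
rewrite qvecE mulr_suml; apply: eq_bigr => j _.
by rewrite -clifford_scalerAl -clifford_scalerAr.
Qed.

Lemma qvec_mulE G : (fun x => qvec x * G x) =
  fun x => \sum_(j < q) x 0 (rshift p.+1 j) *: (pgen (rshift p.+1 j) * G x).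
Proof.
apply/funext => x; rewrite qvecE mulr_suml; apply: eq_bigr => j _.
by rewrite -clifford_scalerAl.
Qed.

Lemma smooth_qvec_mul G : smooth Omega G -> smooth Omega (fun x => qvec x * G x).
Proof.
move=> sG; rewrite qvec_mulE; apply: smooth_sum; [exact: oO|move=> j].
apply: smooth_scale; [exact: oO| |exact: (smooth_cmul _ oO sG)].
by move=> k; exact: Ck_coord.
Qed.

Lemma partial_qvec_mul G i x : smooth Omega G -> Omega x ->
  partial i (fun y => qvec y * G y) x =
    \sum_(j < q) ((i == rshift p.+1 j)%:R *: (pgen (rshift p.+1 j) * G x)) +
    qvec x * partial i G x.
Proof.
move=> sG Ox; rewrite qvec_mulE.
have dG (c : cliff) : is_derive x (delta_mx 0 i) (fun y => c * G y) (c * partial i G x).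
  by apply: is_partial_cmul; exact: smooth_has_partial sG Ox.
have dj (j : 'I_q) : is_derive x (delta_mx 0 i)
   (fun y => y 0 (rshift p.+1 j) *: (pgen (rshift p.+1 j) * G y))
   ((i == rshift p.+1 j)%:R *: (pgen (rshift p.+1 j) * G x) +
     x 0 (rshift p.+1 j) *: (pgen (rshift p.+1 j) * partial i G x)).
  have [c1 c2] := is_derive_coord x (delta_mx 0 i) (rshift p.+1 j).
  have [g1 g2] := dG (pgen (rshift p.+1 j)).
  apply: (is_derive_eq (is_derive_scale c1 g1)).
  by rewrite c2 mxE eqxx eq_sym; congr (_ + _); exact: (congr1 (fun u : cliff => _ *: u) g2).
apply: etrans (partial_val (is_derive_bigsum _ dj)) _.
rewrite big_split/=; congr (_ + _); rewrite qvecE mulr_suml; apply: eq_bigr => j _.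
by rewrite -clifford_scalerAl.
Qed.

Lemma partial_qvec_l G (i : 'I_p.+1) x : smooth Omega G -> Omega x ->
  partial (lshift q i) (fun y => qvec y * G y) x = qvec x * partial (lshift q i) G x.
Proof.
move=> sG Ox; apply: etrans (partial_qvec_mul _ sG Ox) _.
rewrite big1 ?add0r// => j _.
by rewrite eq_lrshift scale0r.
Qed.

Lemma partial_qvec_r G (j : 'I_q) x : smooth Omega G -> Omega x ->
  partial (rshift p.+1 j) (fun y => qvec y * G y) x =
  pgen (rshift p.+1 j) * G x + qvec x * partial (rshift p.+1 j) G x.
Proof.
move=> sG Ox; apply: etrans (partial_qvec_mul _ sG Ox) _.
rewrite (bigD1 j)//= eqxx scale1r big1 ?addr0// => k kj.
by rewrite (inj_eq (@rshift_inj _ _)) eq_sym (negbTE kj) scale0r.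
Qed.

Lemma laplacian_qvec_mul G x : smooth Omega G -> Omega x ->
  laplacian (fun y => qvec y * G y) x = qvec x * laplacian G x +
    2 *: \sum_(j < q) pgen (rshift p.+1 j) * partial (rshift p.+1 j) G x.
Proof.
move=> sG Ox.
have H1 (i : 'I_p.+1) : partial (lshift q i) (partial (lshift q i) (fun y => qvec y * G y)) x =
    qvec x * partial (lshift q i) (partial (lshift q i) G) x.
  apply: etrans (partial_qvec_l i (smooth_partial _ sG) Ox).
  by apply: (derive_eq_near _ oO Ox) => y Oy; exact: partial_qvec_l.
have H2 (j : 'I_q) : partial (rshift p.+1 j) (partial (rshift p.+1 j) (fun y => qvec y * G y)) x =
    2 *: (pgen (rshift p.+1 j) * partial (rshift p.+1 j) G x) +
    qvec x * partial (rshift p.+1 j) (partial (rshift p.+1 j) G) x.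
  apply: etrans (derive_eq_near _ oO Ox (fun y Oy => partial_qvec_r j sG Oy)) _.
  apply: etrans (smooth_partialD (U := Omega) (rshift p.+1 j) (smooth_cmul _ oO sG)
    (smooth_qvec_mul (smooth_partial (rshift p.+1 j) sG)) Ox) _.
  apply: etrans (congr2 (fun u v : cliff => u + v) (smooth_partial_cmul _ _ sG Ox)
    (partial_qvec_r j (smooth_partial _ sG) Ox)) _.
  generalize (partial (rshift p.+1 j) (partial (rshift p.+1 j) G) x),
    (partial (rshift p.+1 j) G x) => P Q.
  by rewrite addrA; congr (_ + _); rewrite -mulr2n scaler_nat.
rewrite /laplacian [LHS]big_split_ord [X in qvec x * X]big_split_ord /=.
apply: etrans (congr2 (fun u v : cliff => u + v) (eq_bigr _ (fun i _ => H1 i))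
  (eq_bigr _ (fun j _ => H2 j))) _.
rewrite big_split/= -scaler_sumr.
rewrite -[X in _ + (_ + X)]mulr_sumr.
rewrite -[X in X + _]mulr_sumr.
by rewrite addrCA addrC -mulrDr.
Qed.

(** The cross term of the product rule is twice the sum of [e_j x_j E H], that is [2 x_q E H]; it
    accounts for the shift from [q] to [q + 2]. *)
Lemma laplacian_qvec_lift H x : even_smooth U H -> Omega x ->
  laplacian (fun y => qvec y * lift H y) x =
    qvec x * lift (axial_laplacian (q%:R + 2) H) x.
Proof.
move=> eH Ox; apply: etrans (laplacian_qvec_mul (smooth_lift eH) Ox) _.
apply: etrans (congr2 (fun u v : cliff => qvec x * u + 2 *: v) (laplacian_lift eH Ox)
  (eq_bigr _ (fun j _ => congr1 (fun u : cliff => pgen (rshift p.+1 j) * u)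
     (partial_lift_r j eH Ox)))) _.
apply: etrans (congr1 (fun u : cliff => qvec x * lift (axial_laplacian q%:R H) x + 2 *: u)
  (sum_pgen_coord x (lift (Er H) x))) _.
rewrite /lift /axial_laplacian.
generalize (LapP H (meridian x)), (Er H (meridian x)), (Er (Er H) (meridian x)) => P Q T.
rewrite clifford_scalerAr -mulrDr [(q%:R + 2) *: Q]scalerDl addrA; congr (_ * _).
exact: addrAC.
Qed.

End AxialLaplacian.

(** * Iterates of the radial derivative, on and off the axis *)

Section IteratedRadialDerivative.
Context {R : realType} {p q : nat}.
Local Notation point := 'rV[R]_(p.+1 + q).
Local Notation spoint := 'rV[R]_(p.+1 + 1).
Local Notation cliff := (clifford R (p + q)).
Local Notation ridx := (@ridx p).
Local Notation rad := (@Defs.rad R p).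
Implicit Types (x y : spoint) (F G H : spoint -> cliff).

Variable U : set spoint.
Hypotheses (oU : open U) (symU : forall z : spoint, U z -> U (refl z)).

Lemma even_iter_Er k F : even_smooth U F -> even_smooth U (iter k Er F).
Proof. by move=> eF; elim: k => // k IH; exact: (even_Er oU symU IH). Qed.

Lemma axial_laplacian_iter_Er k (c : R) F : even_smooth U F ->
  (forall x, U x -> axial_laplacian c F x = 0) ->
  forall x, U x -> axial_laplacian (c + k.*2%:R) (iter k Er F) x = 0.
Proof.
move=> eF H0; elim: k => [|k IH]; first by rewrite addr0.
have -> : c + k.+1.*2%:R = (c + k.*2%:R) + 2 :> R by rewrite doubleS -addn2 natrD addrA.
exact: (axial_laplacian_Er oU symU (even_iter_Er k eF) IH).
Qed.

Lemma radial_second F x : even_smooth U F -> U x ->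
  partial ridx (partial ridx F) x = Er F x + rad x ^+ 2 *: Er (Er F) x.
Proof.
move=> eF Ux; have [sF _] := eF; have eE := even_Er oU symU eF; have [sE _] := eE.
apply: etrans (derive_eq_near _ oU Ux (fun y Uy => drE oU symU eF Uy)) _.
apply: etrans (partial_rad_ridx sE Ux) _.
apply: etrans (congr1 (fun u : cliff => Er F x + rad x *: u) (drE oU symU eE Ux)) _.
by rewrite scalerA -expr2.
Qed.

Lemma laplacian_even F x : even_smooth U F -> U x ->
  \sum_i partial i (partial i F) x = axial_laplacian 1 F x.
Proof.
move=> eF Ux; rewrite big_split_ord big_ord1.
apply: etrans (congr1 (fun u : cliff => LapP F x + u) (radial_second eF Ux)) _.
by rewrite /axial_laplacian scale1r addrA.
Qed.

(** The constant [3 = 1 + 2] is the shift of [laplacian_qvec_lift] in one radial dimension, with [r]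
    in the role of [x_q]. *)
Lemma laplacian_rad_even H x : even_smooth U H -> U x ->
  \sum_i partial i (partial i (fun y => rad y *: H y)) x = rad x *: axial_laplacian 3 H x.
Proof.
move=> eH Ux; have [sH _] := eH.
have [sd _] := even_dr_odd oU symU eH.
rewrite big_split_ord big_ord1.
have H1 (i : 'I_p.+1) : partial (lshift 1 i) (partial (lshift 1 i) (fun y => rad y *: H y)) x =
    rad x *: partial (lshift 1 i) (partial (lshift 1 i) H) x.
  apply: etrans (partial_rad_lshift i (smooth_partial _ sH) Ux).
  by apply: (derive_eq_near _ oU Ux) => y Uy; exact: (partial_rad_lshift i sH Uy).
have H2 : partial ridx (partial ridx (fun y => rad y *: H y)) x =
    rad x *: (3 *: Er H x + rad x ^+ 2 *: Er (Er H) x).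
  apply: etrans (derive_eq_near _ oU Ux (fun y Uy => partial_rad_ridx sH Uy)) _.
  apply: etrans (smooth_partialD (U := U) ridx sH _ Ux) _.
    exact: (smooth_scale oU (@smooth_rad R p U) sd).
  apply: etrans (congr2 (fun u v : cliff => u + v) (drE oU symU eH Ux)
    (partial_rad_ridx sd Ux)) _.
  apply: etrans (congr2 (fun u v : cliff => rad x *: Er H x + (u + rad x *: v))
    (drE oU symU eH Ux) (radial_second eH Ux)) _.
  generalize (Er H x), (Er (Er H) x) => P Q.
  rewrite !scalerDr !addrA; congr (_ + _).
  by rewrite -!scalerDl scalerA; congr (_ *: _); ring.
apply: etrans (congr2 (fun u v : cliff => u + v) (eq_bigr _ (fun i _ => H1 i)) H2) _.
by rewrite -scaler_sumr -scalerDr /axial_laplacian addrA.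
Qed.

Lemma even_tangential (c : 'I_p.+1 -> cliff) F : even_smooth U F ->
  let D G z := \sum_i c i * partial (lshift 1 i) G z in
  even_smooth U (D F) /\ forall x, U x -> Er (D F) x = D (Er F) x.
Proof.
move=> eF.
have eP i := even_cmul oU (c i) (even_partial oU symU i eF).
have [e1 e2] := even_sum oU symU (index_enum 'I_p.+1) eP.
split=> [|x Ux]; first exact: e1.
apply: etrans (e2 x Ux) _; apply: eq_bigr => i _.
apply: etrans (Er_cmul oU symU _ (even_partial oU symU i eF) Ux) _.
exact: (congr1 (fun u : cliff => c i * u) (Er_partial oU symU i eF Ux)).
Qed.

Definition even_Dp := even_tangential (fun i => pgen (lshift q i)).
Definition even_Dpbar := even_tangential (fun i => pconj (lshift q i)).

(* For [k = 0] this is the Vekua system for [F1] and [F2 = r H]. *)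
Lemma iterated_vekua k F H : even_smooth U F -> even_smooth U H ->
  (forall x, U x -> Dp F x = H x + rad x ^+ 2 *: Er H x) ->
  (forall x, U x -> Dpbar H x = - Er F x) ->
  forall x, U x ->
  Dp (iter k Er F) x =
    (1 + k.*2%:R) *: iter k Er H x + rad x ^+ 2 *: iter k.+1 Er H x /\
  Dpbar (iter k Er H) x = - iter k.+1 Er F x.
Proof.
move=> eF eH v1 v2; elim: k => [|k IH] x Ux; first by rewrite addr0 scale1r; split; [exact: v1|exact: v2].
have eFk := even_iter_Er k eF; have eHk := even_iter_Er k eH.
have eFk1 := even_iter_Er k.+1 eF; have eHk1 := even_iter_Er k.+1 eH.
split.
  have [_ E] := even_Dp eFk; apply: etrans (esym (E x Ux)) _.
  pose S x := (1 + k.*2%:R) *: iter k Er H x + 1 *: (rad x ^+ 2 *: iter k.+1 Er H x).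
  have ES y : U y -> Dp (iter k Er F) y = S y.
    by move=> Uy; have [-> _] := IH y Uy; rewrite /S scale1r.
  apply: etrans (Er_eq oU ES Ux) _.
  apply: etrans (Er_linear oU symU _ _ eHk (even_r2 oU eHk1) Ux) _.
  apply: etrans (congr1 (fun u : cliff => (1 + k.*2%:R) *: Er (iter k Er H) x + 1 *: u)
    (Er_r2 oU symU eHk1 Ux)) _.
  rewrite -[Er (iter k Er H) x]/(iter k.+1 Er H x) -[Er (iter k.+1 Er H) x]/(iter k.+2 Er H x).
  generalize (iter k.+1 Er H x), (iter k.+2 Er H x) => P Q.
  have -> : 1 + k.+1.*2%:R = (1 + k.*2%:R) + 2 :> R by rewrite doubleS -addn2 natrD addrA.
  by rewrite scale1r addrA [in RHS]scalerDl.
have [_ E] := even_Dpbar eHk; apply: etrans (esym (E x Ux)) _.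
pose S x := (-1) *: iter k.+1 Er F x + 0 *: iter k.+1 Er F x.
have ES y : U y -> Dpbar (iter k Er H) y = S y.
  by move=> Uy; have [_ ->] := IH y Uy; rewrite /S scaleN1r scale0r addr0.
apply: etrans (Er_eq oU ES Ux) _.
apply: etrans (Er_linear oU symU _ _ eFk1 eFk1 Ux) _.
by rewrite scaleN1r scale0r addr0.
Qed.

Lemma open_off_axis : open (U `&` [set x | rad x != 0]).
Proof. by apply: openI => //; exact: open_coord_neq0. Qed.

Lemma iter_inv_r_dr k F x : even_smooth U F -> U x -> rad x != 0 ->
  iter k inv_r_dr F x = iter k Er F x.
Proof.
move=> eF; elim: k x => // k IH x Ux rx.
have eFk := even_iter_Er k eF.
have H y : (U `&` [set x | rad x != 0]) y -> iter k inv_r_dr F y = iter k Er F y.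
  by move=> [Uy ry]; exact: IH.
apply: etrans (congr1 (fun u : cliff => (rad x)^-1 *: u)
  (derive_eq_near _ open_off_axis (conj Ux rx) H)) _.
apply: etrans (congr1 (fun u : cliff => (rad x)^-1 *: u) (drE oU symU eFk Ux)) _.
by rewrite scalerA mulVf// scale1r.
Qed.

(** Conjugation by [r] turns [F -> d_r (F / r)] into [(1/r) d_r]: for [F = r H] one step gives
    [d_r H = r E H]. *)
Lemma iter_dr_inv_r k F H x : even_smooth U H -> (forall x, U x -> F x = rad x *: H x) ->
  U x -> rad x != 0 -> iter k dr_inv_r F x = rad x *: iter k Er H x.
Proof.
move=> eH FH; elim: k x => [|k IH] x Ux rx; first exact: FH.
have eHk := even_iter_Er k eH.
have H' y : (U `&` [set x | rad x != 0]) y -> div_r (iter k dr_inv_r F) y = iter k Er H y.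
  by move=> [Uy ry]; rewrite /div_r (IH y Uy ry) scalerA mulVf// scale1r.
apply: etrans (derive_eq_near _ open_off_axis (conj Ux rx) H') _.
exact: (drE oU symU eHk Ux).
Qed.

(** [G] is the continuous extension across [r = 0] of an expression [F] meaningful off the axis. The
    limit prescribed there is taken along the axis of [r], which stays in the open set [U]. *)
Lemma extend_r0_limit F G x : (forall y, U y -> {for y, continuous G}) ->
  (forall y, U y -> rad y != 0 -> F y = G y) -> U x ->
  (rad x = 0 -> cvg_r0 F (lsubmx x)) /\ extend_r0 F x = G x.
Proof.
move=> cG FG Ux.
suff H : rad x = 0 -> F (row_mx (lsubmx x) r%:M) @[r --> 0^'] --> G x.
  split; first by move=> /H rx; apply/cvg_ex; exists (G x).
  rewrite /extend_r0; case: (eqVneq (rad x) 0) => [/H H0|]; last exact: FG.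
  exact: (cvg_lim _ H0).
move=> rx.
have E (r : R) : row_mx (lsubmx x) r%:M = r *: delta_mx 0 ridx + x.
  apply: spointP => [k|]; last by rewrite rad_ridx rx addr0 /Defs.rad row_mxEr mxE mulr1n.
  by rewrite row_mxEl !mxE eqxx /Defs.ridx eq_lrshift mulr0 add0r.
have [d d0 dU] := open_ball_sub oU Ux.
apply/cvgrPdist_lt => e e0.
have [d' d'0 D] := continuous_ballP (cG x Ux) e0.
exists (Num.min d d'); first by rewrite /= lt_min d0.
move=> r /=; rewrite sub0r normrN lt_min => /andP[rd rd'] r0; rewrite E.
have Uy : U (r *: delta_mx 0 ridx + x).
  by apply: dU; apply: ball_step; [exact: d0|exact: ballxx|rewrite addrK].
rewrite (FG _ Uy); last by rewrite rad_ridx rx addr0.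
apply: D; apply: ball_step; [exact: d'0|exact: ballxx|by rewrite addrK].
Qed.

End IteratedRadialDerivative.

(** * The Laplacian and the Dirac operator on functions [F + x_q H] *)

Section GeneralizedPartialSlice.
Context {R : realType} {p q : nat}.
Local Notation point := 'rV[R]_(p.+1 + q).
Local Notation spoint := 'rV[R]_(p.+1 + 1).
Local Notation cliff := (clifford R (p + q)).
Local Notation ridx := (@ridx p).
Local Notation rad := (@Defs.rad R p).

(** [eta] supplies the direction when [x_q = 0], where any unit vector serves. *)
Lemma sphere_decomposition (eta : 'rV[R]_q) (x : point) : sphere eta ->
  exists2 w : 'rV[R]_q, sphere w & rsubmx x = qnorm x *: w.
Proof.
move=> eta1; have [r0|r0] := eqVneq (qnorm x) 0.
  by exists eta => //; apply/rowP => j; rewrite r0 scale0r !mxE qnorm_eq0.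
exists ((qnorm x)^-1 *: rsubmx x); last by rewrite scalerA divff// scale1r.
rewrite /sphere /=; under eq_bigr do rewrite !mxE exprMn.
rewrite -mulr_sumr -/(qnorm2 x) exprVn /qnorm sqr_sqrtr ?qnorm2_ge0// mulVf//.
by apply: contra r0; rewrite /qnorm => /eqP ->; rewrite sqrtr0.
Qed.

Lemma row_mx_qnorm (xp : 'rV[R]_p.+1) (r : R) (w : 'rV[R]_q) : 0 <= r -> sphere w ->
  qnorm (row_mx xp (r *: w)) = r.
Proof.
move=> r0 w1; rewrite /qnorm /qnorm2.
under eq_bigr do rewrite row_mxEr mxE exprMn.
by rewrite -mulr_sumr w1 mulr1 sqrtr_sqr ger0_norm.
Qed.

Lemma vecZ (r : R) (w : 'rV[R]_q) : vec (r *: w) = r *: vec w :> cliff.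
Proof.
by rewrite /vec scaler_sumr; apply: eq_bigr => j _; rewrite mxE scalerA.
Qed.

Lemma qvec_sqr (eta : 'rV[R]_q) (x : point) : sphere eta ->
  qvec x * qvec x = - (qnorm x ^+ 2)%:A :> cliff.
Proof.
move=> eta1; have [w w1 xw] := sphere_decomposition x eta1.
rewrite /qvec xw vecZ -clifford_scalerAl -clifford_scalerAr (vec_sqr w1) scalerA.
by rewrite scalerN expr2.
Qed.

Lemma pgen_sqr (j : 'I_q) : pgen (rshift p.+1 j) * pgen (rshift p.+1 j) = -1 :> cliff.
Proof.
have w1 : sphere (delta_mx 0 j : 'rV[R]_q).
  rewrite /sphere /= (bigD1 j)//= mxE !eqxx expr1n big1 ?addr0// => k kj.
  by rewrite mxE (negbTE kj) andbF expr0n.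
rewrite -(vec_sqr w1) /vec (bigD1 j)//= mxE !eqxx scale1r big1 ?addr0// => k kj.
by rewrite mxE (negbTE kj) andbF scale0r.
Qed.

Variables (U : set spoint) (Omega : set point).
Hypotheses (oU : open U) (symU : forall z : spoint, U z -> U (refl z)).
Hypotheses (oO : open Omega) (OU : forall x, Omega x -> U (meridian x)).

Definition axial (F H : spoint -> cliff) (x : point) : cliff := lift F x + qvec x * lift H x.

Lemma smooth_axial F H : even_smooth U F -> even_smooth U H -> smooth Omega (axial F H).
Proof.
move=> eF eH; apply: smoothD; [exact: oO|exact: (smooth_lift oU symU oO OU eF)|].
exact: (smooth_qvec_mul oO (smooth_lift oU symU oO OU eH)).
Qed.

Lemma partial_axial F H i x : even_smooth U F -> even_smooth U H -> Omega x ->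
  partial i (axial F H) x = partial i (lift F) x + partial i (fun y => qvec y * lift H y) x.
Proof.
move=> eF eH Ox; apply: (smooth_partialD _ _ _ Ox); first exact: (smooth_lift oU symU oO OU eF).
exact: (smooth_qvec_mul oO (smooth_lift oU symU oO OU eH)).
Qed.

(** Changing the parameter of [axial_laplacian] from [c] to [q], or from [c + 2] to [q + 2], adds
    the same multiple [q - c] of [E]; hence one scalar comes out in front of both parts. *)
Lemma laplacian_axial (c : R) F H x : even_smooth U F -> even_smooth U H ->
  (forall z, U z -> axial_laplacian c F z = 0) ->
  (forall z, U z -> axial_laplacian (c + 2) H z = 0) -> Omega x ->
  laplacian (axial F H) x = (q%:R - c) *: axial (Er F) (Er H) x.
Proof.
move=> eF eH F0 H0 Ox.
have sF := smooth_lift oU symU oO OU eF.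
have sH := smooth_qvec_mul oO (smooth_lift oU symU oO OU eH).
have E : laplacian (axial F H) x =
    laplacian (lift F) x + laplacian (fun y => qvec y * lift H y) x.
  rewrite /laplacian -big_split; apply: eq_bigr => i _.
  apply: etrans (derive_eq_near _ oO Ox (fun y Oy => partial_axial i eF eH Oy)) _.
  exact: (smooth_partialD _ (smooth_partial _ sF) (smooth_partial _ sH) Ox).
have L (d : R) (G : spoint -> cliff) (z : spoint) : axial_laplacian d G z = 0 ->
    axial_laplacian (q%:R - c + d) G z = (q%:R - c) *: Er G z.
  move=> G0; rewrite -[RHS]addr0 -[X in _ = _ + X]G0 /axial_laplacian scalerDl.
  generalize (LapP G z), (Er G z), (Er (Er G) z) => P Q T.
  by rewrite !addrA [P + _]addrC.
apply: (etrans E).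
apply: etrans (congr2 (fun u v : cliff => u + v) (laplacian_lift oU symU oO OU eF Ox)
  (laplacian_qvec_lift oU symU oO OU eH Ox)) _.
have q1 : q%:R = q%:R - c + c :> R by rewrite subrK.
have q2 : q%:R + 2 = q%:R - c + (c + 2) :> R by rewrite [in RHS]addrA subrK.
rewrite /lift {1}q1 q2 (L _ _ _ (F0 _ (OU Ox))) (L _ _ _ (H0 _ (OU Ox))).
by rewrite /axial /lift scalerDr clifford_scalerAr.
Qed.

Lemma iter_laplacian_axial k (f : point -> cliff) F H : even_smooth U F -> even_smooth U H ->
  (forall z, U z -> axial_laplacian 1 F z = 0) ->
  (forall z, U z -> axial_laplacian 3 H z = 0) ->
  (forall x, Omega x -> f x = axial F H x) ->
  forall x, Omega x -> iter k laplacian f x =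
    (\prod_(j < k) (q%:R - (1 + j.*2%:R))) *: axial (iter k Er F) (iter k Er H) x.
Proof.
move=> eF eH F0 H0 fE; elim: k => [|k IH] x Ox.
  by rewrite big_ord0 scale1r; exact: fE.
set C := \prod_(j < k) _ in IH.
have eFk := even_iter_Er oU symU k eF; have eHk := even_iter_Er oU symU k eH.
have sA := smooth_axial eFk eHk.
(* The induction hypothesis holds on the open set [Omega], so it may be differentiated twice
   there. *)
have -> : iter k.+1 laplacian f x = C *: laplacian (axial (iter k Er F) (iter k Er H)) x.
  rewrite iterS /laplacian scaler_sumr; apply: eq_bigr => i _.
  apply: etrans (smooth_partialZ C i (smooth_partial i sA) Ox).
  apply: (derive_eq_near _ oO Ox) => y Oy.
  apply: etrans (smooth_partialZ C i sA Oy).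
  exact: (derive_eq_near _ oO Oy IH).
have Fk := axial_laplacian_iter_Er oU symU k eF F0.
have Hk z : U z -> axial_laplacian (1 + k.*2%:R + 2) (iter k Er H) z = 0.
  have -> : 1 + k.*2%:R + 2 = 3 + k.*2%:R :> R by ring.
  exact: (axial_laplacian_iter_Er oU symU k eH H0).
apply: etrans (congr1 (fun u : cliff => C *: u) (laplacian_axial eFk eHk Fk Hk Ox)) _.
by rewrite scalerA big_ord_recr.
Qed.

Lemma axial_laplacian_iterable k (f : point -> cliff) F H : even_smooth U F ->
  even_smooth U H ->
  (forall z, U z -> axial_laplacian 1 F z = 0) ->
  (forall z, U z -> axial_laplacian 3 H z = 0) ->
  (forall x, Omega x -> f x = axial F H x) -> laplacian_iterable Omega k f.
Proof.
move=> eF eH F0 H0 fE j i x jk Ox.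
have eFj := even_iter_Er oU symU j eF; have eHj := even_iter_Er oU symU j eH.
have E y (Oy : Omega y) := esym (iter_laplacian_axial j eF eH F0 H0 fE Oy).
have sj := smooth_eq oO E (smoothZ _ oO (smooth_axial eFj eHj)).
split; first exact: (smooth_has_partial sj Ox).
exact: (smooth_has_partial (smooth_partial i sj) Ox).
Qed.

(** Moving [x_q] to the left past [e_i], for [i <= p], conjugates the operator in [x_p]. In the last
    [q] variables, the squares of the generators contribute [- q H], and the sum of the [x_j e_j]
    rebuilds [x_q], with [x_q^2 = - r^2]. *)
Lemma dirac_axial (eta : 'rV[R]_q) F H x : sphere eta -> even_smooth U F ->
  even_smooth U H -> Omega x ->
  Defs.dirac (axial F H) x =
    lift (fun z => Dp F z - (q%:R *: H z + rad z ^+ 2 *: Er H z)) x +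
    qvec x * lift (fun z => Dpbar H z + Er F z) x.
Proof.
move=> eta1 eF eH Ox; have [sF _] := eF; have [sH _] := eH.
have slH := smooth_lift oU symU oO OU eH.
have H1 (i : 'I_p.+1) : pgen (lshift q i) * partial (lshift q i) (axial F H) x =
    pgen (lshift q i) * lift (partial (lshift 1 i) F) x +
    qvec x * (pconj (lshift q i) * lift (partial (lshift 1 i) H) x).
  apply: etrans (congr1 (fun u : cliff => pgen (lshift q i) * u)
    (partial_axial (lshift q i) eF eH Ox)) _.
  apply: etrans (congr2 (fun u v : cliff => pgen (lshift q i) * (u + v))
    (partial_lift_l OU i sF Ox) (partial_qvec_l i slH Ox)) _.
  apply: etrans (congr1 (fun u : cliff => pgen (lshift q i) *
    (lift (partial (lshift 1 i) F) x + qvec x * u)) (partial_lift_l OU i sH Ox)) _.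
  by rewrite mulrDr !mulrA vec_pconjC.
have H2 (j : 'I_q) : pgen (rshift p.+1 j) * partial (rshift p.+1 j) (axial F H) x =
    pgen (rshift p.+1 j) * (x 0 (rshift p.+1 j) *: (lift (Er F) x + qvec x * lift (Er H) x))
    - lift H x.
  apply: etrans (congr1 (fun u : cliff => pgen (rshift p.+1 j) * u)
    (partial_axial (rshift p.+1 j) eF eH Ox)) _.
  apply: etrans (congr2 (fun u v : cliff => pgen (rshift p.+1 j) * (u + v))
    (partial_lift_r oU symU OU j eF Ox) (partial_qvec_r j slH Ox)) _.
  apply: etrans (congr1 (fun u : cliff => pgen (rshift p.+1 j) *
    (x 0 (rshift p.+1 j) *: lift (Er F) x + (pgen (rshift p.+1 j) * lift H x + qvec x * u)))
    (partial_lift_r oU symU OU j eH Ox)) _.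
  generalize (lift (Er F) x), (lift (Er H) x), (lift H x) => P Q T.
  rewrite -clifford_scalerAr scalerDr addrCA mulrDr mulrA pgen_sqr mulN1r.
  exact: addrC.
rewrite /Defs.dirac big_split_ord /=.
apply: etrans (congr2 (fun u v : cliff => u + v) (eq_bigr _ (fun i _ => H1 i))
  (eq_bigr _ (fun j _ => H2 j))) _.
rewrite [X in X + _]big_split [X in _ + X]big_split /= -[X in _ + X + _]mulr_sumr.
apply: etrans (congr1 (fun u : cliff => \sum_(i < p.+1) pgen (lshift q i) *
   lift (partial (lshift 1 i) F) x + qvec x * (\sum_(i < p.+1) pconj (lshift q i) *
   lift (partial (lshift 1 i) H) x) + (u + \sum_(j < q) - lift H x))
  (sum_pgen_coord x (lift (Er F) x + qvec x * lift (Er H) x))) _.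
rewrite sumr_const card_ord /lift.
rewrite -[X in X + _ + _]/(Dp F (meridian x)) -[X in _ + _ * X + _]/(Dpbar H (meridian x)).
generalize (Dp F (meridian x)), (Dpbar H (meridian x)), (Er F (meridian x)),
  (Er H (meridian x)), (H (meridian x)) => P Q S T V.
rewrite rad_meridian mulrDr mulrA (qvec_sqr x eta1) mulrDr mulNr -scalerAl mul1r.
by rewrite scaler_nat mulNrn opprD; exact: (AC (2*(2*1)) ((1*(5*4))*(2*3))).
Qed.

End GeneralizedPartialSlice.

Lemma odd_double_pred_half n : odd n -> n = n.-1./2.*2.+1.
Proof. by case: n => //= k ok; rewrite even_halfK. Qed.

(** The factor of index [0] is the leading factor of the double factorial; in the others both terms
    of the difference drop by [2], which gives the product for the preceding value of [m]. *)
Lemma double_factorialE (R : realType) (m : nat) :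
  \prod_(j < m) ((m.*2.+1)%:R - (1 + j.*2%:R)) = (double_factorial m.*2)%:R :> R.
Proof.
elim: m => [|m IH]; first by rewrite big_ord0.
rewrite big_ord_recl doubleS [double_factorial _]/= natrM -IH; congr (_ * _).
  by rewrite -[m.*2.+3]addn1 natrD addr0 addrK.
apply: eq_bigr => j _; rewrite lift0 doubleS -[in LHS]addn2 -[(j.*2).+2]addn2 !natrD; ring.
Qed.

(** * The even functions [F1] and [F2 / r] of a partial-slice monogenic function *)

Section StemFunctions.
Context {R : realType} {p q : nat}.
Local Notation point := 'rV[R]_(p.+1 + q).
Local Notation spoint := 'rV[R]_(p.+1 + 1).
Local Notation cliff := (clifford R (p + q)).
Local Notation ridx := (@ridx p).
Local Notation rad := (@Defs.rad R p).
Variables (Omega : set point) (f : point -> cliff) (eta : 'rV[R]_q).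
Hypotheses (dom : slice_domain Omega) (sym : p_symmetric Omega).
Hypotheses (fGSM : GSM Omega f) (eta1 : sphere eta).
Local Notation U := (slice Omega eta).

Let oU : open U := slice_open dom eta1.

Lemma lsubmx_refl (x : spoint) : lsubmx (refl x) = lsubmx x.
Proof. by apply/rowP => i; rewrite !mxE eq_lrshift andbF mulr0 add0r. Qed.

Lemma slice_refl (x : spoint) : U x -> U (refl x).
Proof.
rewrite -{1}(slice_sphere sym eta1 (sphere_opp eta1)) /slice /=.
by rewrite /slice_point lsubmx_refl rad_refl scalerN scaleNr.
Qed.

Lemma meridian_slice (x : point) : Omega x -> U (meridian x).
Proof.
have [w w1 xw] := sphere_decomposition x eta1.
rewrite /slice /slice_point /= rad_meridian /meridian row_mxKl.
have E : x = row_mx (lsubmx x) (qnorm x *: w) by rewrite -xw hsubmxK.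
have [r0|r0] := eqVneq (qnorm x) 0; first by rewrite {1}E r0 !scale0r.
by rewrite {1}E => Ox; apply: (sym _ w1 Ox eta1); rewrite lt_neqAle eq_sym r0 qnorm_ge0.
Qed.

Lemma even_F1 : even_smooth U (F1 f eta).
Proof.
split; first exact: (smooth_F1 dom sym fGSM eta1).
move=> x _; rewrite scale1r /F1 /= lsubmx_refl rad_refl scaleNr opprK.
by congr (_ *: _); exact: addrC.
Qed.

Lemma odd_F2 : has_parity U (-1) (F2 f eta).
Proof.
move=> x _; rewrite scaleN1r /F2 /= lsubmx_refl rad_refl scaleNr opprK.
by rewrite -[RHS]scalerN -mulrN opprB.
Qed.

Let H := cdivx ridx (F2 f eta).

Lemma even_F2_quotient : even_smooth U H.
Proof. exact: (even_cdivx oU (smooth_F2 dom sym fGSM eta1) odd_F2). Qed.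

Lemma F2_quotient x : U x -> F2 f eta x = rad x *: H x.
Proof. exact: (cdivxK (odd_vanishes odd_F2)). Qed.

Lemma axial_laplacian_F1 x : U x -> axial_laplacian 1 (F1 f eta) x = 0.
Proof.
move=> Ux; rewrite -(laplacian_even oU slice_refl even_F1 Ux).
exact: (harmonic_F1 dom sym fGSM eta1 Ux).
Qed.

(** Harmonicity of [F2 = r H] says that [r] times the left side vanishes, and [rad_cancel] removes
    the factor. *)
Lemma axial_laplacian_F2 x : U x -> axial_laplacian 3 H x = 0.
Proof.
have eH := even_F2_quotient; have [sH _] := eH.
have eE := even_Er oU slice_refl eH; have eEE := even_Er oU slice_refl eE.
have [eL _] := even_LapP oU slice_refl eH.
have [s1 _] := even_linear oU 1 3 eL eE.
have [s2 _] := even_r2 oU eEE.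
have s3 : smooth U (axial_laplacian 3 H).
  apply: (smooth_eq oU _ (smoothD oU s1 s2)) => y _.
  by rewrite scale1r.
apply: (rad_cancel (G := fun=> 0) oU s3 (fun k => Ck_cst k U 0)) => {}x Ux; rewrite scaler0.
rewrite -(laplacian_rad_even oU slice_refl eH Ux) -[RHS](harmonic_F2 dom sym fGSM eta1 Ux).
apply: eq_bigr => i _; apply: (derive_eq_near _ oU Ux) => y Uy.
by apply: (derive_eq_near _ oU Uy) => z Uz; rewrite F2_quotient.
Qed.

Lemma Dp_F1 x : U x -> Dp (F1 f eta) x = H x + rad x ^+ 2 *: Er H x.
Proof.
move=> Ux; have eH := even_F2_quotient; have [sH _] := eH.
apply: etrans (vekua1 dom sym fGSM eta1 Ux) _.
apply: etrans (derive_eq_near _ oU Ux F2_quotient) _.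
apply: etrans (partial_rad_ridx sH Ux) _.
apply: etrans (congr1 (fun u : cliff => H x + rad x *: u) (drE oU slice_refl eH Ux)) _.
by rewrite scalerA expr2.
Qed.

Lemma Dpbar_F2 x : U x -> Dpbar H x = - Er (F1 f eta) x.
Proof.
have eH := even_F2_quotient; have [sH _] := eH.
have eF := even_F1; have [sE _] := even_Er oU slice_refl eF.
have [[sD _] _] := even_Dpbar oU slice_refl eH.
apply: (rad_cancel (G := fun y => - Er (F1 f eta) y) oU sD).
  by apply: (smooth_eq oU _ (smoothZ (-1) oU sE)) => y _; rewrite scaleN1r.
move=> {}x Ux; rewrite scalerN.
apply: etrans _ (congr1 (fun u : cliff => - u) (drE oU slice_refl eF Ux)).
apply: etrans _ (vekua2 dom sym fGSM eta1 Ux).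
rewrite /Dpbar scaler_sumr; apply: eq_bigr => i _.
rewrite clifford_scalerAr; apply: (congr1 (fun u : cliff => pconj (lshift q i) * u)).
apply: etrans (esym (partial_rad_lshift i sH Ux)) _.
by apply: (derive_eq_near _ oU Ux) => y Uy; rewrite F2_quotient.
Qed.

(** With [w] the direction of [x_q], [w F2 = w r H = x_q H]. The direction has disappeared, and with
    it the singularity at [r = 0]; this gives the joint smoothness of [f] that the slices alone do
    not show. *)
Lemma GSM_axial x : Omega x -> f x = axial (F1 f eta) H x.
Proof.
move=> Ox; have [w w1 xw] := sphere_decomposition x eta1.
have Ux := meridian_slice Ox.
have := representation_formula dom sym fGSM eta1 w1 Ux.
rewrite /slice_point rad_meridian /meridian row_mxKl -xw hsubmxK => ->.
rewrite -/(meridian x) (F2_quotient Ux) rad_meridian /axial /qvec xw vecZ /lift.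
by rewrite -clifford_scalerAr -clifford_scalerAl.
Qed.

Lemma tau_axial x : odd q -> Omega x ->
  tau f x = axial (iter q.-1./2 Er (F1 f eta)) (iter q.-1./2 Er H) x.
Proof.
move=> q_odd Ox; rewrite /tau.
have oO : open Omega by have [[]] := dom.
have qE := odd_double_pred_half q_odd.
rewrite (iter_laplacian_axial oU slice_refl oO meridian_slice _ even_F1 even_F2_quotient
  axial_laplacian_F1 axial_laplacian_F2 GSM_axial Ox).
move: qE; set m := q.-1./2 => qE.
have PE : \prod_(j < m) (q%:R - (1 + j.*2%:R)) = (double_factorial q.-1)%:R :> R.
  by rewrite qE double_factorialE.
rewrite PE scalerA mulVf ?scale1r// qE /= pnatr_eq0 -lt0n.
by elim: (m) => // k; rewrite doubleS /= muln_gt0.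
Qed.

End StemFunctions.

Theorem theorem3p11 (R : realType) (p q : nat) (q_odd : odd q)
    (Omega : set 'rV[R]_(p.+1 + q)) (f : 'rV[R]_(p.+1 + q) -> clifford R (p + q))
    (eta : 'rV[R]_q) :
  slice_domain Omega -> p_symmetric Omega -> GSM Omega f -> sphere eta ->
  let m := q.-1./2 in
  let A := stemA m (F1 f eta) in
  let B := stemB m (F2 f eta) in
  [/\ laplacian_iterable Omega m f,
      stemA_exists (slice Omega eta) m (F1 f eta),
      stemB_exists (slice Omega eta) m (F2 f eta),
      (forall (xp : 'rV[R]_p.+1) (r : R) (omega : 'rV[R]_q),
         0 <= r -> sphere omega -> Omega (row_mx xp (r *: omega)) ->
         tau f (row_mx xp (r *: omega)) =
           A (row_mx xp r%:M) + vec omega * B (row_mx xp r%:M))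
    & monogenic Omega (tau f)].
Proof.
move=> dom sym fGSM eta1 m A B.
have oO : open Omega by have [[]] := dom.
have oU := slice_open dom eta1.
have symU := @slice_refl _ _ _ _ _ sym eta1.
have OU := @meridian_slice _ _ _ _ _ sym eta1.
have eF := even_F1 dom sym fGSM eta1.
have eH := even_F2_quotient dom sym fGSM eta1.
have FH := @F2_quotient _ _ _ Omega f eta.
have LF := @axial_laplacian_F1 _ _ _ _ f _ dom sym fGSM eta1.
have LH := @axial_laplacian_F2 _ _ _ _ f _ dom sym fGSM eta1.
have fE := @GSM_axial _ _ _ _ f _ dom sym fGSM eta1.
have v1 := @Dp_F1 _ _ _ _ f _ dom sym fGSM eta1.
have v2 := @Dpbar_F2 _ _ _ _ f _ dom sym fGSM eta1.
have tE x := @tau_axial _ _ _ _ f _ dom sym fGSM eta1 x q_odd.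
set U := slice Omega eta in oU symU OU eF eH FH LF LH v1 v2 *.
set H := cdivx _ _ in eH FH LH fE v1 v2 tE.
have eFk k := even_iter_Er oU symU k eF.
have eHk k := even_iter_Er oU symU k eH.
have eEF : even_smooth U (iter m Er (F1 f eta)) := eFk m.
have eEH : even_smooth U (iter m Er H) := eHk m.
have oV : open (U `&` [set x | Defs.rad x != 0]) := open_off_axis oU.
have sA := smooth_axial oU symU oO OU eEF eEH.
have limA x (Ux : U x) := extend_r0_limit oU (fun y Uy => smooth_cont (proj1 eEF) Uy)
  (fun y Uy ry => iter_inv_r_dr oU symU m eF Uy ry) Ux.
have sradH : smooth U (fun x => Defs.rad x *: iter m Er H x).
  exact: (smooth_scale oU (@smooth_rad R p U) (proj1 eEH)).
(* The extension of the iterate for [F2] is [r E^m H]. It vanishes at [r = 0], in accordance with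
   the free choice of the direction there. *)
have limB x (Ux : U x) := extend_r0_limit oU (fun y Uy => smooth_cont sradH Uy)
  (fun y Uy ry => iter_dr_inv_r oU symU m eH FH Uy ry) Ux.
split.
- exact: (axial_laplacian_iterable oU symU oO OU eF eH LF LH fE).
- move=> x Ux; split; last by have [+ _] := limA x Ux.
  move=> rx j _; apply: (derivable_eq_near oV (conj Ux rx) (F := iter j Er (F1 f eta))).
    by move=> y [Uy ry]; apply: esym; exact: (iter_inv_r_dr oU symU j eF Uy ry).
  by have [sj _] := eFk j; exact: (smooth_has_partial sj Ux).
- move=> x Ux; split; last by have [+ _] := limB x Ux.
  move=> rx j _; apply: (derivable_eq_near oV (conj Ux rx) (F := iter j Er H)).
    move=> y [Uy ry]; rewrite /div_r (iter_dr_inv_r oU symU j eH FH Uy ry).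
    by rewrite scalerA mulVf// scale1r.
  by have [sj _] := eHk j; exact: (smooth_has_partial sj Ux).
- move=> xp r w r0 w1 Ox; set x := row_mx _ _ in Ox *.
  (* This uses [0 <= r]: the third component read by [meridian] is the norm of [r w]. *)
  have mx : meridian x = row_mx xp r%:M by rewrite /meridian row_mxKl row_mx_qnorm.
  have Ux := OU x Ox.
  rewrite (tE x Ox) /axial /lift /A /B /stemA /stemB -mx (limA _ Ux).2 (limB _ Ux).2.
  rewrite rad_meridian row_mx_qnorm// /qvec row_mxKr vecZ.
  by rewrite -clifford_scalerAr -clifford_scalerAl.
split; first exact: (smooth_C1_on (smooth_eq oO (fun x Ox => esym (tE x Ox)) sA)).
move=> x Ox; have Ux := OU x Ox.
have E : Defs.dirac (tau f) x = Defs.dirac (axial (iter m Er (F1 f eta)) (iter m Er H)) x.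
  by apply: eq_bigr => i _; congr (_ * _); exact: (derive_eq_near _ oO Ox tE).
apply: (etrans E); apply: etrans (dirac_axial oU symU oO OU eta1 eEF eEH Ox) _.
have [D1 D2] := iterated_vekua oU symU m eF eH v1 v2 Ux.
rewrite /lift D1 D2 !iterS.
have qE : 1 + m.*2%:R = q%:R :> R.
  by rewrite [in RHS](odd_double_pred_half q_odd) -natr1 addrC.
by rewrite qE subrr addNr mulr0 addr0.
Qed.
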